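(* Let $G$ be a finite group with homomorphisms $s,h:G\to\mathbb Z_2$, let $\omega$ be a normalized $U(1)$-valued 2-cocycle on $G$ (coefficients twisted by $s$), let $A=\mathbb C[G,\omega,s]$ with $\mathbb Z_2$-grading $h$, and let $V$ be a finite-dimensional orthogonal real representation of $G$. Let $A^V$ be the associated $\mathbb Z_2$-graded algebra of Dirac Hamiltonians, $\mathcal A(A^V)$ its algebraic classification, and $K(A^V)^G$ the classifying space of symmetric mass terms with basepoint $M_0$. For a finite-dimensional $Cl^{0,1}\hat\otimes A^V$-module $W$, choose an injective module map $W\hookrightarrow\mathcal U$ into the universe, and send $[W]$ to the path component of the element of $K(A^V)^G$ that equals $-M_0$ on the image of $W$ and equals $M_0$ on a complementary $Cl^{0,1}\hat\otimes A^V$-submodule. Then this assignment (''changing the sign of the mass term'') induces a well-defined map $$\mathcal A(A^V)\longrightarrow \pi_0\big(K(A^V)^G\big),$$ and this map is a group isomorphism.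
   Context: Symmetry algebra. $G$ acts on $U(1)$ by ${}^g a=a$ if $s(g)=0$ and ${}^g a=\bar a$ if $s(g)=1$; $\omega$ is a 2-cocycle for this action with $\omega(1,g)=\omega(g,1)=1$. $\mathbb C[G,\omega,s]$ is the real associative algebra that is a left $\mathbb C$-vector space with basis $G$, with $g\cdot g'=\omega(g,g')\,gg'$ and $g z={}^g z\, g$ for $z\in\mathbb C$ (where ${}^gz=z$ or $\bar z$ according to $s(g)=0$ or $1$). It is $\mathbb Z_2$-graded: $\mathbb C$ has degree $0$, $g$ has degree $h(g)$. Algebra $A^V$. Let $\tilde e_1,\dots,\tilde e_q$ be an orthonormal basis of $V$ and $\rho_V:G\to O(V)$ the representation. $A^V$ is the real algebra generated by $A$ and $\tilde e_1,\dots,\tilde e_q$ with relations $\tilde e_i^2=1$, $\tilde e_i\tilde e_j=-\tilde e_j\tilde e_i$ ($i\ne j$), $\tilde e_i z=z\tilde e_i$ for $z\in\mathbb C\subset A$, and $(-1)^{h(g)}g\,\tilde e_i\,(g)^{-1}=\rho_V(g)(\tilde e_i)$, where $(g)^{-1}$ is the inverse in the algebra. The $\tilde e_i$ have degree $1$. Clifford algebras and super tensor product. $Cl^{p,q}$ is the real algebra with anticommuting generators $e_1,\dots,e_p$ (squaring to $-1$) and $\tilde e_1,\dots,\tilde e_q$ (squaring to $+1$), all of degree 1. $\hat\otimes$ is the super tensor product over $\mathbb R$: $a\hat\otimes 1$ and $1\hat\otimes b$ anticommute if both $a,b$ have degree 1 and commute if one has degree 0. Algebraic classification. For a semisimple algebra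 $B$, $\mathcal M(B)$ is the free abelian group on isomorphism classes of irreducible (ungraded) $B$-modules. The inclusion $Cl^{0,1}\hat\otimes A^V\hookrightarrow Cl^{0,2}\hat\otimes A^V$ gives by restriction $i^*:\mathcal M(Cl^{0,2}\hat\otimes A^V)\to\mathcal M(Cl^{0,1}\hat\otimes A^V)$, and $\mathcal A(A^V):=\mathrm{coker}(i^* )$. Classifying space. Let $B=Cl^{0,1}\hat\otimes A^V$. The universe $\mathcal U=\bigoplus_{n\ge1}W_n$ is a countable direct sum of finite-dimensional irreducible $B$-modules in which each isomorphism class of irreducible $B$-module occurs infinitely often; $\rho$ is its representation and $M_0=\rho(\tilde e_1\hat\otimes1)$ with $\tilde e_1\in Cl^{0,1}$. Put $U_n=\bigoplus_{j\le n}W_j$. $K(A^V)^G$ is the space of linear maps $M$ on $\mathcal U$ such that for some $n$, $M$ preserves $U_n$ and equals $M_0$ on $\bigoplus_{j>n}W_j$, and such that $M$ (in place of $M_0$ as the action of $\tilde e_1\hat\otimes 1$) together with the given action of $A^V$ is again a representation of $B$. It carries the direct limit topology over $n$ of the spaces of such maps on $U_n$. The group structure on $\pi_0(K(A^V)^G)$ is induced by direct sum of operators, using an isomorphism of $B$-modules $\mathcal U\oplus\mathcal U\cong\mathcal U$ that permutes irreducible summands. *)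

(* Defs.v *)
From HB Require Import structures.
From mathcomp Require Import all_boot all_order all_algebra all_fingroup.
From mathcomp Require Import generic_quotient ring_quotient mxrepresentation.
From mathcomp Require Import complex.
From mathcomp Require Import freeg.
From mathcomp Require Import all_classical all_reals all_analysis.

Set Implicit Arguments.
Unset Strict Implicit.
Unset Printing Implicit Defensive.

Import Order.TTheory GRing.Theory Num.Theory numFieldNormedType.Exports.

Local Open Scope classical_set_scope.
Local Open Scope quotient_scope.
Local Open Scope ring_scope.

(* Associative unital R-algebras, as rings with a central structure morphism;  *)
(* unlike in [algType], 1 = 0 is not excluded, so that algebras presented by    *)
(* generators and relations are instances.                                    *)
Structure ralgebra (R : comNzRingType) := RAlgebra {
  ralg_sort :> pzRingType;
  alg : {rmorphism R -> ralg_sort};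
  alg_central : forall r a, alg r * a = a * alg r
}.

Definition algebra_morphism (R : comNzRingType) (A C : ralgebra R) (f : A -> C) :=
  [/\ {morph f : a b / a + b}, {morph f : a b / a * b}
    & forall r, f (alg A r) = alg C r].

Definition mx_ralgebra (R : comNzRingType) n : ralgebra R :=
  @RAlgebra R 'M[R]_n (@scalar_mx R n) (fun r a => esym (scalar_mxC r a)).

Section Presentation.
Variables (R : comNzRingType) (X : Type).

Inductive aexp : Type :=
  | Gen of X
  | Cst of R
  | Add of aexp & aexp
  | Mul of aexp & aexp.

HB.instance Definition _ := gen_eqMixin aexp.
HB.instance Definition _ := gen_choiceMixin aexp.

Variable rel : aexp -> aexp -> Prop.

(* The smallest congruence containing [rel] and the axioms of R-algebras.      *)
Inductive acong : aexp -> aexp -> Prop :=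
  | acong_rel t u : rel t u -> acong t u
  | acong_refl t : acong t t
  | acong_sym t u : acong t u -> acong u t
  | acong_trans t u v : acong t u -> acong u v -> acong t v
  | acong_add t t' u u' :
      acong t t' -> acong u u' -> acong (Add t u) (Add t' u')
  | acong_mul t t' u u' :
      acong t t' -> acong u u' -> acong (Mul t u) (Mul t' u')
  | acong_addA t u v : acong (Add t (Add u v)) (Add (Add t u) v)
  | acong_addC t u : acong (Add t u) (Add u t)
  | acong_add0 t : acong (Add (Cst 0) t) t
  | acong_mulA t u v : acong (Mul t (Mul u v)) (Mul (Mul t u) v)
  | acong_mul1l t : acong (Mul (Cst 1) t) t
  | acong_mulDl t u v : acong (Mul (Add t u) v) (Add (Mul t v) (Mul u v))
  | acong_mulDr t u v : acong (Mul t (Add u v)) (Add (Mul t u) (Mul t v))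
  | acong_mul0l t : acong (Mul (Cst 0) t) (Cst 0)
  | acong_cstD r r' : acong (Cst (r + r')) (Add (Cst r) (Cst r'))
  | acong_cstM r r' : acong (Cst (r * r')) (Mul (Cst r) (Cst r'))
  | acong_cstC r t : acong (Mul (Cst r) t) (Mul t (Cst r)).

Definition acongb (t u : aexp) : bool := `[< acong t u >].

Lemma acongb_equiv : equiv_class_of acongb.
Proof.
split=> [t|t u|u t v].
- by apply/asboolP; exact: acong_refl.
- by apply/asboolP/asboolP; exact: acong_sym.
- by move=> /asboolP tu /asboolP uv; apply/asboolP; exact: acong_trans tu uv.
Qed.

Canonical acongb_equivRel := EquivRelPack acongb_equiv.
Canonical acongb_encModRel := defaultEncModRel acongb.

(* The R-algebra with generators X and relations [rel].                       *)
Definition palg := {eq_quot acongb}.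
HB.instance Definition _ : EqQuotient aexp acongb palg := EqQuotient.on palg.
HB.instance Definition _ := Choice.on palg.

Definition pcls (t : aexp) : palg := \pi_palg t.

Lemma pcls_eq t u : pcls t = pcls u <-> acong t u.
Proof. by split=> [/eqmodP/asboolP//|tu]; apply/eqmodP/asboolP. Qed.

Lemma pcls_repr x : pcls (repr x) = x. Proof. exact: reprK. Qed.

Lemma repr_pcls t : acong (repr (pcls t)) t.
Proof. by apply/pcls_eq; rewrite pcls_repr. Qed.

Definition padd (x y : palg) := pcls (Add (repr x) (repr y)).
Definition pmul (x y : palg) := pcls (Mul (repr x) (repr y)).
Definition popp (x : palg) := pmul (pcls (Cst (-1))) x.

Lemma pcls_add t u : padd (pcls t) (pcls u) = pcls (Add t u).
Proof. by apply/pcls_eq; apply: acong_add; exact: repr_pcls. Qed.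
Lemma pcls_mul t u : pmul (pcls t) (pcls u) = pcls (Mul t u).
Proof. by apply/pcls_eq; apply: acong_mul; exact: repr_pcls. Qed.

Lemma palg_ind (P : palg -> Prop) : (forall t, P (pcls t)) -> forall x, P x.
Proof. by move=> Pt x; rewrite -[x]pcls_repr. Qed.

Lemma paddA : associative padd.
Proof.
elim/palg_ind=> t; elim/palg_ind=> u; elim/palg_ind=> v.
by rewrite !pcls_add; apply/pcls_eq; exact: acong_addA.
Qed.
Lemma paddC : commutative padd.
Proof.
elim/palg_ind=> t; elim/palg_ind=> u.
by rewrite !pcls_add; apply/pcls_eq; exact: acong_addC.
Qed.
Lemma padd0 : left_id (pcls (Cst 0)) padd.
Proof. by elim/palg_ind=> t; rewrite pcls_add; apply/pcls_eq; exact: acong_add0. Qed.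
Lemma paddN : left_inverse (pcls (Cst 0)) popp padd.
Proof.
elim/palg_ind=> t; rewrite /popp pcls_mul pcls_add; apply/pcls_eq.
apply: acong_trans (acong_add (acong_refl _) (acong_sym (acong_mul1l t))) _.
apply: acong_trans (acong_sym (acong_mulDl _ _ _)) _.
apply: acong_trans (acong_mul (acong_sym (acong_cstD _ _)) (acong_refl t)) _.
by rewrite addNr; exact: acong_mul0l.
Qed.
HB.instance Definition _ := GRing.isZmodule.Build palg paddA paddC padd0 paddN.

Lemma pmulA : associative pmul.
Proof.
elim/palg_ind=> t; elim/palg_ind=> u; elim/palg_ind=> v.
by rewrite !pcls_mul; apply/pcls_eq; exact: acong_mulA.
Qed.
Lemma pmul1l : left_id (pcls (Cst 1)) pmul.
Proof. by elim/palg_ind=> t; rewrite pcls_mul; apply/pcls_eq; exact: acong_mul1l. Qed.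
Lemma pmul1r : right_id (pcls (Cst 1)) pmul.
Proof.
elim/palg_ind=> t; rewrite pcls_mul; apply/pcls_eq.
exact: acong_trans (acong_sym (acong_cstC _ _)) (acong_mul1l _).
Qed.
Lemma pmulDl : left_distributive pmul padd.
Proof.
elim/palg_ind=> t; elim/palg_ind=> u; elim/palg_ind=> v.
by rewrite !(pcls_add, pcls_mul); apply/pcls_eq; exact: acong_mulDl.
Qed.
Lemma pmulDr : right_distributive pmul padd.
Proof.
elim/palg_ind=> t; elim/palg_ind=> u; elim/palg_ind=> v.
by rewrite !(pcls_add, pcls_mul); apply/pcls_eq; exact: acong_mulDr.
Qed.
HB.instance Definition _ :=
  GRing.Zmodule_isPzRing.Build palg pmulA pmul1l pmul1r pmulDl pmulDr.

Definition pcst (r : R) : palg := pcls (Cst r).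

Lemma pcst_nmod : nmod_morphism pcst.
Proof.
by split=> // r r'; rewrite -[RHS]/(padd _ _) pcls_add; apply/pcls_eq; exact: acong_cstD.
Qed.
Lemma pcst_monoid : monoid_morphism pcst.
Proof.
by split=> // r r'; rewrite -[RHS]/(pmul _ _) pcls_mul; apply/pcls_eq; exact: acong_cstM.
Qed.
HB.instance Definition _ := GRing.isNmodMorphism.Build R palg pcst pcst_nmod.
HB.instance Definition _ := GRing.isMonoidMorphism.Build R palg pcst pcst_monoid.

Lemma pcst_central r (x : palg) : pcst r * x = x * pcst r.
Proof.
elim/palg_ind: x => t; rewrite -[LHS]/(pmul _ _) -[RHS]/(pmul _ _) !pcls_mul.
by apply/pcls_eq; exact: acong_cstC.
Qed.

Definition presented : ralgebra R := RAlgebra pcst_central.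

Definition pgen (x : X) : presented := pcls (Gen x).

Lemma pclsD t u : pcls (Add t u) = pcls t + pcls u.
Proof. by rewrite -pcls_add. Qed.
Lemma pclsM t u : pcls (Mul t u) = pcls t * pcls u.
Proof. by rewrite -pcls_mul. Qed.
Section Lift.
Variables (C : ralgebra R) (f : X -> C).

Fixpoint aeval (t : aexp) : C :=
  match t with
  | Gen x => f x
  | Cst r => alg C r
  | Add t u => aeval t + aeval u
  | Mul t u => aeval t * aeval u
  end.

Hypothesis f_rel : forall t u, rel t u -> aeval t = aeval u.

Lemma aeval_cong t u : acong t u -> aeval t = aeval u.
Proof.
elim=> {t u} /=.
- exact: f_rel.
- by [].
- by [].
- by move=> t u v _ -> _ ->.
- by move=> t t' u u' _ -> _ ->.
- by move=> t t' u u' _ -> _ ->.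
- by move=> t u v; rewrite addrA.
- by move=> t u; rewrite addrC.
- by move=> t; rewrite rmorph0 add0r.
- by move=> t u v; rewrite mulrA.
- by move=> t; rewrite rmorph1 mul1r.
- by move=> t u v; rewrite mulrDl.
- by move=> t u v; rewrite mulrDr.
- by move=> t; rewrite rmorph0 mul0r.
- by move=> r r'; rewrite rmorphD.
- by move=> r r'; rewrite rmorphM.
- by move=> r t; rewrite alg_central.
Qed.

Definition plift (x : presented) : C := aeval (repr x).

Lemma plift_pcls t : plift (pcls t) = aeval t.
Proof. exact/aeval_cong/repr_pcls. Qed.

Lemma plift_gen x : plift (pgen x) = f x. Proof. exact: plift_pcls. Qed.

Lemma plift_morphism : algebra_morphism plift.
Proof.
split=> [||r]; last exact: plift_pcls.
- by elim/palg_ind=> t; elim/palg_ind=> u; rewrite -pclsD !plift_pcls.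
- by elim/palg_ind=> t; elim/palg_ind=> u; rewrite -pclsM !plift_pcls.
Qed.

End Lift.

(* The homogeneous elements of degree d for the grading in which a generator   *)
(* x is homogeneous of degree d when [gdeg d x]; [true] is the odd degree.     *)
Inductive phomog (gdeg : bool -> X -> Prop) : bool -> presented -> Prop :=
  | phomog_gen d x : gdeg d x -> phomog gdeg d (pgen x)
  | phomog_alg r : phomog gdeg false (alg presented r)
  | phomog0 d : phomog gdeg d 0
  | phomogD d x y : phomog gdeg d x -> phomog gdeg d y -> phomog gdeg d (x + y)
  | phomogM d e x y :
      phomog gdeg d x -> phomog gdeg e y -> phomog gdeg (d (+) e) (x * y).

End Presentation.

Arguments Gen {R X}.
Arguments Cst {R X}.

Structure superalgebra (R : comNzRingType) := SuperAlgebra {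
  super_sort :> ralgebra R;
  homog : bool -> set super_sort
}.

(* The relations saying that [k] maps an algebra A homomorphically to the      *)
(* presented algebra.                                                         *)
Inductive emb_rel (R : comNzRingType) (X : Type) (A : ralgebra R) (k : A -> X) :
    aexp R X -> aexp R X -> Prop :=
  | emb_add a b : emb_rel k (Gen (k (a + b))) (Add (Gen (k a)) (Gen (k b)))
  | emb_mul a b : emb_rel k (Gen (k (a * b))) (Mul (Gen (k a)) (Gen (k b)))
  | emb_alg r : emb_rel k (Gen (k (alg A r))) (Cst r).

Section SuperTensor.
Variable R : comNzRingType.

(* The super tensor product A (x)^ B: the algebra generated by A and B subject *)
(* to (1 (x) b)(a (x) 1) = (-1)^(|a||b|) (a (x) 1)(1 (x) b).                   *)
Inductive st_rel (A B : superalgebra R) :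
    aexp R (A + B)%type -> aexp R (A + B)%type -> Prop :=
  | st_embl t u : emb_rel inl t u -> st_rel t u
  | st_embr t u : emb_rel inr t u -> st_rel t u
  | st_comm d e a b : homog d a -> homog e b ->
      st_rel (Mul (Gen (inr b)) (Gen (inl a)))
             (Mul (Cst ((-1) ^+ (d && e))) (Mul (Gen (inl a)) (Gen (inr b)))).

Definition stensor (A B : superalgebra R) : ralgebra R := presented (@st_rel A B).

Definition st_inl (A B : superalgebra R) (a : A) : stensor A B :=
  pgen (@st_rel A B) (inl a).
Definition st_inr (A B : superalgebra R) (b : B) : stensor A B :=
  pgen (@st_rel A B) (inr b).

Lemma st_inl_morphism A B : algebra_morphism (@st_inl A B).
Proof.
split=> [a b|a b|r].
- by have /pcls_eq := acong_rel (@st_embl A B _ _ (emb_add (@inl A B) a b)); rewrite pclsD.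
- by have /pcls_eq := acong_rel (@st_embl A B _ _ (emb_mul (@inl A B) a b)); rewrite pclsM.
- by have /pcls_eq := acong_rel (@st_embl A B _ _ (emb_alg (@inl A B) r)).
Qed.

Lemma st_inr_morphism A B : algebra_morphism (@st_inr A B).
Proof.
split=> [a b|a b|r].
- by have /pcls_eq := acong_rel (@st_embr A B _ _ (emb_add (@inr A B) a b)); rewrite pclsD.
- by have /pcls_eq := acong_rel (@st_embr A B _ _ (emb_mul (@inr A B) a b)); rewrite pclsM.
- by have /pcls_eq := acong_rel (@st_embr A B _ _ (emb_alg (@inr A B) r)).
Qed.

Lemma st_swap (A B : superalgebra R) d e (a : A) (b : B) :
  homog d a -> homog e b ->
  st_inr A b * st_inl B a = alg _ ((-1) ^+ (d && e)) * (st_inl B a * st_inr A b).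
Proof.
by move=> ad be; have /pcls_eq := acong_rel (st_comm ad be); rewrite !pclsM.
Qed.

Section Functoriality.
Variables (A A' B : superalgebra R) (f : A -> A').
Hypothesis f_morph : algebra_morphism f.
Hypothesis f_homog : forall d a, homog d a -> homog d (f a).

Definition st_map_gen (x : A + B) : stensor A' B :=
  match x with inl a => st_inl B (f a) | inr b => st_inr A' b end.

Lemma st_map_rel t u : @st_rel A B t u -> aeval st_map_gen t = aeval st_map_gen u.
Proof.
have [fD fM fA] := f_morph.
have [lD lM lA] := st_inl_morphism A' B; have [rD rM rA] := st_inr_morphism A' B.
case=> {t u} [t u []|t u []|d e a b ad be] /=.
- by move=> a b; rewrite fD lD.
- by move=> a b; rewrite fM lM.
- by move=> r; rewrite fA lA.
- by move=> a b; rewrite rD.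
- by move=> a b; rewrite rM.
- by move=> r; rewrite rA.
- by rewrite (st_swap (f_homog ad) be).
Qed.

Definition st_map : stensor A B -> stensor A' B := plift st_map_gen.

Lemma st_map_morphism : algebra_morphism st_map.
Proof. exact: plift_morphism st_map_rel. Qed.

End Functoriality.

End SuperTensor.

Section Clifford.
Variable R : comNzRingType.

(* [inl i] is the generator e_i of square -1, [inr j] the generator e~_j of    *)
(* square +1.                                                                 *)
Inductive cl_rel p q :
    aexp R ('I_p + 'I_q)%type -> aexp R ('I_p + 'I_q)%type -> Prop :=
  | cl_neg i : cl_rel (Mul (Gen (inl i)) (Gen (inl i))) (Cst (-1))
  | cl_pos j : cl_rel (Mul (Gen (inr j)) (Gen (inr j))) (Cst 1)
  | cl_anti x y : x != y ->
      cl_rel (Mul (Gen x) (Gen y)) (Mul (Cst (-1)) (Mul (Gen y) (Gen x))).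

Definition Cl p q : superalgebra R :=
  @SuperAlgebra R (presented (@cl_rel p q)) (phomog (fun d _ => d = true)).

Definition cl_gen p q (x : 'I_p + 'I_q) : Cl p q := pgen (@cl_rel p q) x.

Section Inclusion.
Variables (p q q' : nat) (le_qq' : (q <= q')%N).

Definition cl_incl_gen (x : 'I_p + 'I_q) : Cl p q' :=
  match x with
  | inl i => cl_gen (inl i)
  | inr j => cl_gen (inr (widen_ord le_qq' j))
  end.

Lemma cl_incl_rel t u :
  @cl_rel p q t u -> aeval cl_incl_gen t = aeval cl_incl_gen u.
Proof.
case=> {t u} [i|j|x y xy] /=.
- have /pcls_eq := acong_rel (@cl_neg p q' i).
  by rewrite pclsM.
- have /pcls_eq := acong_rel (@cl_pos p q' (widen_ord le_qq' j)).
  by rewrite pclsM.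
- pose w (x : 'I_p + 'I_q) : 'I_p + 'I_q' :=
    match x with inl i => inl i | inr j => inr (widen_ord le_qq' j) end.
  have wE z : cl_incl_gen z = cl_gen (w z) by case: z.
  have w_inj : w x != w y.
    apply: contra_neq xy; case: x y => [i|j] [i'|j'] //= [] //.
      by move=> ->.
    by move=> jj'; congr inr; apply: val_inj.
  have /pcls_eq := acong_rel (cl_anti w_inj).
  by rewrite !pclsM !wE.
Qed.

Definition cl_incl : Cl p q -> Cl p q' := plift cl_incl_gen.

Lemma cl_incl_morphism : algebra_morphism cl_incl.
Proof. exact: plift_morphism cl_incl_rel. Qed.

Lemma cl_incl_homog d (a : Cl p q) : homog d a -> homog d (cl_incl a).
Proof.
have [iD iM iA] := cl_incl_morphism.
have i0 : cl_incl 0 = 0 by rewrite -(rmorph0 (alg (Cl p q))) iA rmorph0.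
elim=> {d a}.
- move=> d x dx; rewrite /cl_incl (plift_gen cl_incl_rel).
  by case: x dx => x dx; exact: phomog_gen.
- by move=> r; rewrite iA; exact: phomog_alg.
- by move=> d; rewrite i0; exact: phomog0.
- by move=> d x y _ hx _ hy; rewrite iD; exact: phomogD.
- by move=> d e x y _ hx _ hy; rewrite iM; exact: phomogM.
Qed.

End Inclusion.
End Clifford.

Section SymmetryAlgebra.
Variables (R : realType) (gT : finGroupType).
Local Notation C := R[i].

Definition twist (b : bool) (z : C) : C := if b then conjc z else z.

(* Z_2 is [bool] with addition [addb]; U(1) is the set of complex numbers of   *)
(* norm 1.                                                                    *)
Record symmetry_data := Symmetry {
  antiu : gT -> bool;
  parity : gT -> bool;
  cocy : gT -> gT -> C;
  antiuM : {morph antiu : x y / (x * y)%g >-> x (+) y};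
  parityM : {morph parity : x y / (x * y)%g >-> x (+) y};
  cocy_norm : forall x y, `|cocy x y| = 1;
  cocyP : forall x y z,
    twist (antiu x) (cocy y z) * cocy x (y * z)%g = cocy (x * y)%g z * cocy x y;
  cocy1l : forall x, cocy 1%g x = 1;
  cocy1r : forall x, cocy x 1%g = 1
}.

Variable D : symmetry_data.
Local Notation s := (antiu D).
Local Notation om := (cocy D).

Lemma twist_is_nmod b : nmod_morphism (twist b).
Proof.
case: b; split=> // [|x y]; [exact: (rmorph0 (@conjc R))|exact: (rmorphD (@conjc R))].
Qed.
Lemma twist_is_monoid b : monoid_morphism (twist b).
Proof.
case: b; split=> // [|x y]; [exact: (rmorph1 (@conjc R))|exact: (rmorphM (@conjc R))].
Qed.
HB.instance Definition _ b := GRing.isNmodMorphism.Build C C (twist b) (twist_is_nmod b).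
HB.instance Definition _ b := GRing.isMonoidMorphism.Build C C (twist b) (twist_is_monoid b).

Lemma twist_real b (r : R) : twist b r%:C%C = r%:C%C.
Proof. by case: b; rewrite //= oppr0. Qed.
Lemma twistD b b' z : twist b (twist b' z) = twist (b (+) b') z.
Proof. by case: b; case: b' => //=; rewrite conjcK. Qed.

Lemma antiu1 : s 1%g = false.
Proof. by have := antiuM D 1%g 1%g; rewrite mulg1; case: (s 1%g). Qed.

(* The twisted group algebra C[G, omega, s]; the function a stands for the     *)
(* element \sum_g (a g) g.                                                    *)
Definition tgalg := {ffun gT -> C}.
HB.instance Definition _ := GRing.Zmodule.on tgalg.

(* From (z g)(z' g') = z (^g z') omega(g, g') g g'.                           *)
Definition tg_mul (a b : tgalg) : tgalg :=
  [ffun x => \sum_g a g * twist (s g) (b (g^-1 * x)%g) * om g (g^-1 * x)%g].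
Definition tg_scalar (z : C) : tgalg := [ffun x => if x == 1%g then z else 0].
Definition tg_one := tg_scalar 1.

Lemma tg_mulA : associative tg_mul.
Proof.
move=> a b c; apply/ffunP=> x; rewrite !ffunE.
under eq_bigr => g _ do
  rewrite ffunE rmorph_sum mulr_sumr mulr_suml
          (reindex_inj (mulgI g^-1%g)) /=.
rewrite exchange_big /=; apply: eq_bigr => k _.
rewrite ffunE !mulr_suml; apply: eq_bigr => g _.
have -> : ((g^-1 * k)^-1 * (g^-1 * x) = k^-1 * x)%g.
  by rewrite invMg invgK -mulgA mulKVg.
rewrite !rmorphM /= twistD -antiuM mulKVg.
have := cocyP D g (g^-1 * k)%g (k^-1 * x)%g.
have -> : (g^-1 * k * (k^-1 * x) = g^-1 * x)%g by rewrite mulgA mulgK.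
rewrite mulKVg => E.
rewrite -!mulrA; congr (_ * (_ * _)).
rewrite E [RHS]mulrCA; congr (_ * _).
by rewrite mulrC.
Qed.

Lemma tg_mul1l : left_id tg_one tg_mul.
Proof.
move=> a; apply/ffunP=> x; rewrite ffunE (bigD1 1%g) //= big1 ?addr0.
  by rewrite ffunE eqxx antiu1 invg1 mul1g cocy1l mulr1 mul1r.
by move=> g /negPf g1; rewrite ffunE g1 !mul0r.
Qed.

Lemma tg_mul1r : right_id tg_one tg_mul.
Proof.
move=> a; apply/ffunP=> x; rewrite ffunE (bigD1 x) //= big1 ?addr0.
  by rewrite ffunE mulVg eqxx rmorph1 cocy1r !mulr1.
move=> g gx; rewrite ffunE; case: eqP => [E|_]; last by rewrite rmorph0 mulr0 mul0r.
by case/eqP: gx; rewrite -[g]mulg1 -E mulKVg.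
Qed.

Lemma tg_mulDl : left_distributive tg_mul +%R.
Proof.
move=> a b c; apply/ffunP=> x; rewrite !ffunE -big_split /=.
by apply: eq_bigr => g _; rewrite ffunE !mulrDl.
Qed.
Lemma tg_mulDr : right_distributive tg_mul +%R.
Proof.
move=> a b c; apply/ffunP=> x; rewrite !ffunE -big_split /=.
by apply: eq_bigr => g _; rewrite ffunE rmorphD /= mulrDr mulrDl.
Qed.
HB.instance Definition _ := GRing.Zmodule_isPzRing.Build tgalg
  tg_mulA tg_mul1l tg_mul1r tg_mulDl tg_mulDr.

Definition tg_real (r : R) : tgalg := tg_scalar r%:C%C.

Lemma tg_real_nmod : nmod_morphism tg_real.
Proof.
split=> [|r r']; apply/ffunP=> x; rewrite !ffunE ?rmorph0 ?rmorphD; case: eqP => //.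
by rewrite addr0.
Qed.
Lemma tg_real_mull r (a : tgalg) x : (tg_real r * a) x = r%:C%C * a x.
Proof.
rewrite ffunE (bigD1 1%g) //= big1 ?addr0.
  by rewrite ffunE eqxx antiu1 invg1 mul1g cocy1l mulr1.
by move=> g /negPf g1; rewrite ffunE g1 !mul0r.
Qed.
Lemma tg_real_monoid : monoid_morphism tg_real.
Proof.
split=> [|r r']; apply/ffunP=> x; first by rewrite !ffunE rmorph1.
by rewrite tg_real_mull !ffunE; case: eqP; rewrite ?mulr0 // rmorphM.
Qed.
HB.instance Definition _ := GRing.isNmodMorphism.Build R tgalg tg_real tg_real_nmod.
HB.instance Definition _ := GRing.isMonoidMorphism.Build R tgalg tg_real tg_real_monoid.

Lemma tg_real_central r (a : tgalg) : tg_real r * a = a * tg_real r.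
Proof.
apply/ffunP=> x; rewrite tg_real_mull ffunE (bigD1 x) //= big1 ?addr0.
  by rewrite ffunE mulVg eqxx twist_real cocy1r mulr1 mulrC.
move=> g gx; rewrite ffunE; case: eqP => [E|_]; last by rewrite rmorph0 mulr0 mul0r.
by case/eqP: gx; rewrite -[g]mulg1 -E mulKVg.
Qed.

Definition tg_ralgebra : ralgebra R := RAlgebra tg_real_central.

Definition tg_delta (g : gT) : tgalg := [ffun x => if x == g then 1 else 0].

Definition tg_inv (g : gT) : tgalg :=
  [ffun x => if x == g^-1%g then twist (s g) (om g g^-1%g)^-1 else 0].

Lemma tg_mulV g : tg_delta g * tg_inv g = 1.
Proof.
apply/ffunP=> x; rewrite !ffunE (bigD1 g) //= big1 ?addr0; last first.
  by move=> k /negPf kg; rewrite ffunE kg !mul0r.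
rewrite !ffunE eqxx mul1r -[in LHS](inj_eq (mulgI g)) mulKVg mulgV.
case: eqP => [->|_]; last by rewrite rmorph0 mul0r.
rewrite twistD addbb /= mulg1 mulVf //.
by rewrite -normr_eq0 cocy_norm oner_eq0.
Qed.

Lemma tg_Vmul g : tg_inv g * tg_delta g = 1.
Proof.
pose d : tgalg := [ffun x => if x == g then
  twist (s g^-1%g) (twist (s g) (om g g^-1%g)^-1 * om g^-1%g g)^-1 else 0].
have omnz x y : om x y != 0 by rewrite -normr_eq0 cocy_norm oner_eq0.
have invd : tg_inv g * d = 1.
  apply/ffunP=> x; rewrite !ffunE (bigD1 g^-1%g) //= big1 ?addr0; last first.
    by move=> k /negPf kg; rewrite ffunE kg !mul0r.
  rewrite !ffunE eqxx invgK -[in LHS](inj_eq (mulgI g^-1%g)) mulKg mulVg.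
  case: eqP => [->|_]; last by rewrite rmorph0 mulr0 mul0r.
  rewrite mulg1 twistD addbb /= mulrAC mulfV //.
  by rewrite mulf_neq0 // fmorph_eq0 invr_eq0.
by rewrite -[X in _ * X]mulr1 -invd (mulrA (tg_delta g)) tg_mulV mul1r.
Qed.

Definition tg_homog (d : bool) : set tgalg :=
  [set a | forall g, a g != 0 -> parity D g = d].

Definition symalg : superalgebra R := @SuperAlgebra R tg_ralgebra tg_homog.

Section DiracAlgebra.
Variables (q : nat) (rV : gT -> 'M[R]_q).

(* V = R^q with its standard orthonormal basis, G acting on column vectors.    *)
Inductive dirac_rel :
    aexp R (symalg + 'I_q)%type -> aexp R (symalg + 'I_q)%type -> Prop :=
  | dirac_emb t u : emb_rel inl t u -> dirac_rel t u
  | dirac_sq i : dirac_rel (Mul (Gen (inr i)) (Gen (inr i))) (Cst 1)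
  | dirac_anti i j : i != j ->
      dirac_rel (Mul (Gen (inr i)) (Gen (inr j)))
                (Mul (Cst (-1)) (Mul (Gen (inr j)) (Gen (inr i))))
  | dirac_cplx i (z : C) :
      dirac_rel (Mul (Gen (inr i)) (Gen (inl (tg_scalar z))))
                (Mul (Gen (inl (tg_scalar z))) (Gen (inr i)))
  | dirac_conj g i :
      dirac_rel
        (Mul (Cst ((-1) ^+ parity D g))
           (Mul (Mul (Gen (inl (tg_delta g))) (Gen (inr i)))
                (Gen (inl (tg_inv g)))))
        (\big[@Add R _/Cst 0]_(j < q) Mul (Cst (rV g j i)) (Gen (inr j))).

Definition dirac_gdeg (d : bool) (x : symalg + 'I_q) : Prop :=
  match x with inl a => homog d a | inr _ => d = true end.

Definition dirac_alg : superalgebra R :=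
  @SuperAlgebra R (presented dirac_rel) (phomog dirac_gdeg).

End DiracAlgebra.
End SymmetryAlgebra.

Section Modules.
Variable R : realType.

(* Finite-dimensional left modules, as matrix representations on columns.      *)
Record fdmod (B : ralgebra R) := FdMod {
  fd_dim : nat;
  fd_act : B -> 'M[R]_fd_dim;
  fd_morphism : @algebra_morphism R B (mx_ralgebra R fd_dim) fd_act
}.

Section FixedAlgebra.
Variable B : ralgebra R.

Definition fd_iso (S T : fdmod B) : Prop :=
  exists (P : 'M[R]_(fd_dim T, fd_dim S)) (Q : 'M[R]_(fd_dim S, fd_dim T)),
    [/\ P *m Q = 1%:M, Q *m P = 1%:M
      & forall b, P *m fd_act S b = fd_act T b *m P].

Lemma fd_iso_refl S : fd_iso S S.
Proof. by exists 1%:M, 1%:M; split=> [||b]; rewrite ?mul1mx ?mulmx1. Qed.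

Lemma fd_iso_sym S T : fd_iso S T -> fd_iso T S.
Proof.
case=> P [Q [PQ QP PE]]; exists Q, P; split=> // b.
by rewrite -[LHS]mulmx1 -PQ mulmxA -(mulmxA Q) -PE !mulmxA QP mul1mx.
Qed.

Lemma fd_iso_trans S T U : fd_iso S T -> fd_iso T U -> fd_iso S U.
Proof.
case=> P [Q [PQ QP PE]] [P' [Q' [PQ' QP' PE']]]; exists (P' *m P), (Q *m Q').
split=> [||b].
- by rewrite mulmxA -(mulmxA P') PQ mulmx1.
- by rewrite mulmxA -(mulmxA Q) QP' mulmx1.
- by rewrite -mulmxA PE mulmxA PE' mulmxA.
Qed.

Definition fd_irreducible (S : fdmod B) : Prop :=
  (0 < fd_dim S)%N /\
  forall E : {vspace 'cV[R]_(fd_dim S)},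
    (forall b v, v \in E -> fd_act S b *m v \in E) -> E = 0%VS \/ E = fullv.

Record irrmod := IrrMod { irr_mod :> fdmod B; irrP : fd_irreducible irr_mod }.

HB.instance Definition _ := gen_eqMixin irrmod.
HB.instance Definition _ := gen_choiceMixin irrmod.

Definition irr_isob (S T : irrmod) : bool := `[< fd_iso S T >].

Lemma irr_isob_equiv : equiv_class_of irr_isob.
Proof.
split=> [S|S T|T S U]; first exact/asboolP/fd_iso_refl.
  by apply/asboolP/asboolP; exact: fd_iso_sym.
by move=> /asboolP ST /asboolP TU; apply/asboolP; exact: fd_iso_trans ST TU.
Qed.
Canonical irr_isob_equivRel := EquivRelPack irr_isob_equiv.
Canonical irr_isob_encModRel := defaultEncModRel irr_isob.

Definition irrcls := {eq_quot irr_isob}.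
HB.instance Definition _ : EqQuotient irrmod irr_isob irrcls := EqQuotient.on irrcls.
HB.instance Definition _ := Choice.on irrcls.

(* The group written M(B).                                                    *)
Definition modgrp := {freeg irrcls / int}.
HB.instance Definition _ := GRing.Lmodule.on modgrp.

Section DirectSum.
Variables (k : nat) (S : 'I_k -> fdmod B).

Definition fd_dsum_act (b : B) : 'M[R]_(\sum_i fd_dim (S i)) :=
  \mxdiag_i fd_act (S i) b.

Lemma fd_dsum_morphism : @algebra_morphism R B (mx_ralgebra R _) fd_dsum_act.
Proof.
split=> [a b|a b|r]; rewrite /fd_dsum_act.
- by rewrite -mxdiagD; apply: eq_mxdiag => i; have [-> _ _] := fd_morphism (S i).
- rewrite -[RHS]/(_ *m _) [X in _ = _ *m X]/mxdiag mul_mxdiag_mxblock.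
  apply: eq_mxblock => i j.
  have [_ fM _] := fd_morphism (S i).
  by case: eqVneq => [<-|_]; [rewrite !conform_mx_id fM|rewrite mulmx0].
- rewrite -[RHS]mxdiagZ; apply: eq_mxdiag => i.
  by have [_ _ ->] := fd_morphism (S i).
Qed.

Definition fd_dsum : fdmod B := FdMod fd_dsum_morphism.
End DirectSum.

(* [S] in M(B): the sum of the classes of the summands in a decomposition of S *)
(* into irreducibles (one exists and the sum is unique when B is semisimple).  *)
Definition modclass (S : fdmod B) : modgrp :=
  xget 0 [set x | exists k (T : 'I_k -> irrmod),
    fd_iso S (fd_dsum (fun i => irr_mod (T i))) /\
    x = \sum_i << \pi_irrcls (T i) >>].

End FixedAlgebra.

Section Restriction.
Variables (B B' : ralgebra R) (f : B -> B') (f_morph : algebra_morphism f).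

Lemma fd_res_morphism (S : fdmod B') :
  @algebra_morphism R B (mx_ralgebra R _) (fun b => fd_act S (f b)).
Proof.
have [fD fM fA] := f_morph; have [SD SM SA] := fd_morphism S.
by split=> [a b|a b|r]; rewrite ?fD ?fM ?fA ?SD ?SM ?SA.
Qed.

Definition fd_res (S : fdmod B') : fdmod B := FdMod (fd_res_morphism S).

Definition modres : modgrp B' -> modgrp B :=
  fglift (fun c : irrcls B' => modclass (fd_res (repr c)) : modgrp B).

Definition modres_im : {pred modgrp B} := fun x => `[< exists y, modres y = x >].

Lemma modres_im_zmod : zmod_closed modres_im.
Proof.
have resB : {morph modres : x y / x - y} by move=> x y; exact: lift_is_additive.
split; first by apply/asboolP; exists 0; rewrite -[0](subrr 0) resB subrr.
move=> x y /asboolP[x' <-] /asboolP[y' <-].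
by apply/asboolP; exists (x' - y'); rewrite resB.
Qed.
HB.instance Definition _ := GRing.isZmodClosed.Build (modgrp B) modres_im modres_im_zmod.

Definition modcoker := Quotient.quot modres_im.

Definition cokercls (x : modgrp B) : modcoker := \pi_modcoker x.

End Restriction.

Section Universe.
Variables (B : ralgebra R) (W : nat -> fdmod B).

(* The direct sum of the W n: finitely supported sections.                     *)
Record universe := Universe {
  ucomp :> forall n, 'cV[R]_(fd_dim (W n));
  ufin : exists N, forall n, (N <= n)%N -> ucomp n = 0
}.

Lemma universeP (u v : universe) : (forall n, u n = v n) -> u = v.
Proof.
case: u v => [u uf] [v vf] /= uv.
have E : u = v by apply: functional_extensionality_dep.
by case: _ / E vf => vf; congr Universe; exact: Prop_irrelevance.
Qed.

HB.instance Definition _ := gen_eqMixin universe.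
HB.instance Definition _ := gen_choiceMixin universe.

Lemma uzero_fin : exists N, forall n, (N <= n)%N -> 0 = 0 :> 'cV[R]_(fd_dim (W n)).
Proof. by exists 0. Qed.
Definition uzero := Universe uzero_fin.

Lemma uadd_fin (u v : universe) : exists N, forall n, (N <= n)%N -> u n + v n = 0.
Proof.
have [[N Nu] [M Mv]] := (ufin u, ufin v); exists (maxn N M) => n.
by rewrite geq_max => /andP[/Nu -> /Mv ->]; rewrite addr0.
Qed.
Definition uadd u v := Universe (uadd_fin u v).

Lemma uopp_fin (u : universe) : exists N, forall n, (N <= n)%N -> - u n = 0.
Proof. by have [N Nu] := ufin u; exists N => n /Nu ->; rewrite oppr0. Qed.
Definition uopp u := Universe (uopp_fin u).

Lemma uscale_fin r (u : universe) : exists N, forall n, (N <= n)%N -> r *: u n = 0.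
Proof. by have [N Nu] := ufin u; exists N => n /Nu ->; rewrite scaler0. Qed.
Definition uscale r u := Universe (uscale_fin r u).

Lemma uact_fin b (u : universe) :
  exists N, forall n, (N <= n)%N -> fd_act (W n) b *m u n = 0.
Proof. by have [N Nu] := ufin u; exists N => n /Nu ->; rewrite mulmx0. Qed.
Definition uact b u := Universe (uact_fin b u).

Lemma uaddA : associative uadd.
Proof. by move=> u v w; apply/universeP => n /=; rewrite addrA. Qed.
Lemma uaddC : commutative uadd.
Proof. by move=> u v; apply/universeP => n /=; rewrite addrC. Qed.
Lemma uadd0 : left_id uzero uadd.
Proof. by move=> u; apply/universeP => n /=; rewrite add0r. Qed.
Lemma uaddN : left_inverse uzero uopp uadd.
Proof. by move=> u; apply/universeP => n /=; rewrite addNr. Qed.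
HB.instance Definition _ := GRing.isZmodule.Build universe uaddA uaddC uadd0 uaddN.

Lemma uscaleA r r' u : uscale r (uscale r' u) = uscale (r * r') u.
Proof. by apply/universeP => n /=; rewrite scalerA. Qed.
Lemma uscale1 : left_id 1 uscale.
Proof. by move=> u; apply/universeP => n /=; rewrite scale1r. Qed.
Lemma uscaleDr : right_distributive uscale +%R.
Proof. by move=> r u v; apply/universeP => n /=; rewrite scalerDr. Qed.
Lemma uscaleDl u : {morph uscale^~ u : r r' / r + r'}.
Proof. by move=> r r'; apply/universeP => n /=; rewrite scalerDl. Qed.
HB.instance Definition _ := GRing.Zmodule_isLmodule.Build R universe
  uscaleA uscale1 uscaleDr uscaleDl.

Lemma uact_linear b : linear (uact b).
Proof. by move=> r u v; apply/universeP => n /=; rewrite mulmxDr scalemxAr. Qed.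
HB.instance Definition _ b :=
  GRing.isLinear.Build R universe universe *:%R (uact b) (uact_linear b).

(* The U_n and the tails \bigoplus_(j >= n) W_j.                              *)
Definition ustage n : set universe := [set u | forall k, (n <= k)%N -> u k = 0].
Definition utail n : set universe := [set u | forall k, (k < n)%N -> u k = 0].
Definition usummand n : set universe := [set u | forall k, k != n -> u k = 0].

(* Comparing the values a and b in nat avoids a cast between the fibres.       *)
Lemma ubasis_fin l (b : 'I_(fd_dim (W l))) :
  exists N, forall n, (N <= n)%N ->
    \col_(a < fd_dim (W n)) ((n == l) && (a == b :> nat))%:R = 0 :> 'cV[R]_(fd_dim (W n)).
Proof.
exists l.+1 => n ln; apply/matrixP => a i; rewrite !mxE.
by case: eqP => // e; rewrite e ltnn in ln.
Qed.
Definition ubasis l b : universe := Universe (@ubasis_fin l b).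

(* The matrix of the U_n -> U_n block of an operator.                         *)
Definition ublock n (M : universe -> universe) :
    'M[R]_(\sum_(k < n) fd_dim (W k)) :=
  \mxblock_(k < n, l < n) \matrix_(a, b) M (ubasis b) k a 0.

End Universe.

Definition is_action (B : ralgebra R) (U : lmodType R) (f : B -> U -> U) : Prop :=
  [/\ forall b, linear (f b),
      forall a b u, f (a + b) u = f a u + f b u,
      forall a b u, f (a * b) u = f a (f b u)
    & forall r u, f (alg B r) u = r *: u].

Lemma uact_action (B : ralgebra R) (W : nat -> fdmod B) : is_action (@uact B W).
Proof.
split=> [|a b u|a b u|r u]; first exact: uact_linear.
all: apply/universeP => n /=; have [fD fM fA] := fd_morphism (W n).
- by rewrite fD mulmxDl.
- by rewrite fM mulmxA.
- by rewrite fA mul_scalar_mx.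
Qed.

Section MassTerms.
Variables (AV : superalgebra R).
Local Notation B := (stensor (Cl R 0 1) AV).
Variables (W : nat -> irrmod B).

(* The element e~_1 (x)^ 1 of B.                                              *)
Definition mass_gen : B := st_inl AV (cl_gen R (inr (ord0 : 'I_1))).

Definition univ := universe (fun n => irr_mod (W n)).
HB.instance Definition _ := GRing.Lmodule.on univ.

Definition ubact (b : B) : {linear univ -> univ} :=
  (uact b : {linear universe _ -> universe _}).

Definition mass0 : {linear univ -> univ} := ubact mass_gen.

Definition mass_stage n (M : univ -> univ) : Prop :=
  (forall u, ustage n u -> ustage n (M u)) /\ (forall u, utail n u -> M u = mass0 u).

(* The points of K(A^V)^G.                                                    *)
Record mass := Mass {
  mass_op :> {linear univ -> univ};
  mass_fin : exists n, mass_stage n mass_op;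
  mass_rep : exists f : B -> univ -> univ,
    [/\ is_action f, forall a, f (st_inr _ a) = ubact (st_inr _ a)
      & f mass_gen = mass_op]
}.

Lemma mass0_fin : exists n, mass_stage n mass0.
Proof.
by exists 0; split=> // u u0 k k0; rewrite /= u0 // mulmx0.
Qed.
Lemma mass0_rep : exists f : B -> univ -> univ,
  [/\ is_action f, forall a, f (st_inr _ a) = ubact (st_inr _ a)
      & f mass_gen = mass0].
Proof. by exists ubact; split=> //; exact: uact_action. Qed.

Definition base_mass : mass := Mass mass0_fin mass0_rep.

HB.instance Definition _ := gen_eqMixin mass.
HB.instance Definition _ := gen_choiceMixin mass.

(* The direct limit topology: O is open when, for every n, its trace on the    *)
(* stage of operators on U_n is open there for the topology of matrices.       *)
Definition mass_open : set_system mass := [set O | forall n,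
  exists2 P : set 'M[R]_(\sum_(k < n) fd_dim (W k)), open P &
    [set M : mass | mass_stage n M] `&` O =
    [set M : mass | mass_stage n M] `&` [set M : mass | P (ublock n M)]].

Lemma mass_openT : mass_open setT.
Proof. by move=> n; exists setT; [exact: openT|rewrite !setIT]. Qed.
Lemma mass_openI : setI_closed mass_open.
Proof.
move=> O O' Oo Oo' n; have [[P Po E] [P' Po' E']] := (Oo n, Oo' n).
exists (P `&` P'); first exact: openI.
by rewrite -[X in X `&` _ = _]setIid setIACA E E' setIACA setIid.
Qed.
Lemma mass_open_bigU (I : Type) (f : I -> set mass) :
  (forall i, mass_open (f i)) -> mass_open (\bigcup_i f i).
Proof.
move=> fo n.
have /choice[P PE] : forall i, exists P : set 'M[R]_(\sum_(k < n) fd_dim (W k)),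
    open P /\ [set M : mass | mass_stage n M] `&` f i =
    [set M : mass | mass_stage n M] `&` [set M : mass | P (ublock n M)].
  by move=> i; have [P Po E] := fo i n; exists P.
exists (\bigcup_i P i); first by apply: bigcup_open => i _; exact: (PE i).1.
rewrite setI_bigcupr; under eq_bigcupr => i _ do rewrite (PE i).2.
by rewrite -setI_bigcupr; congr (_ `&` _).
Qed.
HB.instance Definition _ :=
  isOpenTopological.Build mass mass_openT mass_openI mass_open_bigU.

(* pi_0 is the set of path components.                                        *)
Definition path_joined (M N : mass) : Prop :=
  exists gamma : R -> mass,
    [/\ {within `[0, 1], continuous gamma}, gamma 0 = M & gamma 1 = N].

Definition pi0 : Type := {P : set mass | exists M, P = path_joined M}.

Definition pi0_of (M : mass) : pi0 := exist _ (path_joined M) (ex_intro _ M erefl).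

(* Isomorphisms U (+) U -> U of B-modules permuting the irreducible summands.  *)
Definition summand_iso (Psi : {linear (univ * univ)%type -> univ}) : Prop :=
  [/\ bijective Psi,
      forall b u v, Psi (ubact b u, ubact b v) = ubact b (Psi (u, v))
    & exists sigma : nat + nat -> nat,
      [/\ bijective sigma,
          forall n, [set Psi (u, 0) | u in @usummand B W n]
                    = @usummand B W (sigma (inl n))
        & forall n, [set Psi (0, u) | u in @usummand B W n]
                    = @usummand B W (sigma (inr n))]].

(* L is the direct sum of M and N, transported along Psi.                      *)
Definition mass_dsum (Psi : univ * univ -> univ) (M N L : mass) : Prop :=
  forall u v, L (Psi (u, v)) = Psi (M u, N v).

Definition submodule (C : set univ) : Prop :=
  [/\ C 0, forall u v, C u -> C v -> C (u + v) & forall b u, C u -> C (ubact b u)].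

Definition module_embedding (X : fdmod B) (j : 'cV[R]_(fd_dim X) -> univ) : Prop :=
  [/\ linear j, injective j & forall b v, j (fd_act X b *m v) = ubact b (j v)].

Definition complementary (E C : set univ) : Prop :=
  E `&` C = [set 0] /\ forall u, exists e c, [/\ E e, C c & u = e + c].

Definition sign_change (X : fdmod B) (j : 'cV[R]_(fd_dim X) -> univ)
    (C : set univ) (M : mass) : Prop :=
  [/\ submodule C, complementary (range j) C,
      forall v, M (j v) = - mass0 (j v)
    & forall c, C c -> M c = mass0 c].

End MassTerms.

Section AlgebraicClassification.
Variable (AV : superalgebra R).

Definition cl12 : Cl R 0 1 -> Cl R 0 2 := @cl_incl R 0 1 2 isT.

Definition st12 : stensor (Cl R 0 1) AV -> stensor (Cl R 0 2) AV := st_map cl12.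

Lemma st12_morphism : algebra_morphism st12.
Proof. by apply: st_map_morphism; [exact: cl_incl_morphism|exact: cl_incl_homog]. Qed.

(* The cokernel of i^*, the restriction along [st12].                         *)
Definition algclass : zmodType := modcoker st12_morphism.

Definition algcls (X : fdmod (stensor (Cl R 0 1) AV)) : algclass :=
  cokercls st12_morphism (modclass X).

End AlgebraicClassification.
End Modules.

(* Main.v *)
(* Averaging over the finite group generated, up to signs, by the generators of A^V, every
   finite-dimensional module over Cl^{0,1} (x) A^V or Cl^{0,2} (x) A^V carries an inner
   product for which the action is closed under adjoints; hence modules are semisimple, and
   two modules have the same class in A(A^V) if and only if they become isomorphic after
   adding restrictions of Cl^{0,2}-modules, i.e. modules X with an automorphism J that commutes
   with A^V, anticommutes with the mass generator m and satisfies J^2 = -1.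

   A path in K(A^V)^G stays in a finite stage U_n, so everything reduces to matrices.
   Rotations show that the component of a sign change depends only on the module, and that
   sign changes on modules with such a J are trivial.  Conversely, the polar decomposition
   deforms a mass term on U_n to an orthogonal one, Q.  The endomorphism s = Qm + mQ commutes
   with Q and m.  For t in (-2, 2) not an eigenvalue of s, let sgn be the sign of s - t; since
   -1 is not an eigenvalue of the orthogonal operator Q m sgn, all (1 - r) + r Q m sgn with
   0 <= r <= 1/2 are invertible, and conjugation by them joins m sgn to Q.  Here m sgn is the
   sign change on the negative spectral subspace of s - t.  The class of this subspace is
   independent of t, because on a spectral subspace where |s| < 2 the operator
   (Qm - mQ) / sqrt(4 - s^2) is a J, and it is locally constant in Q. *)
From HB Require Import structures.
Require Import Defs.
From mathcomp Require Import all_boot all_order all_algebra all_fingroup.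
From mathcomp Require Import generic_quotient ring_quotient mxrepresentation.
From mathcomp Require Import complex freeg.
From mathcomp Require Import all_classical all_reals all_analysis.
From mathcomp Require Import ring lra.

Set Implicit Arguments.
Unset Strict Implicit.
Unset Printing Implicit Defensive.

Import Order.TTheory GRing.Theory Num.Theory numFieldNormedType.Exports.

Local Open Scope classical_set_scope.
Local Open Scope quotient_scope.
Local Open Scope ring_scope.

(** * Algebras given by generators and relations *)

(** The cocycle takes values in U(1), so the elements of G may generate an infinite group and cannot
    simply be averaged over: unit complex numbers are isometries because the complex unit is skew
    for a form that is averaged beforehand. Once this form is standard, adjoints are transposes and
    positivity replaces the handling of eigenvalues: the square root of a positive definite matrix
    inherits the commutation relations of its square and depends continuously on it. These two facts
    yield |M| and the sign of s - t.

    In general no single t avoids the spectrum of s along a whole path. The invariant of a mass term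
    is therefore a relation, quantified over all regular t. The bounds -2 and 2 are forced: Q = m
    gives s = 2 and Q = -m gives s = -2, and there Qm - mQ vanishes, so that no J can be made from
    it.

    To move sign changes, an equality of classes has to become an isomorphism of modules; this rests
    on cancellation and on the uniqueness of decompositions, both drawn from Schur's lemma. *)

Section Presented.
Variables (R : comNzRingType) (X : Type) (rel : aexp R X -> aexp R X -> Prop).

Lemma presented_ind (P : presented rel -> Prop) :
    (forall x, P (pgen rel x)) -> (forall r, P (alg (presented rel) r)) ->
    (forall x y, P x -> P y -> P (x + y)) ->
    (forall x y, P x -> P y -> P (x * y)) ->
  forall x, P x.
Proof.
move=> Pg Pa PD PM; elim/palg_ind; elim=> [x|r|t Pt u Pu|t Pt u Pu].
- exact: Pg.
- exact: Pa.
- by rewrite pclsD; exact: PD.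
- by rewrite pclsM; exact: PM.
Qed.

(** Evaluating an expression at the generators gives back its class, so every defining relation can
    be read as an equation in the presented algebra. *)
Lemma pgen_rel t u : rel t u -> aeval (C := presented rel) (pgen rel) t = aeval (pgen rel) u.
Proof.
have E v : aeval (C := presented rel) (pgen rel) v = pcls rel v.
  by elim: v => //= [v -> w ->|v -> w ->]; rewrite ?pclsD ?pclsM.
by move=> tu; rewrite !E; apply/pcls_eq/acong_rel.
Qed.
End Presented.

Lemma morph_comp (R : comNzRingType) (A B C : ralgebra R) (f : A -> B) (g : B -> C) :
  algebra_morphism f -> algebra_morphism g -> algebra_morphism (g \o f).
Proof.
move=> [fD fM fA] [gD gM gA]; split=> [a b|a b|r] /=.
- by rewrite fD gD.
- by rewrite fM gM.
- by rewrite fA gA.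
Qed.

Section AlgMorph.
Variables (R : comNzRingType) (A B : ralgebra R) (f : A -> B).
Hypothesis fm : algebra_morphism f.

Lemma amorphD a b : f (a + b) = f a + f b. Proof. by case: fm. Qed.
Lemma amorphM a b : f (a * b) = f a * f b. Proof. by case: fm. Qed.
Lemma amorphA r : f (alg A r) = alg B r. Proof. by case: fm. Qed.
Lemma amorph0 : f 0 = 0.
Proof. by rewrite -(rmorph0 (alg A)) amorphA rmorph0. Qed.
Lemma amorphN a : f (- a) = - f a.
Proof. by apply/eqP; rewrite -subr_eq0 opprK -amorphD addNr amorph0. Qed.
Lemma amorph_sum I r (P : pred I) (F : I -> A) :
  f (\sum_(i <- r | P i) F i) = \sum_(i <- r | P i) f (F i).
Proof. by apply: (big_morph f amorphD amorph0). Qed.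
End AlgMorph.

Section CliffordTensor.
Variables (R : comNzRingType) (p q : nat) (AV : superalgebra R).
Local Notation B := (stensor (Cl R p q) AV).

Definition clg (x : 'I_p + 'I_q) : B := st_inl AV (cl_gen R x).

Definition clsq (x : 'I_p + 'I_q) : R := if x is inl _ then -1 else 1.

Lemma clif_ind (P : B -> Prop) :
    (forall x, P (clg x)) -> (forall a, P (st_inr (Cl R p q) a)) ->
    (forall r, P (alg B r)) -> (forall x y, P x -> P y -> P (x + y)) ->
    (forall x y, P x -> P y -> P (x * y)) -> forall b, P b.
Proof.
move=> Pg Pr Pa PD PM; apply: presented_ind => //; case=> [c|a]; last exact: Pr.
rewrite -/(st_inl AV c); move: c; have lm := st_inl_morphism (Cl R p q) AV.
apply: presented_ind => [x|r|x y Px Py|x y Px Py].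
- exact: Pg.
- by rewrite (amorphA lm).
- by rewrite (amorphD lm); exact: PD.
- by rewrite (amorphM lm); exact: PM.
Qed.

Lemma cl_gen_sq x : cl_gen R x * cl_gen R x = alg (Cl R p q) (clsq x).
Proof. case: x => i; [exact: (pgen_rel (cl_neg R q i))|exact: (pgen_rel (cl_pos R p i))]. Qed.

Lemma clg_sq x : clg x * clg x = alg B (clsq x).
Proof.
have lm := st_inl_morphism (Cl R p q) AV.
by rewrite -(amorphM lm) cl_gen_sq (amorphA lm).
Qed.

Lemma alg_sign (A : ralgebra R) n (x : A) : alg A ((-1) ^+ n) * x = (-1) ^+ n * x.
Proof. by rewrite rmorph_sign. Qed.

Lemma clg_anti x y : x != y -> clg x * clg y = - (clg y * clg x).
Proof.
have lm := st_inl_morphism (Cl R p q) AV.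
move=> xy; rewrite -!(amorphM lm).
rewrite [X in st_inl _ X](pgen_rel (cl_anti R xy)) /= !(amorphM lm) (amorphA lm).
by rewrite rmorphN1 mulN1r.
Qed.

Lemma cl_gen_homog x : homog (s := Cl R p q) true (cl_gen R x).
Proof. exact: phomog_gen. Qed.

Lemma clg_swap d a x : homog d a ->
  st_inr (Cl R p q) a * clg x = (-1) ^+ d * (clg x * st_inr (Cl R p q) a).
Proof.
by move=> ad; rewrite (st_swap (cl_gen_homog x) ad) alg_sign andTb.
Qed.

Section Lift.
Variables (C : ralgebra R) (phi : AV -> C) (g : 'I_p + 'I_q -> C).
Hypotheses (phi_m : algebra_morphism phi) (g_sq : forall x, g x * g x = alg C (clsq x)).
Hypothesis g_anti : forall x y, x != y -> g x * g y = - (g y * g x).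
Hypothesis g_swap : forall d a x, homog d a -> phi a * g x = (-1) ^+ d * (g x * phi a).

Lemma cl_lift_rel t u : cl_rel (R := R) t u -> aeval g t = aeval g u.
Proof.
case=> {t u} [i|j|x y xy] /=; try exact: g_sq.
by rewrite rmorphN1 mulN1r; exact: g_anti.
Qed.
Definition cl_lift : Cl R p q -> C := plift (rel := @cl_rel R p q) g.

Lemma cl_lift_m : algebra_morphism cl_lift. Proof. exact: plift_morphism cl_lift_rel. Qed.
Lemma cl_lift_gen x : cl_lift (cl_gen R x) = g x. Proof. exact: (plift_gen cl_lift_rel). Qed.

Lemma sign_comm (A : pzRingType) n (x : A) : (-1) ^+ n * x = x * (-1) ^+ n.
Proof. by rewrite -signr_odd; case: odd; rewrite ?mul1r ?mulr1 ?mulN1r ?mulrN1. Qed.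

(** The sign rule is given on generators; it extends to products because [d && e] is additive in [d]
    modulo 2. *)
Lemma cl_lift_swap d e (c : Cl R p q) a : homog d c -> homog e a ->
  phi a * cl_lift c = (-1) ^+ (d && e) * (cl_lift c * phi a).
Proof.
have lm := cl_lift_m.
move=> hc ea; elim: hc => {d c} [d x ->|r|d|d x y _ IHx _ IHy|d d' x y _ IHx _ IHy].
- by rewrite cl_lift_gen; exact: g_swap.
- by rewrite (amorphA lm) andFb mul1r alg_central.
- by rewrite (amorph0 lm) mul0r !mulr0.
- by rewrite (amorphD lm) mulrDr IHx IHy mulrDl mulrDr.
- rewrite (amorphM lm) [LHS]mulrA IHx -[LHS]mulrA -[in LHS](mulrA (cl_lift x)) IHy.
  rewrite andb_addl signr_addb -[RHS]mulrA; congr (_ * _).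
  by rewrite mulrA -sign_comm -!mulrA.
Qed.

Definition clif_lift_gen (x : Cl R p q + AV) : C :=
  match x with inl c => cl_lift c | inr a => phi a end.

Lemma clif_lift_rel t u :
  @st_rel R (Cl R p q) AV t u -> aeval clif_lift_gen t = aeval clif_lift_gen u.
Proof.
have lm := cl_lift_m.
case=> {t u} [t u []|t u []|d e a b ad be] /=.
- by move=> a b; rewrite (amorphD lm).
- by move=> a b; rewrite (amorphM lm).
- by move=> r; rewrite (amorphA lm).
- by move=> a b; rewrite (amorphD phi_m).
- by move=> a b; rewrite (amorphM phi_m).
- by move=> r; rewrite (amorphA phi_m).
- by rewrite (cl_lift_swap ad be) rmorph_sign.
Qed.

(** Universal property of the super tensor product with a Clifford algebra. It serves both to
    replace the mass generator by another mass term and to adjoin a second Clifford generator. *)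
Lemma clif_lift_ex : exists F : B -> C,
  [/\ algebra_morphism F, forall x, F (clg x) = g x & forall a, F (st_inr _ a) = phi a].
Proof.
exists (plift (rel := @st_rel R (Cl R p q) AV) clif_lift_gen); split.
- exact: plift_morphism clif_lift_rel.
- by move=> x; rewrite /clg /st_inl (plift_gen clif_lift_rel) /= cl_lift_gen.
- by move=> a; rewrite /st_inr (plift_gen clif_lift_rel).
Qed.
End Lift.
End CliffordTensor.
Arguments clg {R p q} AV x.

(** * Positive definite matrices *)

Section PosDef.
Variable R : realType.
Implicit Types m n : nat.

Definition posd n (A : 'M[R]_n) :=
  A^T = A /\ forall v : 'cV_n, v != 0 -> 0 < (v^T *m A *m v) 0 0.

(** On a finite spectrum any function is a polynomial, so that functions of a real symmetric matrix
    stay real and symmetric. *)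
Lemma interpolation (f : R -> R) (s : seq R) :
  exists p : {poly R}, forall x, x \in s -> p.[x] = f x.
Proof.
elim: s => [|x s [p pE]]; first by exists 0.
have [xs|xs] := boolP (x \in s).
  by exists p => y; rewrite inE => /orP[/eqP->|]; exact: pE.
pose w := \prod_(y <- s) ('X - y%:P).
have wx : w.[x] != 0 by rewrite -/(root w x) root_prod_XsubC.
exists (p + ((f x - p.[x]) / w.[x])%:P * w) => y; rewrite inE !hornerE.
case/predU1P=> [->|ys]; first by rewrite divfK // addrC subrK.
have /rootP -> : root w y by rewrite root_prod_XsubC.
by rewrite mulr0 addr0 pE.
Qed.

Lemma dot_self_ge0 n (v : 'cV[R]_n) : 0 <= (v^T *m v) 0 0.
Proof. by rewrite mxE sumr_ge0 // => i _; rewrite mxE -expr2 sqr_ge0. Qed.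

Lemma dot_self_eq0 n (v : 'cV[R]_n) : (v^T *m v) 0 0 = 0 -> v = 0.
Proof.
rewrite mxE => /eqP; rewrite psumr_eq0 => [/allP v0|i _]; last by rewrite mxE -expr2 sqr_ge0.
apply/colP=> i; have := v0 i (mem_index_enum i).
by rewrite !mxE -expr2 sqrf_eq0 => /eqP.
Qed.

Lemma dot_self_gt0 n (v : 'cV[R]_n) : v != 0 -> 0 < (v^T *m v) 0 0.
Proof.
by rewrite lt_def dot_self_ge0 andbT; apply: contra_neq; exact: dot_self_eq0.
Qed.

Lemma posd1 n : posd (1%:M : 'M[R]_n).
Proof. by split=> [|v v0]; rewrite ?trmx1 // mulmx1 dot_self_gt0. Qed.

Lemma posd_ge0 n (A : 'M[R]_n) (v : 'cV_n) : posd A -> 0 <= (v^T *m A *m v) 0 0.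
Proof.
by move=> [_ Ap]; case: (eqVneq v 0) => [->|/Ap/ltW//]; rewrite mulmx0 mxE.
Qed.

Lemma posdD n (A A' : 'M[R]_n) : posd A -> (A'^T = A') ->
  (forall v : 'cV_n, 0 <= (v^T *m A' *m v) 0 0) -> posd (A + A').
Proof.
move=> [As Ap] A's A'p; split=> [|v v0]; first by rewrite linearD /= As A's.
by rewrite mulmxDr mulmxDl mxE ltr_wpDr ?Ap.
Qed.

Lemma unitmx_inj0 (F : fieldType) n (A : 'M[F]_n) :
  (forall v : 'cV_n, A *m v = 0 -> v = 0) -> A \in unitmx.
Proof.
move=> A0; rewrite -unitmx_tr -row_free_unit -kermx_eq0; apply/eqP/row_matrixP=> i.
rewrite row0; apply: (can_inj (@trmxK _ _ _)); rewrite trmx0; apply: A0.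
by apply: (can_inj (@trmxK _ _ _)); rewrite trmx_mul trmxK trmx0 -row_mul mulmx_ker row0.
Qed.

Lemma posd_unit n (A : 'M[R]_n) : posd A -> A \in unitmx.
Proof.
move=> [_ Ap]; apply: unitmx_inj0 => v Av; apply/eqP/negP=> /negP /Ap.
by rewrite -mulmxA Av mulmx0 mxE ltxx.
Qed.

Lemma posd_congr m n (A : 'M[R]_n) (Z : 'M[R]_(n, m)) : posd A ->
  (forall v : 'cV_m, Z *m v = 0 -> v = 0) -> posd (Z^T *m A *m Z).
Proof.
move=> [As Ap] Zi; split=> [|v v0]; first by rewrite !trmx_mul trmxK As mulmxA.
have Zv : Z *m v != 0 by apply: contra_neq v0 => /Zi.
by have := Ap _ Zv; rewrite trmx_mul !mulmxA.
Qed.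

Lemma posd_trmul n (Z : 'M[R]_n) : Z \in unitmx -> posd (Z^T *m Z).
Proof.
move=> Zu; rewrite -[Z^T]mulmx1; apply: posd_congr; first exact: posd1.
by move=> v Zv; rewrite -[v](mulKmx Zu) Zv mulmx0.
Qed.

Lemma posd_sqr n (S : 'M[R]_n) : S^T = S -> S \in unitmx -> posd (S *m S).
Proof. by move=> Ss Su; have := posd_trmul Su; rewrite Ss. Qed.

Lemma posd_eigen n (A : 'M[R]_n) r : posd A -> root (char_poly A) r -> 0 < r.
Proof.
move=> [As Ap]; rewrite -eigenvalue_root_char => /eigenvalueP[v vA v0].
have := Ap v^T; rewrite trmx_eq0 trmxK => /(_ v0).
rewrite vA -scalemxAl mxE -[X in X *m _]trmxK => h.
by rewrite -(pmulr_lgt0 r (dot_self_gt0 (v:=v^T) _)) ?trmx_eq0.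
Qed.

(** The spectral theorem diagonalises [A] over the complex numbers; writing the root through a real
    polynomial in [A] brings it back to the reals. *)
Lemma posd_sqrt n (A : 'M[R]_n) : posd A ->
  exists S : 'M[R]_n, posd S /\ S *m S = A.
Proof.
case: n A => [|n] A Ap.
  by exists 1%:M; split; [exact: posd1|apply/matrixP; case].
pose f := real_complex R; pose AC := map_mx f A.
have ACh : AC \is hermsymmx.
  apply: realsym_hermsym.
    apply/is_hermitianmxP; rewrite expr0 scale1r map_mx_id //.
    by rewrite /AC map_trmx; case: Ap => ->.
  by apply/mxOverP => i j; rewrite mxE complex_real.
have /orthomx_spectralP := hermitian_normalmx ACh.
set P := spectralmx AC; set d := spectral_diag AC => ACE.
have Pu : P \in unitmx := spectral_unit AC.
have /mxOverP dr : d \is a mxOver Num.real by exact: hermitian_spectral_diag_real.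
have dRe i : d 0 i = f (complex.Re (d 0 i)) by rewrite [RHS]RRe_real.
have d_gt0 i : 0 < complex.Re (d 0 i).
  apply: (posd_eigen Ap); rewrite -(fmorph_root f) map_char_poly -/AC.
  suff h : root (char_poly AC) (d 0 i) by rewrite (dRe i) in h; exact: h.
  rewrite -eigenvalue_root_char; apply/eigenvalueP.
  exists (row i P); last first.
    by apply/negP=> /eqP P0; have := row_mul i P (invmx P); rewrite P0 mul0mx mulmxV //
      => /rowP/(_ i)/eqP; rewrite !mxE eqxx oner_eq0.
  rewrite ACE !mulmxA -row_mul mulmxV // row1 -rowE row_diag_mx -scalemxAl.
  by rewrite -rowE.
(* The fourth root is interpolated instead of the square root: [S] only has to be symmetric and
   invertible, and then [S *m S] is positive definite as a square. *)
have [q qE] := interpolation (fun x => Num.sqrt (Num.sqrt x))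
   [seq complex.Re (d 0 i) | i <- enum 'I_n.+1].
pose S := horner_mx A q.
have Sc k : horner_mx AC (map_poly f (q ^+ k)) =
    invmx P *m diag_mx (map_mx (fun z => f ((Num.sqrt (Num.sqrt (complex.Re z))) ^+ k)) d) *m P.
  rewrite ACE -[X in _ *m X]invmxK horner_mx_uconj ?invmxK; last by rewrite unitmx_inv.
  rewrite horner_mx_diag; congr (_ *m diag_mx _ *m _); apply/rowP=> i; rewrite !mxE.
  rewrite [in LHS]dRe horner_map /= horner_exp qE //.
  by apply: map_f; rewrite mem_enum.
have S4 : (S *m S) *m (S *m S) = A.
  have -> : (S *m S) *m (S *m S) = horner_mx A (q ^+ 4).
    by rewrite rmorphXn /= -/S !exprS expr0 mulr1 mulrA.
  apply: (map_mx_inj (f := f)); rewrite map_horner_mx -/AC Sc [RHS]ACE.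
  rewrite (_ : map_mx _ d = d) //; apply/rowP=> i; rewrite mxE.
  by rewrite (exprM _ 2 2) !sqr_sqrtr ?sqrtr_ge0 ?ltW // [RHS]dRe.
have Su : S \in unitmx.
  have := posd_unit Ap; rewrite -S4 !unitmx_mul => /andP[/andP[]//].
have Ss : S^T = S.
  rewrite /S; elim/poly_ind: q {qE S Sc S4 Su} => [|q c IH].
    by rewrite rmorph0 trmx0.
  rewrite rmorphD rmorphM /= horner_mx_X horner_mx_C linearD /= tr_scalar_mx.
  congr (_ + _); rewrite trmx_mul IH; case: Ap => -> _.
  exact: (comm_mx_horner q (comm_mx_refl A)).
by exists (S *m S); split=> //; exact: posd_sqr.
Qed.

(** The square of the Frobenius norm. *)
Definition fro m n (Z : 'M[R]_(m, n)) : R := \tr (Z^T *m Z).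

Lemma tr_quad m n (P : 'M[R]_m) (Z : 'M[R]_(m, n)) :
  \tr (Z^T *m P *m Z) = \sum_j ((col j Z)^T *m P *m col j Z) 0 0.
Proof.
by apply: eq_bigr => j _; rewrite tr_col -row_mul colE mulmxA -row_mul -colE !mxE.
Qed.

Lemma tr_quad_ge0 m n (P : 'M[R]_m) (Z : 'M[R]_(m, n)) :
  posd P -> 0 <= \tr (Z^T *m P *m Z).
Proof. by move=> Pp; rewrite tr_quad sumr_ge0 // => j _; exact: posd_ge0. Qed.

Lemma fro_ge0 m n (Z : 'M[R]_(m, n)) : 0 <= fro Z.
Proof. by rewrite /fro -[Z^T]mulmx1; exact/tr_quad_ge0/posd1. Qed.

Lemma tr_quad_eq0 m n (P : 'M[R]_m) (Z : 'M[R]_(m, n)) :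
  posd P -> \tr (Z^T *m P *m Z) = 0 -> Z = 0.
Proof.
move=> Pp; rewrite tr_quad => /eqP.
rewrite psumr_eq0 => [/allP Z0|j _]; last exact: posd_ge0.
apply/matrixP=> i j; rewrite mxE; have /= := Z0 j (mem_index_enum j).
have [/colP/(_ i)|/(proj2 Pp)] := eqVneq (col j Z) 0; first by rewrite !mxE.
move=> h /eqP e; have: (0 : R) < 0 by rewrite -[X in _ < X]e.
by rewrite ltxx.
Qed.

(** Pairing the equation with [Z] under the trace gives a vanishing sum of two nonnegative terms. *)
Lemma sylvester0 m n (P : 'M[R]_m) (Q : 'M[R]_n) (Z : 'M[R]_(m, n)) :
  posd P -> posd Q -> P *m Z + Z *m Q = 0 -> Z = 0.
Proof.
move=> Pp Qp PZQ; apply: (tr_quad_eq0 Pp).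
have := congr1 (fun X => \tr (Z^T *m X)) PZQ.
rewrite mulmx0 mulmxDr linearD /= mxtrace0 (mxtrace_mulC Z^T (Z *m Q)) mulmxA.
have h := tr_quad_ge0 Z^T Qp; rewrite trmxK in h.
move=> /eqP; rewrite paddr_eq0 ?tr_quad_ge0 //.
by case/andP=> /eqP.
Qed.

(** The difference [X *m Q - P *m X] solves the Sylvester equation above. Roots and absolute values
    inherit commutation relations by this lemma. *)
Lemma sqrt_intertwine m n (P : 'M[R]_m) (Q : 'M[R]_n) (X : 'M[R]_(m, n)) :
  posd P -> posd Q -> X *m (Q *m Q) = (P *m P) *m X -> X *m Q = P *m X.
Proof.
move=> Pp Qp E; apply/eqP; rewrite -subr_eq0; apply/eqP/(sylvester0 Pp Qp).
by rewrite mulmxBr mulmxBl !mulmxA -E !mulmxA addrA subrK subrr.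
Qed.

Lemma entry_sqr_le_fro m n (Z : 'M[R]_(m, n)) i j : Z i j ^+ 2 <= fro Z.
Proof.
rewrite /fro /mxtrace (bigD1 j) //= mxE (bigD1 i) //= mxE -expr2 -addrA lerDl.
apply: addr_ge0; first by apply: sumr_ge0 => k _; rewrite mxE -expr2 sqr_ge0.
apply: sumr_ge0 => k _; rewrite mxE; apply: sumr_ge0 => l _.
by rewrite mxE -expr2 sqr_ge0.
Qed.

Lemma tr_mul_le_fro m n (X Y : 'M[R]_(m, n)) : 2 * \tr (X^T *m Y) <= fro X + fro Y.
Proof.
have := fro_ge0 (X - Y); have E : (X - Y)^T = X^T - Y^T by rewrite linearB.
rewrite /fro E mulmxBl !mulmxBr !(raddfB (@mxtrace R n)) /=.
have -> : \tr (Y^T *m X) = \tr (X^T *m Y).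
  by rewrite -mxtrace_tr trmx_mul trmxK.
lra.
Qed.

(* From T'Z + ZT = A' - A with Z = T' - T and T = S^2. *)
Lemma sqrt_diff_le n (S T T' : 'M[R]_n) : posd S -> posd T' -> T = S *m S ->
  fro ((T' - T) *m S) <= fro ((T' *m T' - T *m T) *m invmx S).
Proof.
move=> Sp T'p TE; set Z := T' - T; set D := _ - T *m T.
have Ts : T^T = T by rewrite TE trmx_mul (proj1 Sp).
have Zs : Z^T = Z by rewrite linearB /= Ts (proj1 T'p).
have DE : D = T' *m Z + Z *m T.
  by rewrite /D /Z mulmxBr mulmxBl addrA subrK.
have E : \tr (Z^T *m D) = \tr (Z^T *m T' *m Z) + fro (Z *m S).
  rewrite DE mulmxDr linearD /= mulmxA; congr (_ + _).
  by rewrite /fro trmx_mul (proj1 Sp) -mulmxA [RHS]mxtrace_mulC TE -!mulmxA.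
have E' : \tr (Z^T *m D) = \tr ((Z *m S)^T *m (D *m invmx S)).
  rewrite trmx_mul (proj1 Sp) -mulmxA [RHS]mxtrace_mulC -!mulmxA.
  by rewrite mulVmx ?mulmx1 // posd_unit.
have := tr_mul_le_fro (Z *m S) (D *m invmx S).
rewrite -E' E; have := tr_quad_ge0 Z T'p; lra.
Qed.
End PosDef.

(** * Limits of matrices, continuity of inverses and square roots *)

Section MatrixLimits.
Variables (R : realType) (T : Type) (F : set_system T).
Context {FF : Filter F}.

Lemma mx_cvgP m n (f : T -> 'M[R]_(m, n)) (l : 'M[R]_(m, n)) :
  f x @[x --> F] --> l <-> forall i j, f x i j @[x --> F] --> l i j.
Proof.
split=> [fl i j|fl].
  exact: (@cvg_comp _ _ _ f (fun M : 'M[R]_(m, n) => M i j) F _ _ fl (@coord_continuous R m n i j l)).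
move=> A [P Pl PA]; apply: (filterS (P := fun t => forall ij, P ij.1 ij.2 (f t ij.1 ij.2))).
  by move=> t Pt; apply: PA => i j; exact: Pt (i, j).
by apply: filter_forall => -[i j]; apply: fl; exact: Pl.
Qed.

Lemma cvg_sumr (I : Type) (r : seq I) (P : pred I) (f : I -> T -> R) (a : I -> R) :
  (forall i, P i -> f i x @[x --> F] --> a i) ->
  \sum_(i <- r | P i) f i x @[x --> F] --> \sum_(i <- r | P i) a i.
Proof. by apply: cvg_big => //; exact: add_continuous. Qed.

Lemma cvg_prodr (I : Type) (r : seq I) (P : pred I) (f : I -> T -> R) (a : I -> R) :
  (forall i, P i -> f i x @[x --> F] --> a i) ->
  \prod_(i <- r | P i) f i x @[x --> F] --> \prod_(i <- r | P i) a i.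
Proof. by apply: cvg_big => //; exact: mul_continuous. Qed.

Lemma mx_cvg_cst m n (l : 'M[R]_(m, n)) : (fun _ : T => l) x @[x --> F] --> l.
Proof. exact: cvg_cst. Qed.

Lemma mx_cvgD m n (f g : T -> 'M[R]_(m, n)) (l k : 'M[R]_(m, n)) :
  f x @[x --> F] --> l -> g x @[x --> F] --> k -> f x + g x @[x --> F] --> l + k.
Proof.
move=> /mx_cvgP fl /mx_cvgP gk; apply/mx_cvgP => i j; rewrite mxE.
by under eq_fun do rewrite mxE; exact: cvgD.
Qed.

Lemma mx_cvgZ m n (a : T -> R) (f : T -> 'M[R]_(m, n)) (b : R) (l : 'M[R]_(m, n)) :
  a x @[x --> F] --> b -> f x @[x --> F] --> l -> a x *: f x @[x --> F] --> b *: l.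
Proof.
move=> ab /mx_cvgP fl; apply/mx_cvgP => i j; rewrite mxE.
by under eq_fun do rewrite mxE; exact: cvgM.
Qed.

Lemma mx_cvgT m n (f : T -> 'M[R]_(m, n)) (l : 'M[R]_(m, n)) :
  f x @[x --> F] --> l -> (f x)^T @[x --> F] --> l^T.
Proof.
move=> /mx_cvgP fl; apply/mx_cvgP => i j; rewrite mxE.
by under eq_fun do rewrite mxE; exact: fl.
Qed.

Lemma mx_cvgM m n p (f : T -> 'M[R]_(m, n)) (g : T -> 'M[R]_(n, p))
    (l : 'M[R]_(m, n)) (k : 'M[R]_(n, p)) :
  f x @[x --> F] --> l -> g x @[x --> F] --> k -> f x *m g x @[x --> F] --> l *m k.
Proof.
move=> /mx_cvgP fl /mx_cvgP gk; apply/mx_cvgP => i j; rewrite mxE.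
by under eq_fun do rewrite mxE; apply: cvg_sumr => h _; exact: cvgM.
Qed.

Lemma cvg_det n (f : T -> 'M[R]_n) (l : 'M[R]_n) :
  f x @[x --> F] --> l -> \det (f x) @[x --> F] --> \det l.
Proof.
move=> /mx_cvgP fl; apply: cvg_sumr => s _; apply: cvgM; first exact: cvg_cst.
by apply: cvg_prodr => i _; exact: fl.
Qed.

Lemma near_unitmx n (f : T -> 'M[R]_n) (l : 'M[R]_n) : l \in unitmx ->
  f x @[x --> F] --> l -> \forall x \near F, f x \in unitmx.
Proof.
rewrite unitmxE unitfE => lu fl.
have /(cvg_det fl) : nbhs (\det l) (fun z : R => z != 0).
  by apply: open_nbhs_nbhs; split=> //; exact: open_neq.
by move=> h; apply: (filterS (P := fun x => \det (f x) != 0)) h => x; rewrite unitmxE unitfE.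
Qed.

Lemma mx_cvgV n (f : T -> 'M[R]_n) (l : 'M[R]_n) : l \in unitmx ->
  f x @[x --> F] --> l -> invmx (f x) @[x --> F] --> invmx l.
Proof.
move=> lu fl; have dl : \det l != 0 by rewrite -unitfE -unitmxE.
have dV : (\det (f x))^-1 @[x --> F] --> (\det l)^-1 by apply: cvgV => //; exact: cvg_det.
have fu := near_unitmx lu fl.
(* [invmx] returns its argument at a singular matrix, so the cofactor formula holds only
   eventually. *)
rewrite /invmx lu; apply: (cvg_trans (G := (\det (f x))^-1 *: \adj (f x) @[x --> F])).
  apply: near_eq_cvg; near=> x; rewrite ifT //; by near: x.
apply: mx_cvgZ => //; apply/mx_cvgP => i j; rewrite mxE.
under eq_fun do rewrite mxE.
apply: cvgM; first exact: cvg_cst.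
apply: cvg_det; apply/mx_cvgP => i' j'; rewrite !mxE; under eq_fun do rewrite !mxE.
by move/mx_cvgP: fl; exact.
Unshelve. all: by end_near. Qed.

(** [sqrt_diff_le] bounds every entry of [(f x - l) *m S] by a Frobenius norm in which only the
    squares and [S] occur, so convergence of the squares suffices. *)
Lemma mx_cvg_sqrt n (f : T -> 'M[R]_n) (l : 'M[R]_n) : (\forall x \near F, posd (f x)) -> posd l ->
  f x *m f x @[x --> F] --> l *m l -> f x @[x --> F] --> l.
Proof.
move=> fp lp fl; have [S [Sp SE]] := posd_sqrt lp; have Su := posd_unit Sp.
pose D x := (f x *m f x - l *m l) *m invmx S.
have D0 : D x @[x --> F] --> (0 : 'M[R]_n).
  rewrite -(mul0mx _ (invmx S)) -(subrr (l *m l)); apply: mx_cvgM; last exact: mx_cvg_cst.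
  by apply: mx_cvgD => //; exact: mx_cvg_cst.
have fro0 : fro (D x) @[x --> F] --> 0.
  rewrite -(mxtrace0 R n) -(mulmx0 _ (0^T : 'M[R]_n)); apply: cvg_sumr => i _.
  by have /mx_cvgP := mx_cvgM (mx_cvgT D0) D0; exact.
have Z0 : (f x - l) *m S @[x --> F] --> (0 : 'M[R]_n).
  apply/mx_cvgP => i j; rewrite mxE.
  have s0 : Num.sqrt (fro (D x)) @[x --> F] --> 0.
    have := @cvg_comp _ _ _ (fun x => fro (D x)) Num.sqrt F _ _ fro0 (@sqrt_continuous R 0).
    by rewrite sqrtr0.
  apply: norm_cvg0; apply: (squeeze_cvgr _ (cvg_cst 0) s0).
  near=> x; rewrite normr_ge0 /= -sqrtr_sqr ler_sqrt ?fro_ge0 //.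
  apply: le_trans (entry_sqr_le_fro _ _ _) (sqrt_diff_le Sp _ (esym SE)).
  by near: x.
have h := mx_cvgD (mx_cvgM Z0 (@mx_cvg_cst _ _ (invmx S))) (@mx_cvg_cst _ _ l).
rewrite mul0mx add0r in h; apply: cvg_trans h; apply: near_eq_cvg.
by apply: nearW => x; rewrite mulmxK // subrK.
Unshelve. all: by end_near. Qed.

End MatrixLimits.

(** * Finite-dimensional modules *)

Section Modules.
Variables (R : realType) (B : ralgebra R).
Implicit Types X Y Z : fdmod B.

Section Act.
Variable X : fdmod B.
Lemma actD a b : fd_act X (a + b) = fd_act X a + fd_act X b.
Proof. exact: (amorphD (fd_morphism X)). Qed.
Lemma actM a b : fd_act X (a * b) = fd_act X a *m fd_act X b.
Proof. exact: (amorphM (fd_morphism X)). Qed.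
Lemma actA r : fd_act X (alg B r) = r%:M.
Proof. exact: (amorphA (fd_morphism X)). Qed.
Lemma actN a : fd_act X (- a) = - fd_act X a.
Proof. exact: (amorphN (fd_morphism X)). Qed.
End Act.

Definition intertw X Y (P : 'M[R]_(fd_dim Y, fd_dim X)) :=
  forall b, P *m fd_act X b = fd_act Y b *m P.

Lemma intertwM X Y Z (P : 'M[R]_(fd_dim Y, fd_dim X)) (Q : 'M[R]_(fd_dim Z, fd_dim Y)) :
  intertw P -> intertw Q -> @intertw X Z (Q *m P).
Proof. by move=> iP iQ b; rewrite -mulmxA iP !mulmxA iQ. Qed.

Lemma intertw1 X : @intertw X X 1%:M.
Proof. by move=> b; rewrite mul1mx mulmx1. Qed.

Lemma intertw0 X Y : @intertw X Y 0.
Proof. by move=> b; rewrite mul0mx mulmx0. Qed.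

Lemma intertwD X Y (P Q : 'M[R]_(fd_dim Y, fd_dim X)) :
  intertw P -> intertw Q -> @intertw X Y (P + Q).
Proof. by move=> iP iQ b; rewrite mulmxDl mulmxDr iP iQ. Qed.

Lemma intertwN X Y (P : 'M[R]_(fd_dim Y, fd_dim X)) : intertw P -> @intertw X Y (- P).
Proof. by move=> iP b; rewrite mulNmx mulmxN iP. Qed.

Lemma intertwB X Y (P Q : 'M[R]_(fd_dim Y, fd_dim X)) :
  intertw P -> intertw Q -> @intertw X Y (P - Q).
Proof. by move=> iP iQ; apply: intertwD => //; exact: intertwN. Qed.

Lemma intertwZ X Y r (P : 'M[R]_(fd_dim Y, fd_dim X)) : intertw P -> @intertw X Y (r *: P).
Proof. by move=> iP b; rewrite -scalemxAl -scalemxAr iP. Qed.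

Lemma fd_isoP X Y : fd_iso X Y <-> exists (P : 'M[R]_(fd_dim Y, fd_dim X)) Q,
  [/\ intertw P, @intertw Y X Q, P *m Q = 1%:M & Q *m P = 1%:M].
Proof.
split=> [[P [Q [PQ QP iP]]]|[P [Q [iP iQ PQ QP]]]]; exists P, Q; split=> // b.
by rewrite -[LHS]mulmx1 -PQ mulmxA -(mulmxA Q) -iP !mulmxA QP mul1mx.
Qed.

Definition fd_add_act X Y b : 'M[R]_(fd_dim X + fd_dim Y) :=
  block_mx (fd_act X b) 0 0 (fd_act Y b).

Lemma fd_add_morphism X Y : @algebra_morphism R B (mx_ralgebra R _) (fd_add_act X Y).
Proof.
split=> [a b|a b|r]; rewrite /fd_add_act.
- by rewrite !actD add_block_mx !addr0.
- rewrite !actM; apply: esym; apply: etrans (mulmx_block _ _ _ _ _ _ _ _) _.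
  by rewrite !mulmx0 !mul0mx !addr0 !add0r.
- by rewrite !actA; apply: esym; exact: scalar_mx_block.
Qed.
Definition fd_add X Y : fdmod B := FdMod (fd_add_morphism X Y).

Definition fd_in1 X Y : 'M[R]_(fd_dim (fd_add X Y), fd_dim X) := col_mx 1%:M 0.
Definition fd_in2 X Y : 'M[R]_(fd_dim (fd_add X Y), fd_dim Y) := col_mx 0 1%:M.
Definition fd_pr1 X Y : 'M[R]_(fd_dim X, fd_dim (fd_add X Y)) := row_mx 1%:M 0.
Definition fd_pr2 X Y : 'M[R]_(fd_dim Y, fd_dim (fd_add X Y)) := row_mx 0 1%:M.

(** A direct sum decomposition given by inclusions and projections: isomorphisms between sums reduce
    to identities among these four maps, without block matrices. *)
Definition biprod X Y Z (u : 'M[R]_(fd_dim Z, fd_dim X)) v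
    (u' : 'M[R]_(fd_dim Z, fd_dim Y)) v' :=
  [/\ intertw u, @intertw Z X v, intertw u' & @intertw Z Y v'] /\
  [/\ v *m u = 1%:M, v' *m u' = 1%:M, v *m u' = 0, v' *m u = 0
    & u *m v + u' *m v' = 1%:M].

Lemma biprod_add X Y : biprod (fd_in1 X Y) (fd_pr1 X Y) (fd_in2 X Y) (fd_pr2 X Y).
Proof.
rewrite /fd_in1 /fd_in2 /fd_pr1 /fd_pr2; split; split.
- by move=> b; rewrite /= /fd_add_act mul_col_mx mul_block_col !mul0mx !mulmx0 mul1mx mulmx1 addr0 add0r.
- by move=> b; rewrite /= /fd_add_act mul_mx_row mul_row_block !mul0mx !mulmx0 mul1mx mulmx1 !addr0.
- by move=> b; rewrite /= /fd_add_act mul_col_mx mul_block_col !mul0mx !mulmx0 mul1mx mulmx1 addr0 add0r.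
- by move=> b; rewrite /= /fd_add_act mul_mx_row mul_row_block !mul0mx !mulmx0 mul1mx mulmx1 !add0r.
- by rewrite mul_row_col mul1mx mul0mx addr0.
- by rewrite mul_row_col mul1mx mul0mx add0r.
- by rewrite mul_row_col mul1mx mul0mx addr0.
- by rewrite mul_row_col mul0mx mulmx0 addr0.
- rewrite !mul_col_row !mul1mx !mul0mx add_block_mx !addr0 add0r.
  by apply: esym; exact: scalar_mx_block.
Qed.

Lemma biprod_iso X Y Z u v u' v' : @biprod X Y Z u v u' v' -> fd_iso Z (fd_add X Y).
Proof.
move=> [[iu iv iu' iv'] [vu vu' c1 c2 s]].
have [[ia ib ia' ib'] [ba ba' d1 d2 t]] := biprod_add X Y.
set a := fd_in1 X Y in ia ba d2 t; set a' := fd_in2 X Y in ia' ba' d1 t.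
set b := fd_pr1 X Y in ib ba d1 t; set b' := fd_pr2 X Y in ib' ba' d2 t.
apply/fd_isoP; exists (a *m v + a' *m v'), (u *m b + u' *m b'); split.
- by apply: intertwD; apply: intertwM.
- by apply: intertwD; apply: intertwM.
- rewrite mulmxDl !mulmxDr !mulmxA -!(mulmxA a) -!(mulmxA a') vu vu' c1 c2.
  by rewrite !(mul0mx, mulmx0, mul1mx, mulmx1, addr0, add0r).
- rewrite mulmxDl !mulmxDr !mulmxA -!(mulmxA u) -!(mulmxA u') ba ba' d1 d2.
  by rewrite !(mul0mx, mulmx0, mul1mx, mulmx1, addr0, add0r).
Qed.

Lemma iso_biprod X Y Z : fd_iso Z (fd_add X Y) -> exists u v u' v', @biprod X Y Z u v u' v'.
Proof.
case/fd_isoP=> P [Q [iP iQ PQ QP]].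
have [[ia ib ia' ib'] [ba ba' d1 d2 t]] := biprod_add X Y.
exists (Q *m fd_in1 X Y), (fd_pr1 X Y *m P), (Q *m fd_in2 X Y), (fd_pr2 X Y *m P).
split; split; try exact: intertwM.
- by rewrite mulmxA -(mulmxA _ P) PQ mulmx1.
- by rewrite mulmxA -(mulmxA _ P) PQ mulmx1.
- by rewrite mulmxA -(mulmxA _ P) PQ mulmx1.
- by rewrite mulmxA -(mulmxA _ P) PQ mulmx1.
- by rewrite !mulmxA -mulmxDl -!(mulmxA Q) -mulmxDr t mulmx1.
Qed.

Lemma fd_add_iso X X' Y Y' : fd_iso X X' -> fd_iso Y Y' -> fd_iso (fd_add X Y) (fd_add X' Y').
Proof.
case/fd_isoP=> P [Q [iP iQ PQ QP]] /fd_isoP[P' [Q' [iP' iQ' PQ' QP']]].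
have [[ia ib ia' ib'] [ba ba' d1 d2 t]] := biprod_add X Y.
apply: (@biprod_iso _ _ _ (fd_in1 X Y *m Q) (P *m fd_pr1 X Y) (fd_in2 X Y *m Q') (P' *m fd_pr2 X Y)).
split; split; try exact: intertwM.
- by rewrite mulmxA -(mulmxA P) ba mulmx1.
- by rewrite mulmxA -(mulmxA P') ba' mulmx1.
- by rewrite mulmxA -(mulmxA P) d1 mulmx0 mul0mx.
- by rewrite mulmxA -(mulmxA P') d2 mulmx0 mul0mx.
- by rewrite !mulmxA -(mulmxA _ Q) -(mulmxA _ Q') QP QP' !mulmx1.
Qed.

Lemma fd_addC X Y : fd_iso (fd_add X Y) (fd_add Y X).
Proof.
have [[ia ib ia' ib'] [ba ba' d1 d2 t]] := biprod_add X Y.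
apply: (@biprod_iso _ _ _ (fd_in2 X Y) (fd_pr2 X Y) (fd_in1 X Y) (fd_pr1 X Y)).
by split; split=> //; rewrite addrC.
Qed.

Lemma fd_addA X Y Z : fd_iso (fd_add X (fd_add Y Z)) (fd_add (fd_add X Y) Z).
Proof.
have [[iu iv iu' iv'] [vu vu' c1 c2 s]] := biprod_add X (fd_add Y Z).
have [[ia ib ia' ib'] [ba ba' d1 d2 t]] := biprod_add Y Z.
have [[ka kb ka' kb'] [wa wa' e1 e2 r]] := biprod_add X Y.
set u := fd_in1 X (fd_add Y Z) in iu vu c2 s; set u' := fd_in2 X (fd_add Y Z) in iu' vu' c1 s.
set v := fd_pr1 X (fd_add Y Z) in iv vu c1 s; set v' := fd_pr2 X (fd_add Y Z) in iv' vu' c2 s.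
set a := fd_in1 Y Z in ia ba d2 t; set a' := fd_in2 Y Z in ia' ba' d1 t.
set b := fd_pr1 Y Z in ib ba d1 t; set b' := fd_pr2 Y Z in ib' ba' d2 t.
set k := fd_in1 X Y in ka wa e2 r; set k' := fd_in2 X Y in ka' wa' e1 r.
set l := fd_pr1 X Y in kb wa e1 r; set l' := fd_pr2 X Y in kb' wa' e2 r.
apply: (@biprod_iso _ _ _ (u *m l + u' *m a *m l') (k *m v + k' *m b *m v') (u' *m a') (b' *m v')).
split; split.
- by apply: intertwD; do ?apply: intertwM.
- by apply: intertwD; do ?apply: intertwM.
- by apply: intertwM.
- by apply: intertwM.
- rewrite mulmxDl !mulmxDr !mulmxA -!(mulmxA _ v) -!(mulmxA _ v') vu vu' c1 c2.
  by rewrite !mulmx1 !mulmx0 !mul0mx addr0 add0r -(mulmxA _ b) ba mulmx1 r.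
- by rewrite mulmxA -(mulmxA _ v') vu' mulmx1.
- rewrite mulmxDl !mulmxA -!(mulmxA _ v) -!(mulmxA _ v') vu' c1 !(mul0mx, mulmx0, mul1mx, mulmx1, addr0, add0r).
  by rewrite -mulmxA d1 mulmx0.
- rewrite mulmxDr !mulmxA -!(mulmxA _ v') vu' c2 !(mul0mx, mulmx0, mul1mx, mulmx1, addr0, add0r).
  by rewrite d2 mul0mx.
- rewrite mulmxDl !mulmxDr !mulmxA -!(mulmxA _ l) -!(mulmxA _ l') wa wa' e1 e2.
  rewrite !(mul0mx, mulmx0, mul1mx, mulmx1, addr0, add0r) -addrA -!(mulmxA u') -mulmxDr.
  by rewrite -mulmxDl t mul1mx s.
Qed.

Lemma fd_add_dim0 X Y : fd_dim X = 0%N -> fd_iso (fd_add X Y) Y.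
Proof.
move=> X0; have [[ia ib ia' ib'] [ba ba' d1 d2 t]] := biprod_add X Y.
apply/fd_isoP; exists (fd_pr2 X Y), (fd_in2 X Y); split=> //.
rewrite -[RHS]t [X in X + _](_ : _ = 0) ?add0r //.
suff -> : fd_in1 X Y = 0 by rewrite mul0mx.
by apply/matrixP=> i [j jX]; exfalso; rewrite X0 in jX.
Qed.

Lemma fd_iso_dim0 X Y : fd_dim X = 0%N -> fd_dim Y = 0%N -> fd_iso X Y.
Proof.
move=> X0 Y0; apply/fd_isoP; exists 0, 0; split; try exact: intertw0.
  by apply/matrixP=> -[i iY]; exfalso; rewrite Y0 in iY.
by apply/matrixP=> -[i iX]; exfalso; rewrite X0 in iX.
Qed.

Lemma fd_iso_dim X Y : fd_iso X Y -> fd_dim X = fd_dim Y.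
Proof.
case=> P [Q [PQ QP _]]; apply/eqP; rewrite eqn_leq.
have := mxrankM_maxl Q P; have := mxrankM_maxl P Q; rewrite PQ QP !mxrank1.
by move=> h1 h2; rewrite (leq_trans h2 (rank_leq_col _)) (leq_trans h1 (rank_leq_col _)).
Qed.

(** In a full rank factorisation [u *m v] of [e], cancelling [u] on the left and [v] on the right of
    [e *m e = e] leaves [v *m u = 1%:M]. *)
Lemma idempotent_factor n (e : 'M[R]_n) : e *m e = e ->
  exists r (u : 'M[R]_(n, r)) (v : 'M[R]_(r, n)), v *m u = 1%:M /\ u *m v = e.
Proof.
move=> ee; have uv : col_base e *m row_base e = e := mulmx_base e.
exists (\rank e), (col_base e), (row_base e); split=> //.
have uf := col_base_full e; have vf := row_base_free e.
move: (col_base e) (row_base e) uv uf vf => u v uv uf vf.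
apply: (row_free_inj vf); rewrite mul1mx; apply: (row_full_inj uf).
by rewrite -[in LHS]mulmxA uv mulmxA uv ee.
Qed.

(** The image carries the compressed action [v *m fd_act X b *m u], which is multiplicative because
    [e] commutes with the action. *)
Lemma split_idempotent X (e : 'M[R]_(fd_dim X)) : intertw e -> e *m e = e ->
  exists (Y : fdmod B) (u : 'M[R]_(fd_dim X, fd_dim Y)) (v : 'M[R]_(fd_dim Y, fd_dim X)),
    [/\ intertw u, intertw v, v *m u = 1%:M & u *m v = e].
Proof.
move=> ie /idempotent_factor[r [u [v [vu uv]]]].
have eu : e *m u = u by rewrite -uv -mulmxA vu mulmx1.
have ve : v *m e = v by rewrite -uv mulmxA vu mul1mx.
have m : @algebra_morphism R B (mx_ralgebra R _) (fun b => v *m fd_act X b *m u).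
  split=> [a b|a b|x].
  - by rewrite actD mulmxDr mulmxDl.
  - rewrite actM; apply: esym; rewrite -[LHS]/(_ *m _) !mulmxA -(mulmxA _ u) uv.
    by rewrite -(mulmxA v _ e) -ie mulmxA ve.
  - by rewrite actA mul_mx_scalar -scalemxAl vu scalemx1.
exists (FdMod m), u, v; split=> // b /=.
- by rewrite !mulmxA uv ie -mulmxA eu.
- by rewrite -mulmxA uv -mulmxA -ie mulmxA ve.
Qed.

Lemma idempotent_add X Y (u : 'M[R]_(fd_dim X, fd_dim Y)) v : intertw u -> @intertw X Y v ->
  v *m u = 1%:M -> exists Z u' v', @biprod Y Z X u v u' v'.
Proof.
move=> iu iv vu.
have ie : @intertw X X (1%:M - u *m v) by apply: intertwB; [exact: intertw1|exact: intertwM].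
have vE : v *m (1%:M - u *m v) = 0 by rewrite mulmxBr mulmx1 mulmxA vu mul1mx subrr.
have Eu : (1%:M - u *m v) *m u = 0 by rewrite mulmxBl mul1mx -mulmxA vu mulmx1 subrr.
have ee : (1%:M - u *m v) *m (1%:M - u *m v) = 1%:M - u *m v.
  by rewrite mulmxBl mul1mx -mulmxA vE mulmx0 subr0.
have [Z [u' [v' [iu' iv' vu' uv']]]] := split_idempotent ie ee.
exists Z, u', v'; split; split=> //; last by rewrite uv' addrC subrK.
  by rewrite -[u']mulmx1 -vu' !mulmxA -(mulmxA v) uv' vE mul0mx.
by rewrite -[v']mul1mx -vu' -!mulmxA (mulmxA u') uv' Eu mulmx0.
Qed.
End Modules.

(** * Schur's lemma, cancellation and uniqueness of decompositions *)

Section Semisimple.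
Variables (R : realType) (B : ralgebra R).
Implicit Types X Y Z : fdmod B.
Implicit Types S T : irrmod B.

Lemma mx_colvecP m n (P Q : 'M[R]_(m, n)) : (forall v : 'cV_n, P *m v = Q *m v) -> P = Q.
Proof.
by move=> PQ; apply/matrixP=> i j; have := PQ (delta_mx j 0); rewrite -!colE => /colP/(_ i); rewrite !mxE.
Qed.

Lemma schur S T (P : 'M[R]_(fd_dim T, fd_dim S)) : @intertw R B S T P ->
  P = 0 \/ exists Q, [/\ @intertw R B T S Q, P *m Q = 1%:M & Q *m P = 1%:M].
Proof.
move=> iP; have [S0 irrS] := irrP S; have [T0 irrT] := irrP T.
pose f : {linear 'cV[R]_(fd_dim S) -> 'cV[R]_(fd_dim T)} := mulmx P.
have kS b v : v \in lker (linfun f) -> fd_act S b *m v \in lker (linfun f).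
  by rewrite !memv_ker !lfunE /= mulmxA iP -mulmxA => /eqP->; rewrite mulmx0.
have [kE|kE] := irrS _ kS; last first.
  left; apply: mx_colvecP => v; have : v \in lker (linfun f) by rewrite kE memvf.
  by rewrite memv_ker lfunE mul0mx => /eqP.
have P0 (v : 'cV[R]_(fd_dim S)) : P *m v = 0 -> v = 0.
  move=> Pv; apply/eqP; rewrite -memv0 -kE memv_ker lfunE; exact/eqP.
have iS b v : v \in limg (linfun f) -> fd_act T b *m v \in limg (linfun f).
  move=> /memv_imgP[w _ ->]; rewrite lfunE /= mulmxA -iP -mulmxA.
  by rewrite -[_ *m (_ *m w)](lfunE f) memv_img ?memvf.
have [iE|iE] := irrT _ iS.
  left; apply: mx_colvecP => v; rewrite mul0mx; apply/eqP.
  by rewrite -memv0 -iE -[P *m v](lfunE f) memv_img ?memvf.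
(* [P] is now injective and surjective; preimages of the basis vectors form a right inverse, which
   injectivity turns into a left inverse. *)
right; have /choice[q qE] : forall j, exists w : 'cV[R]_(fd_dim S), P *m w = delta_mx j 0.
  move=> j; have : delta_mx j 0 \in limg (linfun f) by rewrite iE memvf.
  by case/memv_imgP=> w _ ->; exists w; rewrite lfunE.
pose Q : 'M[R]_(fd_dim S, fd_dim T) := \matrix_(i, j) q j i 0.
have PQ : P *m Q = 1%:M.
  apply: mx_colvecP => v; apply/matrixP=> i k; rewrite (ord1 k) !mul1mx -mulmxA.
  have -> : Q *m v = \sum_j v j 0 *: q j.
    by apply/colP=> a; rewrite summxE mxE; apply: eq_bigr => j _; rewrite !mxE mulrC.
  rewrite mulmx_sumr summxE (bigD1 i) //= big1 => [|j ji].
    by rewrite -scalemxAr qE !mxE !eqxx mulr1 addr0.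
  by rewrite -scalemxAr qE !mxE eq_sym (negPf ji) mulr0.
have QP : Q *m P = 1%:M.
  apply: mx_colvecP => v; apply/eqP; rewrite -subr_eq0 -mulmxBl; apply/eqP/P0.
  by rewrite mulmxA mulmxBr mulmx1 mulmxA PQ mul1mx subrr mul0mx.
have /fd_isoP : fd_iso S T by exists P, Q.
by exists Q; split=> // b; rewrite -[LHS]mulmx1 -PQ mulmxA -(mulmxA Q) -iP !mulmxA QP mul1mx.
Qed.

(** Iterated binary sums up to isomorphism, so that inductions on the list never handle an indexed
    direct sum. The link with [fd_dsum] is [decomp_dsum]. *)
Fixpoint decomp (s : seq (irrmod B)) X : Prop :=
  if s is T :: s' then exists X', decomp s' X' /\ fd_iso X (fd_add T X')
  else fd_dim X = 0%N.

Lemma decomp_iso s X Y : fd_iso X Y -> decomp s X -> decomp s Y.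
Proof.
case: s => [|S s] XY /=; first by rewrite (fd_iso_dim XY).
by case=> X' [dX' XE]; exists X'; split=> //; apply: fd_iso_trans XE; exact: fd_iso_sym.
Qed.

Lemma decomp_unique s X Y : decomp s X -> decomp s Y -> fd_iso X Y.
Proof.
elim: s X Y => [|S s IH] X Y /=; first exact: fd_iso_dim0.
move=> [X' [dX XE]] [Y' [dY YE]]; apply: fd_iso_trans XE _.
apply: fd_iso_trans (fd_iso_sym YE); apply: fd_add_iso; first exact: fd_iso_refl.
exact: IH.
Qed.

Lemma decomp_cat s t X Y : decomp s X -> decomp t Y -> decomp (s ++ t) (fd_add X Y).
Proof.
elim: s X => [|S s IH] X /=.
  by move=> X0; apply: decomp_iso; exact/fd_iso_sym/fd_add_dim0.
case=> X' [dX' XE] dY; exists (fd_add X' Y); split; first exact: IH.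
apply: fd_iso_trans (fd_iso_sym (fd_addA _ _ _)).
by apply: fd_add_iso => //; exact: fd_iso_refl.
Qed.

Lemma decomp_mid s1 S s2 X : decomp (s1 ++ S :: s2) X ->
  exists2 X', decomp (s1 ++ s2) X' & fd_iso X (fd_add S X').
Proof.
elim: s1 X => [|T s1 IH] X /=; first by case=> X' []; exists X'.
case=> X' [/IH[X'' dX'' X'E] XE]; exists (fd_add T X'').
  by exists X''; split=> //; exact: fd_iso_refl.
apply: fd_iso_trans XE _; apply: fd_iso_trans (fd_add_iso (fd_iso_refl T) X'E) _.
apply: fd_iso_trans (fd_addA _ _ _) _; apply: fd_iso_trans (fd_iso_sym (fd_addA _ _ _)).
by apply: fd_add_iso (fd_addC _ _) (fd_iso_refl _).
Qed.

(* The Schur complement of the component A -> A'. *)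
Lemma iso_cancel Z A X A' Y u v u' v' a b a' b'
    (F : 'M[R]_(fd_dim A, fd_dim A')) :
  @biprod R B A X Z u v u' v' -> @biprod R B A' Y Z a b a' b' ->
  @intertw R B A' A F -> F *m (b *m u) = 1%:M -> (b *m u) *m F = 1%:M -> fd_iso X Y.
Proof.
move=> [[iu iv iu' iv'] [vu vu' c1 c2 s]] [[ia ib ia' ib'] [ba ba' d1 d2 t]] iF Fl Fr.
apply/fd_isoP; exists (b' *m (1%:M - u *m F *m b) *m u'), (v' *m a').
have e1 : v' *m (1%:M - u *m F *m b) = v'.
  by rewrite mulmxBr mulmx1 !mulmxA c2 !mul0mx subr0.
have e2 : (1%:M - u *m F *m b) *m u = 0.
  by rewrite mulmxBl mul1mx -!mulmxA Fl mulmx1 subrr.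
have e3 : b *m (1%:M - u *m F *m b) = 0.
  by rewrite mulmxBr mulmx1 !mulmxA Fr mul1mx subrr.
have e4 : (1%:M - u *m F *m b) *m a' = a'.
  by rewrite mulmxBl mul1mx -!mulmxA d1 !mulmx0 subr0.
have iP : @intertw R B Z Z (1%:M - u *m F *m b).
  by apply: intertwB; [exact: intertw1|do ?apply: intertwM].
move: (1%:M - u *m F *m b) iP e1 e2 e3 e4 => P iP e1 e2 e3 e4; split.
- by do ?apply: intertwM.
- exact: intertwM.
- have E : u' *m v' = 1%:M - u *m v by rewrite -s addrAC subrr add0r.
  rewrite mulmxA -(mulmxA _ u') E mulmxBr mulmx1 mulmxA -(mulmxA b' _ u) e2.
  by rewrite mulmx0 mul0mx subr0 -mulmxA e4.
- have E : a' *m b' = 1%:M - a *m b by rewrite -t addrAC subrr add0r.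
  rewrite !mulmxA -(mulmxA v') E mulmxBr mulmx1 mulmxBl mulmxA -(mulmxA _ b) e3.
  by rewrite mulmx0 subr0 e1 vu'.
Qed.

(** By Schur's lemma the component from [S] to [S] of the isomorphism is invertible or zero. If it
    is zero, the identity of [S] factors through [Y], and the splitting of the target can be changed
    until the component is the identity. *)
Lemma iso_cancel_irr S X Y : fd_iso (fd_add S X) (fd_add S Y) -> fd_iso X Y.
Proof.
move=> h; have bY := biprod_add S Y.
have [u [v [u' [v' bX]]]] := iso_biprod (fd_iso_sym h).
have [[iu iv iu' iv'] [vu vu' c1 c2 s]] := bX.
have [[ia ib ia' ib'] [ba ba' d1 d2 t]] := bY.
set a := fd_in1 S Y in ia ba d2 t bY; set a' := fd_in2 S Y in ia' ba' d1 t bY.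
set b := fd_pr1 S Y in ib ba d1 t bY; set b' := fd_pr2 S Y in ib' ba' d2 t bY.
have [bu0|[F [iF Fr Fl]]] := schur (intertwM iu ib).
  (* shear so that the diagonal component becomes the identity *)
  have w : v *m a' *m b' *m u = 1%:M.
    have : v *m (a *m b + a' *m b') *m u = 1%:M by rewrite t mulmx1.
    by rewrite mulmxDr mulmxDl !mulmxA -(mulmxA v a b) -!(mulmxA _ _ u) bu0 !mulmx0 add0r !mulmxA.
  pose b1 := b + v *m a' *m b'; pose a1 := a' - a *m v *m a'.
  apply: (@iso_cancel (fd_add S Y) S X S Y u v u' v' a b1 a1 b' 1%:M bX).
  - have iva : intertw (v *m a') by exact: intertwM.
    split; split=> //.
    + by apply: intertwD => //; apply: intertwM.
    + by apply: intertwB => //; rewrite -mulmxA; apply: intertwM.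
    + by rewrite mulmxDl ba -!mulmxA d2 !mulmx0 addr0.
    + by rewrite mulmxBr ba' !mulmxA d2 !mul0mx subr0.
    + rewrite mulmxDl !mulmxBr d1 !mulmxA ba mul1mx -!(mulmxA _ b') ba' d2.
      by rewrite !(mul0mx, mulmx0, mul1mx, mulmx1, subr0, sub0r) addNr.
    + rewrite mulmxDr mulmxBl !mulmxA -addrA (addrC (a *m v *m a' *m b')) subrK.
      exact: t.
  - exact: intertw1.
  - by rewrite mul1mx mulmxDl bu0 add0r.
  - by rewrite mulmx1 mulmxDl bu0 add0r.
exact: iso_cancel bX bY iF Fl Fr.
Qed.

(** Krull-Schmidt exchange: if [S] has a nonzero component in the head of [t], the two are
    isomorphic and cancel; otherwise [S] is a summand of the tail, and the induction hypothesis
    applies there. *)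
Lemma decomp_exchange S X X' t : fd_iso X (fd_add S X') -> decomp t X ->
  exists t1 T t2, [/\ t = t1 ++ T :: t2, fd_iso S T & decomp (t1 ++ t2) X'].
Proof.
elim: t X X' => [|T t IH] X X' XE /=.
  move=> X0; have [S0 _] := irrP S; have := fd_iso_dim XE; rewrite X0 /= => e.
  by have := ltn_addr (fd_dim X') S0; rewrite -e.
case=> Y [dY XE'].
have [u [v [u' [v' bX]]]] := iso_biprod XE.
have [a [b [a' [b' bY]]]] := iso_biprod XE'.
have [[iu iv iu' iv'] [vu vu' c1 c2 s]] := bX.
have [[ia ib ia' ib'] [ba ba' d1 d2 r]] := bY.
have [bu0|[F [iF Fr Fl]]] := schur (intertwM iu ib); last first.
  exists [::], T, t; split=> //; first by exists (b *m u), F; split=> //; exact: intertwM.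
  by apply: decomp_iso dY; apply: fd_iso_sym; exact: iso_cancel bX bY iF Fl Fr.
have w : v *m a' *m b' *m u = 1%:M.
  have : v *m (a *m b + a' *m b') *m u = 1%:M by rewrite r mulmx1.
  by rewrite mulmxDr mulmxDl !mulmxA -(mulmxA v a b) -!(mulmxA _ _ u) bu0 !mulmx0 add0r !mulmxA.
(* [S] is a direct summand of [Y], by the inclusion [b' *m u] and the retraction [v *m a']. *)
have [Y' [p [q bZ]]] := idempotent_add (intertwM iu ib') (intertwM ia' iv) (etrans (mulmxA _ _ _) w).
have YE := biprod_iso bZ.
have [t1 [T' [t2 [-> ST' dY']]]] := IH _ _ YE dY.
exists (T :: t1), T', t2; split=> //=; exists Y'; split=> //.
apply: (@iso_cancel_irr S); apply: fd_iso_trans (fd_iso_sym XE) _.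
apply: fd_iso_trans XE' _; apply: fd_iso_trans (fd_add_iso (fd_iso_refl _) YE) _.
apply: fd_iso_trans (fd_addA _ _ _) _; apply: fd_iso_trans (fd_iso_sym (fd_addA _ _ _)).
exact: fd_add_iso (fd_addC _ _) (fd_iso_refl _).
Qed.

Definition irrsum (s : seq (irrmod B)) : modgrp B :=
  \sum_(S <- s) << \pi_(irrcls B) S >>.

Lemma pi_irr S T : fd_iso S T <-> \pi_(irrcls B) S = \pi_(irrcls B) T.
Proof. by split=> [h|/eqmodP/asboolP//]; apply/eqmodP/asboolP. Qed.

Lemma irrsum_decomp s t X : decomp s X -> decomp t X -> irrsum s = irrsum t.
Proof.
elim: s t X => [|S s IH] t X /=.
  case: t => // T t X0 [X' [_ /fd_iso_dim]]; rewrite X0 /=; have [T0 _] := irrP T.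
  by move: T0; case: (fd_dim T).
case=> X' [dX' XE] dt; have [t1 [T [t2 [-> ST dX'']]]] := decomp_exchange XE dt.
rewrite /irrsum big_cons big_cat big_cons /= -/(irrsum _) (IH _ _ dX' dX'').
by rewrite /irrsum big_cat /= addrCA ((pi_irr _ _).1 ST).
Qed.
End Semisimple.

(** * Orthogonal complements and existence of decompositions *)

Section Decomposition.
Variables (R : realType) (B : ralgebra R).
Implicit Types X Y Z : fdmod B.
Implicit Types S T : irrmod B.

(** Adjoints act through the algebra, which makes orthogonal complements of submodules
    submodules. *)
Definition star_closed X := forall b, exists b', (fd_act X b)^T = fd_act X b'.

Lemma vspace_matrix n (E : {vspace 'cV[R]_n}) : exists r (A : 'M[R]_(n, r)),
  [/\ forall c : 'cV_r, A *m c \in E, forall v, v \in E -> exists c : 'cV_r, v = A *m c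
    & forall c : 'cV_r, A *m c = 0 -> c = 0].
Proof.
exists (\dim E), (\matrix_(i, j) (vbasis E)`_j i 0).
set A := \matrix_(i, j) _.
have AE (c : 'cV_(\dim E)) : A *m c = \sum_j c j 0 *: (vbasis E)`_j.
  by apply/colP=> i; rewrite summxE mxE; apply: eq_bigr => j _; rewrite !mxE mulrC.
split=> [c|v vE|c].
- rewrite AE; apply: memv_suml => j _; apply/memvZ/vbasis_mem/mem_nth.
  by rewrite size_tuple.
- exists (\col_j coord (vbasis E) j v); rewrite AE {1}(coord_vbasis vE).
  by apply: eq_bigr => j _; rewrite mxE.
- have /freeP fr := basis_free (vbasisP E); rewrite AE => /(fr (fun j => c j 0)) c0.
  by apply/colP=> j; rewrite c0 mxE.
Qed.

(** The orthogonal projection onto [E], by the least squares formula. Stability gives be = ebe for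
    the action of every b; transposing this identity for the adjoint of b gives eb = ebe. *)
Lemma stable_idempotent X (E : {vspace 'cV[R]_(fd_dim X)}) : star_closed X ->
    (forall b v, v \in E -> fd_act X b *m v \in E) ->
  exists e, [/\ @intertw R B X X e, e *m e = e, forall v, v \in E -> e *m v = v
              & forall v, e *m v \in E].
Proof.
move=> Xs Es; have [r [A [A1 A2 A3]]] := vspace_matrix E.
pose G := A^T *m A; have Gu : G \in unitmx.
  apply: unitmx_inj0 => v Gv; apply/A3/dot_self_eq0.
  by rewrite trmx_mul -mulmxA (mulmxA A^T) Gv mulmx0 mxE.
pose e := A *m invmx G *m A^T.
have eA : e *m A = A by rewrite /e -mulmxA mulmxKV.
have Ae : A^T *m e = A^T by rewrite /e !mulmxA mulmxV // mul1mx.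
have stab b : e *m (fd_act X b *m A) = fd_act X b *m A.
  apply: mx_colvecP => v; rewrite -mulmxA -(mulmxA _ A).
  have [c ->] := A2 _ (Es b _ (A1 v)); by rewrite mulmxA eA.
have es : e^T = e.
  by rewrite /e !trmx_mul trmxK trmx_inv trmx_mul trmxK mulmxA.
have h b : fd_act X b *m e = e *m (fd_act X b *m e).
  by rewrite /e !mulmxA -(mulmxA _ (fd_act X b) A) -/e stab.
have eeA : e *m e = e by rewrite {2}/e !mulmxA eA.
have eE v : v \in E -> e *m v = v by move=> /A2[c ->]; rewrite mulmxA eA.
have Ee v : e *m v \in E by rewrite /e -!mulmxA; exact: A1.
exists e; split=> // b; have [b' bE] := Xs b; rewrite h.
move: (e) es h => f fs h; apply: (can_inj (@trmxK _ _ _)).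
by rewrite !trmx_mul fs bE h -!mulmxA.
Qed.

Lemma fd_zero_morphism : @algebra_morphism R B (mx_ralgebra R 0) (fun=> 0).
Proof. have h (A C : 'M[R]_0) : A = C by apply/matrixP => -[].
by split=> [a b|a b|r]; exact: h. Qed.
Definition fd_zero : fdmod B := FdMod fd_zero_morphism.

Hypothesis ss : forall X, exists Y, fd_iso X Y /\ star_closed Y.

(** Strong induction on the dimension. Each round passes to a star-closed copy, since the summands
    split off need not be star-closed themselves. *)
Lemma decomp_ex X : exists s, decomp s X.
Proof.
have [n] := ubnP (fd_dim X); elim: n X => // n IH X; rewrite ltnS => Xn.
have [X0|X0] := posnP (fd_dim X); first by exists [::].
have [Y [XY Ys]] := ss X; have dXY := fd_iso_dim XY.
have [Yirr|] := pselect (fd_irreducible Y).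
  exists [:: IrrMod Yirr], fd_zero; split=> //; apply: fd_iso_trans XY _.
  exact: fd_iso_trans (fd_iso_sym (fd_add_dim0 _ (X := fd_zero) erefl)) (fd_addC _ _).
rewrite dXY in X0.
rewrite /fd_irreducible => /not_andP[//|/existsNP[E /not_implyP[Es /not_orP[E0 E1]]]].
have [e [ie ee eE Ee]] := stable_idempotent Ys Es.
have [Y1 [u [v [iu iv vu uv]]]] := split_idempotent ie ee.
have [Y2 [u' [v' bp]]] := idempotent_add iu iv vu.
have YE := biprod_iso bp; have dY := fd_iso_dim YE.
have [_ [_ _ _ _ s1]] := bp.
have d1 : (0 < fd_dim Y1)%N.
  rewrite lt0n; apply/eqP => d1; apply: E0; apply/eqP; rewrite -subv0; apply/subvP => w wE.
  rewrite -(eE _ wE) -uv (_ : u = 0) ?mul0mx ?mem0v //.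
  by apply/matrixP=> i [j jd]; exfalso; rewrite d1 in jd.
have d2 : (0 < fd_dim Y2)%N.
  rewrite lt0n; apply/eqP => d2; apply: E1; apply/eqP; rewrite eqEsubv subvf; apply/subvP => w _.
  rewrite -[w]mul1mx -s1 (_ : u' = 0) ?mul0mx ?addr0 ?uv //.
  by apply/matrixP=> i [j jd]; exfalso; rewrite d2 in jd.
rewrite /= in dY; have dd : fd_dim X = (fd_dim Y1 + fd_dim Y2)%N by rewrite dXY.
have [|s1' ds1] := IH Y1; first by rewrite (leq_trans _ Xn) // dd -addn1 leq_add2l.
have [|s2' ds2] := IH Y2; first by rewrite (leq_trans _ Xn) // dd -add1n leq_add2r.
exists (s1' ++ s2'); apply: (decomp_iso (fd_iso_sym XY)); apply: (decomp_iso (fd_iso_sym YE)).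
exact: decomp_cat.
Qed.

End Decomposition.

(** * Classes of modules in the free group on irreducible classes *)

Section ModuleClass.
Variables (R : realType) (B : ralgebra R).
Implicit Types X Y Z : fdmod B.
Implicit Types S T : irrmod B.

Lemma cast_iso X Y (e : fd_dim X = fd_dim Y) :
  (forall b, fd_act Y b = castmx (e, e) (fd_act X b)) -> fd_iso X Y.
Proof.
case: Y e => n f m /= e; case: n / e f m => f m E.
exists 1%:M, 1%:M; split=> [||b]; rewrite ?mul1mx ?mulmx1 //= E castmx_id.
Qed.

Lemma dsum_recl k (T : 'I_k.+1 -> fdmod B) :
  fd_iso (fd_dsum T) (fd_add (T ord0) (fd_dsum (fun i : 'I_k => T (fintype.lift ord0 i)))).
Proof.
apply: fd_iso_sym; pose Z := fd_add (T ord0) (fd_dsum (fun i : 'I_k => T (fintype.lift ord0 i))).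
have e : fd_dim Z = fd_dim (fd_dsum T) := @mxsize_recl k (fun i => fd_dim (T i)).
apply: (@cast_iso Z _ e) => b.
apply: etrans (mxdiag_recl _) _.
by congr (castmx (_, _) _); exact: Prop_irrelevance.
Qed.

Lemma decomp_dsum k (T : 'I_k -> irrmod B) :
  decomp [seq T i | i <- enum 'I_k] (fd_dsum (fun i => irr_mod (T i))).
Proof.
elim: k T => [|k IH] T.
  by rewrite (size0nil (size_enum_ord 0)) /=; exact: big_ord0.
rewrite enum_ordSl /= -map_comp; exists (fd_dsum (fun i => irr_mod (T (fintype.lift ord0 i)))).
split; first exact: IH.
exact: (dsum_recl (fun i => irr_mod (T i))).
Qed.

(** [modclass] picks a value given by some decomposition; uniqueness of decompositions leaves only
    one. *)
Lemma modclassE s X : decomp s X -> modclass X = irrsum s.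
Proof.
move=> dX; rewrite /modclass; apply: xget_unique.
  exists (size s), (tnth (in_tuple s)); split.
    apply: decomp_unique dX _; have := decomp_dsum (tnth (in_tuple s)).
    by rewrite (map_tnth_enum (in_tuple s)).
  by rewrite /irrsum big_tnth.
move=> x [k [T [XT ->]]]; have dT := decomp_iso (fd_iso_sym XT) (decomp_dsum T).
by rewrite -(irrsum_decomp dT dX) /irrsum big_map big_enum.
Qed.

Lemma irrsum_cat (s t : seq (irrmod B)) : irrsum (s ++ t) = irrsum s + irrsum t.
Proof. by rewrite /irrsum big_cat. Qed.

Lemma coeff_irrsum S (s : seq (irrmod B)) :
  coeff (\pi_(irrcls B) S) (irrsum s) = (count (fun T => irr_isob S T) s)%:R.
Proof.
elim: s => [|T s IH]; first by rewrite /irrsum big_nil coeff0.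
rewrite /irrsum big_cons coeffD -/(irrsum s) IH coeffU mul1r natrD /=.
congr ((nat_of_bool _)%:R + _).
by apply/idP/idP => [/eqP/esym/pi_irr h|/asboolP/pi_irr->//]; exact/asboolP.
Qed.

(** Coefficients in the free abelian group count multiplicities, so the head of [s] reappears in [t]
    up to isomorphism and can be removed from both. *)
Lemma irrsum_iso s t X Y : irrsum s = irrsum t -> decomp s X -> decomp t Y -> fd_iso X Y.
Proof.
elim: s t X Y => [|S s IH] t X Y st /=.
  case: t st => [|T t] st; first by move=> dX dY; exact: fd_iso_dim0.
  have := coeff_irrsum T (T :: t); rewrite -st /irrsum big_nil coeff0 /=.
  have -> : irr_isob T T by apply/asboolP; exact: fd_iso_refl.
  by move/eqP; rewrite eq_sym pnatr_eq0.
case=> X' [dX' XE] dY.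
have : has (fun T => irr_isob S T) t.
  rewrite has_count -(ltr_nat int) -coeff_irrsum -st coeff_irrsum ltr_nat /=.
  by have -> : irr_isob S S by apply/asboolP; exact: fd_iso_refl.
move=> ht; have [t1 [T [t2 [tE ST]]]] : exists t1 T t2, t = t1 ++ T :: t2 /\ fd_iso S T.
  elim: t ht {st dY} => //= T t IHt; case: (boolP (irr_isob S T)) => [/asboolP ST _|_ /IHt].
    by exists [::], T, t.
  by move=> [t1 [T' [t2 [-> ST]]]]; exists (T :: t1), T', t2.
rewrite tE in st dY; have [Y' dY' YE] := decomp_mid dY.
apply: fd_iso_trans XE _; apply: fd_iso_trans (fd_iso_sym YE).
have piST := (pi_irr _ _).1 ST; apply: fd_add_iso ST _; apply: IH dX' dY'.
move: st; rewrite irrsum_cat /irrsum !big_cons -!/(irrsum _) piST addrCA.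
by rewrite -irrsum_cat => /addrI.
Qed.

Lemma freeg_irrsum (x : modgrp B) : exists s t, x = irrsum s - irrsum t.
Proof.
have P0 : exists s t, (0 : modgrp B) = irrsum s - irrsum t.
  by exists [::], [::]; rewrite subrr.
have PD (y z : modgrp B) : (exists s t, y = irrsum s - irrsum t) ->
    (exists s t, z = irrsum s - irrsum t) -> exists s t, y + z = irrsum s - irrsum t.
  move=> [s [t ->]] [s' [t' ->]]; exists (s ++ s'), (t ++ t').
  by rewrite !irrsum_cat opprD addrACA.
have PN (y : modgrp B) : (exists s t, y = irrsum s - irrsum t) ->
    exists s t, - y = irrsum s - irrsum t.
  by move=> [s [t ->]]; exists t, s; rewrite opprB.
have P1 (z : irrcls B) : exists s t, (<< z >> : modgrp B) = irrsum s - irrsum t.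
  by exists [:: repr z], [::]; rewrite /irrsum big_seq1 big_nil subr0 reprK.
have Pn (n : nat) (z : irrcls B) : exists s t, (<< z >> *+ n : modgrp B) = irrsum s - irrsum t.
  by elim: n => [|n IH]; rewrite ?mulr0n // mulrS; exact: PD.
rewrite -(freeg_sumE x); elim: (dom x) => [|z s IH]; rewrite ?big_nil ?big_cons //.
apply: PD => //; case: (coeff z x) => n.
  by have := Pn n z; rewrite freegU_muln natz.
by have := PN _ (Pn n.+1 z); rewrite freegU_muln freegUN NegzE natz.
Qed.

Section Exact.
Hypothesis ss : forall X, exists Y, fd_iso X Y /\ star_closed Y.

Lemma modclass_iso X Y : fd_iso X Y -> modclass X = modclass Y.
Proof.
move=> XY; have [s dX] := decomp_ex ss X.
by rewrite (modclassE dX) (modclassE (decomp_iso XY dX)).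
Qed.

Lemma modclassD X Y : modclass (fd_add X Y) = modclass X + modclass Y.
Proof.
have [[s dX] [t dY]] := (decomp_ex ss X, decomp_ex ss Y).
by rewrite (modclassE dX) (modclassE dY) (modclassE (decomp_cat dX dY)) irrsum_cat.
Qed.

Lemma modclass_inj X Y : modclass X = modclass Y -> fd_iso X Y.
Proof.
have [[s dX] [t dY]] := (decomp_ex ss X, decomp_ex ss Y).
by rewrite (modclassE dX) (modclassE dY) => /irrsum_iso; exact.
Qed.
End Exact.

Definition irrmods (s : seq (irrmod B)) : fdmod B := foldr (fun S X => fd_add S X) (fd_zero B) s.

Lemma decomp_irrmods s : decomp s (irrmods s).
Proof. by elim: s => //= S s IH; exists (irrmods s); split=> //; exact: fd_iso_refl. Qed.

Lemma modgrp_modclass (x : modgrp B) : exists X Y, x = modclass X - modclass Y.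
Proof.
have [s [t ->]] := freeg_irrsum x; exists (irrmods s), (irrmods t).
by rewrite !(modclassE (decomp_irrmods _)).
Qed.
End ModuleClass.

(** * Invariant inner products *)

Section Averaging.
Variable R : realType.

Lemma posd_sum n (I : finType) (i0 : I) (F : I -> 'M[R]_n) :
  (forall i, posd (F i)) -> posd (\sum_i F i).
Proof.
move=> Fp; rewrite (bigD1 i0) //=; apply: posdD => //.
  by rewrite (raddf_sum (@trmx R n n)) /=; apply: eq_bigr => i _; case: (Fp i).
move=> v; rewrite mulmx_sumr mulmx_suml summxE; apply: sumr_ge0 => i _.
exact: posd_ge0.
Qed.

Lemma sign_sq (c : bool) : ((-1) ^+ c * (-1) ^+ c = 1 :> R)%R.
Proof. by rewrite -expr2 sqrr_sign. Qed.

Lemma posd_sandwich n (G x : 'M[R]_n) c : posd G -> x *m x = ((-1) ^+ c)%:M ->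
  posd (x^T *m G *m x).
Proof.
move=> Gp xx; apply: posd_congr => // v xv.
have := congr1 (mulmx x) xv; rewrite mulmx0 mulmxA xx mul_scalar_mx => /eqP.
by rewrite scaler_eq0 signr_eq0 => /eqP.
Qed.

(** A further operator [x] is averaged in by adding the pullback of [G] along [x]: two terms suffice
    because [x] squares to a sign, and the operators already treated stay isometries because they
    commute with [x] up to sign. *)
Lemma invariant_form n (s : seq 'M[R]_n) :
    (forall x, x \in s -> exists c : bool, x *m x = ((-1) ^+ c)%:M) ->
    (forall x y, x \in s -> y \in s -> exists c : bool, x *m y = (-1) ^+ c *: (y *m x)) ->
  exists G, posd G /\ forall x, x \in s -> x^T *m G *m x = G.
Proof.
elim: s => [|x s IH] sq co; first by exists 1%:M; split=> //; exact: posd1.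
have [|y z ys zs|G [Gp GE]] := IH.
- by move=> y ys; apply: sq; rewrite inE ys orbT.
- by apply: co; rewrite inE ?ys ?zs orbT.
have [c xx] := sq x (mem_head _ _).
exists (G + x^T *m G *m x); split.
  have [xs xp] := posd_sandwich Gp xx.
  by apply: posdD => // v; exact: posd_ge0 (posd_sandwich Gp xx).
move=> y; rewrite inE mulmxDr mulmxDl => /predU1P[->|ys].
  rewrite addrC; congr (_ + _).
  rewrite -!mulmxA xx !mulmxA -trmx_mul xx tr_scalar_mx mul_scalar_mx mul_mx_scalar.
  by rewrite scalerA sign_sq scale1r.
rewrite (GE _ ys); congr (_ + _).
have [c' xy] : exists c' : bool, x *m y = (-1) ^+ c' *: (y *m x).
  by apply: co; rewrite inE ?eqxx ?ys ?orbT.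
have -> : y^T *m (x^T *m G *m x) *m y = (x *m y)^T *m G *m (x *m y).
  by rewrite trmx_mul !mulmxA.
have tz : ((-1) ^+ c' *: (y *m x))^T = (-1) ^+ c' *: (y *m x)^T by rewrite linearZ.
rewrite xy tz -!scalemxAl -scalemxAr scalerA sign_sq scale1r trmx_mul.
by rewrite -!mulmxA (mulmxA G) (mulmxA y^T) (mulmxA y^T) GE.
Qed.

(** [y] is the adjoint of [x] for the bilinear form with matrix [G]. *)
Definition adj n (G x y : 'M[R]_n) := x^T *m G = G *m y.

Lemma adjD n (G x y x' y' : 'M[R]_n) : adj G x y -> adj G x' y' -> adj G (x + x') (y + y').
Proof. by rewrite /adj linearD /= mulmxDl mulmxDr => -> ->. Qed.

Lemma adjM n (G x y x' y' : 'M[R]_n) : adj G x y -> adj G x' y' -> adj G (x *m x') (y' *m y).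
Proof. by rewrite /adj trmx_mul -mulmxA => ->; rewrite mulmxA => ->; rewrite mulmxA. Qed.

Lemma adj_scalar n (G : 'M[R]_n) r : adj G r%:M r%:M.
Proof. by rewrite /adj tr_scalar_mx scalar_mxC. Qed.

Lemma adjZ n (G x y : 'M[R]_n) r : adj G x y -> adj G (r *: x) (r *: y).
Proof. by rewrite /adj linearZ /= -scalemxAl -scalemxAr => ->. Qed.

Lemma adj_sum n (G : 'M[R]_n) (I : Type) (r : seq I) (P : pred I) (x y : I -> 'M[R]_n) :
  (forall i, P i -> adj G (x i) (y i)) ->
  adj G (\sum_(i <- r | P i) x i) (\sum_(i <- r | P i) y i).
Proof.
move=> xy; elim: r => [|i r IH]; first by rewrite !big_nil /adj trmx0 mul0mx mulmx0.
by rewrite !big_cons; case: ifP => // Pi; apply: adjD => //; exact: xy.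
Qed.

Lemma adj_sumG n (I : finType) (G : I -> 'M[R]_n) (x y : 'M[R]_n) :
  (forall i, adj (G i) x y) -> adj (\sum_i G i) x y.
Proof.
by move=> xy; rewrite /adj mulmx_sumr mulmx_suml; apply: eq_bigr => i _; exact: xy.
Qed.

(** The adjoint of an isometry is its inverse, and the inverse of [x] is [c *: x]. *)
Lemma adj_orth n (G x : 'M[R]_n) c : x *m x = c%:M -> c * c = 1 -> x^T *m G *m x = G ->
  adj G x (c *: x).
Proof.
move=> xx cc GE; rewrite /adj -[in RHS]GE -!mulmxA -!scalemxAr xx mul_mx_scalar.
by rewrite -scalemxAr scalerA cc scale1r.
Qed.

Lemma adj_conj n (G L x x' y y' : 'M[R]_n) :
  L *m x = y *m L -> y' *m L = L *m x' -> adj G y y' -> adj (L^T *m G *m L) x x'.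
Proof.
rewrite /adj => Lx Ly yy'; rewrite !mulmxA -trmx_mul Lx trmx_mul -(mulmxA _ y^T) yy'.
by rewrite -!mulmxA Ly.
Qed.
End Averaging.

(** * Relations, degrees and homogeneous parts in the Dirac algebra *)

Section Dirac.
Variables (R : realType) (gT : finGroupType) (D : symmetry_data R gT).
Variables (q : nat) (rV : gT -> 'M[R]_q).
Local Notation AV := (dirac_alg D rV).
Local Notation s := (antiu D).
Local Notation om := (cocy D).
Local Notation C := R[i].
Local Notation sc z := (tg_scalar gT z : symalg D).
Local Notation dl g := (tg_delta R g : symalg D).

Definition em (a : symalg D) : AV := pgen (dirac_rel (D := D) rV) (inl a).
Definition vgen (i : 'I_q) : AV := pgen (dirac_rel (D := D) rV) (inr i).

Lemma em_morphism : algebra_morphism em.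
Proof.
split=> [a b|a b|r].
- exact: (pgen_rel (dirac_emb rV (emb_add (@inl (symalg D) 'I_q) a b))).
- exact: (pgen_rel (dirac_emb rV (emb_mul (@inl (symalg D) 'I_q) a b))).
- exact: (pgen_rel (dirac_emb rV (emb_alg (@inl (symalg D) 'I_q) r))).
Qed.

Lemma dirac_ind (P : AV -> Prop) :
    (forall a, P (em a)) -> (forall i, P (vgen i)) ->
    (forall r, P (alg AV r)) -> (forall x y, P x -> P y -> P (x + y)) ->
    (forall x y, P x -> P y -> P (x * y)) -> forall a, P a.
Proof. by move=> Pe Pv Pa PD PM; apply: presented_ind => // -[a|i]; [exact: Pe|exact: Pv]. Qed.

Lemma vgen_sq i : vgen i * vgen i = 1.
Proof. by apply: etrans (pgen_rel (dirac_sq D rV i)) _; rewrite /= rmorph1. Qed.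

Lemma vgen_anti i j : i != j -> vgen i * vgen j = - (vgen j * vgen i).
Proof.
move=> ij; apply: etrans (pgen_rel (dirac_anti D rV ij)) _.
by rewrite /= rmorphN1 mulN1r.
Qed.

Lemma vgen_cplx i z : vgen i * em (sc z) = em (sc z) * vgen i.
Proof. exact: (pgen_rel (dirac_cplx D rV i z)). Qed.

Lemma vgen_conj g i :
  alg AV ((-1) ^+ parity D g) * (em (dl g) * vgen i * em (tg_inv D g)) =
  \sum_j alg AV (rV g j i) * vgen j.
Proof.
apply: etrans (pgen_rel (dirac_conj D rV g i)) _.
by rewrite (@big_morph _ _ (aeval (pgen (dirac_rel (D:=D) rV))) 0 +%R (Cst 0) (@Add _ _)) ?rmorph0.
Qed.

Lemma tg_scalar_mull z (a : tgalg R gT) x : (sc z * a : symalg D) x = z * a x.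
Proof.
rewrite [LHS]ffunE (bigD1 1%g) //= big1 ?addr0.
  by rewrite ffunE eqxx antiu1 invg1 mul1g cocy1l mulr1.
by move=> g /negPf g1; rewrite ffunE g1 !mul0r.
Qed.
Lemma tg_delta_mull g (a : tgalg R gT) x :
  (dl g * a : symalg D) x = twist (s g) (a (g^-1 * x)%g) * om g (g^-1 * x)%g.
Proof.
rewrite [LHS]ffunE (bigD1 g) //= big1 ?addr0; first by rewrite ffunE eqxx mul1r.
by move=> k /negPf kg; rewrite ffunE kg !mul0r.
Qed.

Lemma tg_delta_scalar g z : dl g * sc z = sc (twist (s g) z) * dl g.
Proof.
apply/ffunP=> x; rewrite tg_delta_mull tg_scalar_mull !ffunE.
rewrite -(inj_eq (mulgI g)) mulKVg mulg1; case: eqP => [->|_]; last by rewrite rmorph0 mul0r mulr0.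
by rewrite mulVg cocy1r.
Qed.

Lemma tg_deltaM g k : dl g * dl k = sc (om g k) * dl (g * k)%g.
Proof.
apply/ffunP=> x; rewrite tg_delta_mull tg_scalar_mull !ffunE.
rewrite -(inj_eq (mulgI g)) mulKVg; case: eqP => [->|_]; last by rewrite rmorph0 mul0r mulr0.
by rewrite mulKg rmorph1 mul1r mulr1.
Qed.

Lemma tg_scalarM z w : sc z * sc w = sc (z * w).
Proof.
apply/ffunP=> x; rewrite tg_scalar_mull !ffunE; case: eqP => // _.
by rewrite mulr0.
Qed.

Lemma tg_scalarE z : sc z = alg (symalg D) (complex.Re z) +
  alg (symalg D) (complex.Im z) * sc ('i%C : C).
Proof.
apply/ffunP=> x; rewrite ffunE -[X in _ + X]/(sc _ * sc _) tg_scalarM !ffunE.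
by case: eqP => _; rewrite ?addr0 // {1}[z]complexE mulrC.
Qed.

Lemma tg_sumE (a : tgalg R gT) : (a : symalg D) = \sum_g sc (a g) * dl g.
Proof.
apply/ffunP=> x; rewrite sum_ffunE (bigD1 x) //= big1 ?addr0.
  by rewrite tg_scalar_mull ffunE eqxx mulr1.
by move=> g /negPf gx; rewrite tg_scalar_mull ffunE eq_sym gx mulr0.
Qed.

Lemma parity1 : parity D 1%g = false.
Proof. by have := parityM D 1%g 1%g; rewrite mulg1; case: (parity D 1%g). Qed.

Lemma parityV g : parity D g^-1%g = parity D g.
Proof. by have := parityM D g g^-1%g; rewrite mulgV parity1; do 2!case: (parity D _). Qed.

Lemma em_homog d (a : tgalg R gT) : tg_homog D d a -> homog d (em a).
Proof. by move=> da; exact: (@phomog_gen _ _ _ (dirac_gdeg (D := D) (q := q)) d (inl a) da). Qed.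

Lemma sc_homog z : homog false (em (sc z)).
Proof.
by apply: em_homog => g; rewrite ffunE; case: (g =P _) => [->|]; rewrite ?eqxx // parity1.
Qed.

Lemma dl_homog g : homog (parity D g) (em (dl g)).
Proof. by apply: em_homog => x; rewrite ffunE; case: (x =P _) => [->//|]; rewrite eqxx. Qed.

Lemma inv_homog g : homog (parity D g) (em (tg_inv D g)).
Proof.
by apply: em_homog => x; rewrite ffunE; case: (x =P _) => [->|]; rewrite ?eqxx // parityV.
Qed.

Lemma vgen_homog i : homog true (vgen i).
Proof. exact: (@phomog_gen _ _ _ (dirac_gdeg (D := D) (q := q)) true (inr i) erefl). Qed.

Lemma homog_sum d (I : Type) (r : seq I) (P : pred I) (F : I -> AV) :
  (forall i, P i -> homog d (F i)) -> homog d (\sum_(i <- r | P i) F i).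
Proof.
move=> FP; elim: r => [|i r IH]; rewrite ?big_nil ?big_cons; first exact: phomog0.
by case: ifP => // Pi; apply: phomogD => //; exact: FP.
Qed.

(** Allows commutation with [AV] to be tested on homogeneous elements, where the signs are
    defined. *)
Lemma dirac_decomp (a : AV) : exists a0 a1, [/\ homog false a0, homog true a1 & a = a0 + a1].
Proof.
elim/dirac_ind: a => [a|i|r|_ _ [a0 [a1 [h0 h1 ->]]] [b0 [b1 [k0 k1 ->]]]
                         |_ _ [a0 [a1 [h0 h1 ->]]] [b0 [b1 [k0 k1 ->]]]].
- exists (em [ffun g => if parity D g then 0 else a g]),
         (em [ffun g => if parity D g then a g else 0]); split.
  + by apply: em_homog => g; rewrite ffunE; case: (parity D g); rewrite ?eqxx.
  + by apply: em_homog => g; rewrite ffunE; case: (parity D g); rewrite ?eqxx.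
  + rewrite -(amorphD em_morphism); congr em; apply/ffunP=> g; rewrite !ffunE.
    by case: (parity D g); rewrite ?addr0 ?add0r.
- by exists 0, (vgen i); split; [exact: phomog0|exact: vgen_homog|rewrite add0r].
- by exists (alg AV r), 0; split; [exact: phomog_alg|exact: phomog0|rewrite addr0].
- by exists (a0 + b0), (a1 + b1); split; [exact: phomogD|exact: phomogD|rewrite addrACA].
- exists (a0 * b0 + a1 * b1), (a0 * b1 + a1 * b0); split.
  + by apply: phomogD; [exact: (phomogM h0 k0)|exact: (phomogM h1 k1)].
  + by apply: phomogD; [exact: (phomogM h0 k1)|exact: (phomogM h1 k0)].
  + by rewrite mulrDl !mulrDr -!addrA; congr (_ + _); rewrite addrA [RHS]addrC.
Qed.
End Dirac.

Section Star.
Variables (R : realType) (AV : superalgebra R) (p n : nat).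
Local Notation B := (stensor (Cl R p n) AV).

Definition aact (X : fdmod B) (a : AV) : 'M[R]_(fd_dim X) := fd_act X (st_inr (Cl R p n) a).
Definition cact (X : fdmod B) x : 'M[R]_(fd_dim X) := fd_act X (clg AV x).

Lemma aact_m X : @algebra_morphism R AV (mx_ralgebra R _) (aact X).
Proof. exact: morph_comp (st_inr_morphism _ _) (fd_morphism X). Qed.

Lemma aactM X a b : aact X (a * b) = aact X a *m aact X b.
Proof. exact: (amorphM (aact_m X)). Qed.
Lemma aactD X a b : aact X (a + b) = aact X a + aact X b.
Proof. exact: (amorphD (aact_m X)). Qed.
Lemma aactA X r : aact X (alg AV r) = r%:M.
Proof. exact: (amorphA (aact_m X)). Qed.
Lemma aact0 X : aact X 0 = 0.
Proof. exact: (amorph0 (aact_m X)). Qed.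

Lemma cact_sq X x : cact X x *m cact X x = (clsq R x)%:M.
Proof. by rewrite -actM clg_sq actA. Qed.

Lemma cact_anti X x y : x != y -> cact X x *m cact X y = - (cact X y *m cact X x).
Proof. by move=> xy; rewrite -!actM clg_anti // actN. Qed.

Lemma act_sign (X : fdmod B) k b : fd_act X ((-1) ^+ k * b) = (-1) ^+ k *: fd_act X b.
Proof. by rewrite -alg_sign actM actA mul_scalar_mx. Qed.

Lemma cact_swap X d a x : homog d a ->
  aact X a *m cact X x = (-1) ^+ d *: (cact X x *m aact X a).
Proof. by move=> ad; rewrite -!actM (clg_swap _ ad) act_sign. Qed.

(** Adjoints for the standard inner product stay in the algebra and keep degrees. The condition on
    degrees is what makes the transpose of a mass term a mass term. *)
Definition adapted (X : fdmod B) :=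
  (forall d a, homog d a -> exists2 a', homog d a' & (aact X a)^T = aact X a') /\
  (forall x, (cact X x)^T = clsq R x *: cact X x).
End Star.

Section DiracStar.
Variables (R : realType) (gT : finGroupType) (D : symmetry_data R gT).
Variables (q : nat) (rV : gT -> 'M[R]_q) (p n : nat).
Local Notation AV := (dirac_alg D rV).
Local Notation B := (stensor (Cl R p n) AV).
Local Notation sc z := (tg_scalar gT z : symalg D).
Local Notation dl g := (tg_delta R g : symalg D).
Variable X : fdmod B.
Local Notation rho a := (aact X (em rV a)).

Let rhoM a b : rho (a * b) = rho a *m rho b.
Proof. by rewrite (amorphM (em_morphism D rV)) aactM. Qed.
Let rhoD a b : rho (a + b) = rho a + rho b.
Proof. by rewrite (amorphD (em_morphism D rV)) aactD. Qed.
Let rhoA r : rho (alg (symalg D) r) = r%:M.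
Proof. by rewrite (amorphA (em_morphism D rV)) aactA. Qed.

Let J := rho (sc 'i%C).
Let L g := rho (dl g).
Let V i := aact X (vgen D rV i).
Let E x := cact X x.

Lemma JJ : J *m J = (-1)%:M.
Proof.
rewrite -rhoM tg_scalarM -rhoA; congr (aact X (em _ _)).
by congr (tg_scalar gT _); rewrite -expr2 sqr_i; apply/eqP; rewrite eq_complex /= oppr0 !eqxx.
Qed.

Lemma VV i : V i *m V i = 1%:M.
Proof. by rewrite -aactM vgen_sq -(rmorph1 (alg AV)) aactA. Qed.

Lemma VV_anti i j : i != j -> V i *m V j = (-1) ^+ true *: (V j *m V i).
Proof.
move=> ij; rewrite -!aactM vgen_anti // /= expr1 scaleN1r.
by rewrite (amorphN (aact_m X)).
Qed.

Lemma JV i : J *m V i = V i *m J.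
Proof. by rewrite -!aactM vgen_cplx. Qed.

Lemma scE z : rho (sc z) = (complex.Re z)%:M + complex.Im z *: J.
Proof. by rewrite tg_scalarE rhoD rhoM !rhoA mul_scalar_mx. Qed.

Lemma LJ g : exists c : bool, L g *m J = (-1) ^+ c *: (J *m L g).
Proof.
rewrite -rhoM tg_delta_scalar rhoM; exists (antiu D g).
rewrite scE; case: (antiu D g) => /=.
  by rewrite raddf0 add0r scaleN1r scalemxAl scaleN1r.
by rewrite raddf0 add0r scale1r expr0 scale1r.
Qed.

(** The conjugation relation multiplied by the action of g on the right. *)
Lemma LV g j : L g *m V j = (-1) ^+ parity D g *: ((\sum_k rV g k j *: V k) *m L g).
Proof.
have LVL : (-1) ^+ parity D g *: (L g *m V j *m rho (tg_inv D g)) = \sum_k rV g k j *: V k.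
  have := congr1 (aact X) (vgen_conj D rV g j).
  rewrite aactM aactA mul_scalar_mx !aactM (amorph_sum (aact_m X)) => ->.
  by apply: eq_bigr => k _; rewrite -[LHS]/(aact X (_ * _)) aactM aactA mul_scalar_mx.
rewrite -LVL -scalemxAl scalerA sign_sq scale1r -mulmxA -rhoM tg_Vmul.
by rewrite -(rmorph1 (alg (symalg D))) rhoA mulmx1.
Qed.

Lemma LL g k : L g *m L k = rho (sc (cocy D g k)) *m L (g * k)%g.
Proof. by rewrite -!rhoM tg_deltaM. Qed.

(** The average takes two rounds. The complex unit, the Clifford generators and the vectors commute
    up to sign, which gives a first form [G]; its pullbacks along the group elements sum to [G2].
    Group elements multiply up to unit complex numbers, and these are isometries of [G] because [J]
    is skew for it. *)
Lemma dirac_form : exists G, [/\ posd G,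
    forall d a, homog d a -> exists2 a', homog d a' & adj G (aact X a) (aact X a')
  & forall x, adj G (E x) (clsq R x *: E x)].
Proof.
pose ops := J :: [seq E x | x <- enum {: 'I_p + 'I_n}] ++ [seq V i | i <- enum 'I_q].
pose sg (x : 'I_p + 'I_n) : bool := if x is inl _ then true else false.
have clsq_sign x : clsq R x = (-1) ^+ sg x.
  by case: x.
have JE x : J *m E x = E x *m J.
  by rewrite /J /E (cact_swap _ _ (sc_homog D rV _)) expr0 scale1r.
have VE i x : V i *m E x = (-1) ^+ true *: (E x *m V i).
  by rewrite /E (cact_swap _ _ (vgen_homog D rV _)).
have [G [Gp GE]] : exists G, posd G /\ forall x, x \in ops -> x^T *m G *m x = G.
  apply: invariant_form => [x|x y]; rewrite !inE !mem_cat.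
    case/or3P=> [/eqP->|/mapP[i _ ->]|/mapP[i _ ->]].
    - by exists true; exact: JJ.
    - by exists (sg i); rewrite /E cact_sq clsq_sign.
    - by exists false; exact: VV.
  case/or3P=> [/eqP->|/mapP[i _ ->]|/mapP[i _ ->]];
    case/or3P=> [/eqP->|/mapP[j _ ->]|/mapP[j _ ->]].
  - by exists false; rewrite expr0 scale1r.
  - by exists false; rewrite expr0 scale1r JE.
  - by exists false; rewrite expr0 scale1r JV.
  - by exists false; rewrite expr0 scale1r JE.
  - have [->|ij] := eqVneq i j; first by exists false; rewrite expr0 scale1r.
    by exists true; rewrite /E cact_anti // scaleN1r.
  - by exists true; rewrite VE scalerA sign_sq scale1r.
  - by exists false; rewrite expr0 scale1r JV.
  - by exists true; rewrite VE.
  - have [->|ij] := eqVneq i j; first by exists false; rewrite expr0 scale1r.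
    by exists true; rewrite VV_anti.
have Lu g v : L g *m v = 0 -> v = 0 :> 'cV[R]_(fd_dim X).
  move=> Lv; have : rho (tg_inv D g) *m L g *m v = 0 by rewrite -mulmxA Lv mulmx0.
  by rewrite -rhoM tg_Vmul -(rmorph1 (alg (symalg D))) rhoA mul1mx.
pose G2 := \sum_g (L g)^T *m G *m L g.
have G2p : posd G2 by apply: (posd_sum 1%g) => g; apply: posd_congr => //; exact: Lu.
have JG : adj G J (- J).
  rewrite -scaleN1r; apply: adj_orth; [exact: JJ|by rewrite mulrNN mulr1|].
  by apply: GE; rewrite mem_head.
have EG x : adj G (E x) (clsq R x *: E x).
  apply: adj_orth; first exact: cact_sq.
    by rewrite clsq_sign sign_sq.
  by apply: GE; rewrite inE mem_cat map_f ?orbT // mem_enum.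
have VG i : adj G (V i) (V i).
  rewrite -[X in adj _ _ X]scale1r; apply: adj_orth; rewrite ?mulr1 ?VV //.
  by apply: GE; rewrite inE mem_cat map_f ?orbT // mem_enum.
have J2 : adj G2 J (- J).
  apply: adj_sumG => g; have [c LJc] := LJ g.
  apply: (@adj_conj _ _ _ _ _ _ ((-1) ^+ c *: J) ((-1) ^+ c *: - J)).
  - by rewrite LJc scalemxAl.
  - by rewrite mulmxN LJc scalerN mulNmx scalemxAl.
  - exact: adjZ.
have E2 x : adj G2 (E x) (clsq R x *: E x).
  apply: adj_sumG => g; have LE := cact_swap X x (dl_homog D rV g).
  apply: (@adj_conj _ _ _ _ _ _ ((-1) ^+ parity D g *: E x)
            ((-1) ^+ parity D g *: (clsq R x *: E x))).
  - by rewrite LE scalemxAl.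
  - by rewrite -scalemxAr LE -!scalemxAl !scalerA mulrC.
  - exact: adjZ.
(* Moving a group element past [V i] turns it into a linear combination of the [V k].
   Self-adjointness, unlike the isometry property, passes to linear combinations. *)
have V2 i : adj G2 (V i) (V i).
  apply: adj_sumG => g.
  apply: (@adj_conj _ _ _ _ _ _ ((-1) ^+ parity D g *: (\sum_k rV g k i *: V k))
            ((-1) ^+ parity D g *: (\sum_k rV g k i *: V k))).
  - by rewrite LV scalemxAl.
  - by rewrite LV scalemxAl.
  - by apply: adjZ; apply: adj_sum => k _; exact: adjZ.
have Zadj (F : 'M[R]_(fd_dim X)) z : adj F J (- J) -> adj F (rho (sc z)) (rho (sc (conjc z))).
  move=> FJ; rewrite !scE; apply: adjD.
    by case: z => a b /=; exact: adj_scalar.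
  by case: z => a b /=; rewrite scaleNr -scalerN; exact: adjZ.
(* The adjoint of a unit complex number is its conjugate, hence its inverse. *)
have ZG z : `|z| = 1 -> (rho (sc z))^T *m G *m rho (sc z) = G.
  move=> z1; rewrite (Zadj G z JG) -mulmxA -rhoM tg_scalarM mulrC -sqr_normc z1 expr1n.
  have -> : (sc (1 : R[i])) = 1 by [].
  by rewrite -(rmorph1 (alg (symalg D))) rhoA mulmx1.
(* [L g *m L k] is [L (g * k)] up to a phase that [G] does not see, so right translation by k
   permutes the summands of [G2]. *)
have LG2 k : (L k)^T *m G2 *m L k = G2.
  rewrite mulmx_sumr mulmx_suml [RHS](reindex_inj (mulIg k)) /=; apply: eq_bigr => g _.
  have -> : (L k)^T *m ((L g)^T *m G *m L g) *m L k = (L g *m L k)^T *m G *m (L g *m L k).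
    by rewrite trmx_mul !mulmxA.
  by rewrite LL trmx_mul -!mulmxA (mulmxA G) (mulmxA _ (G *m _)) mulmxA (mulmxA _ G) ZG ?cocy_norm // !mulmxA.
have L2 g : adj G2 (L g) (rho (tg_inv D g)).
  rewrite /adj -[X in _ = X *m _](LG2 g) -mulmxA -rhoM tg_mulV.
  by rewrite -(rmorph1 (alg (symalg D))) rhoA mulmx1.
(* The adjoint of a sum of terms z g is the sum of g^-1 times the conjugate of z. It has the same
   degree, as g and g^-1 have the same parity. *)
have em2 (a : symalg D) : exists2 a', (forall d, tg_homog D d a -> homog d a')
    & adj G2 (rho a) (aact X a').
  exists (\sum_g em rV (tg_inv D g) * em rV (sc (conjc (a g)))).
    move=> d da; apply: homog_sum => g _.
    have [ag0|ag] := eqVneq (a g) 0.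
      rewrite ag0 conjc0; have -> : sc (0 : R[i]) = 0 by apply/ffunP=> x; rewrite !ffunE; case: eqP.
      by rewrite (amorph0 (em_morphism D rV)) mulr0; exact: phomog0.
    rewrite -(da g ag) -[parity D g]addbF; apply: phomogM; last exact: sc_homog.
    exact: inv_homog.
  rewrite [X in em rV X](tg_sumE D a) (amorph_sum (em_morphism D rV)) !(amorph_sum (aact_m X)).
  apply: adj_sum => g _; rewrite rhoM aactM; apply: adjM; first exact: Zadj.
  exact: L2.
exists G2; split=> // d a.
elim=> {d a} [d [a|i] dx|r|d|d x y _ [x' hx Ex] _ [y' hy Ey]|d e x y _ [x' hx Ex] _ [y' hy Ey]].
- by have [a' ha Ea] := em2 a; exists a'; [exact: ha|].
- by exists (vgen D rV i); [rewrite dx; exact: vgen_homog|exact: V2].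
- by exists (alg AV r); [exact: phomog_alg|rewrite aactA; exact: adj_scalar].
- by exists 0; [exact: phomog0|rewrite aact0 /adj trmx0 mul0mx mulmx0].
- by exists (x' + y'); [exact: phomogD|rewrite !aactD; exact: adjD].
- by exists (y' * x'); [rewrite addbC; exact: phomogM|rewrite !aactM; exact: adjM].
Qed.

(** A change of basis by the square root of the invariant form makes the form standard and turns
    adjoints into transposes. *)
Lemma dirac_adapted : exists Y, fd_iso X Y /\ adapted Y.
Proof.
have [G [Gp GA GE]] := dirac_form; have [S [Sp SE]] := posd_sqrt Gp.
have Su := posd_unit Sp; have Ss : S^T = S := proj1 Sp.
have m : @algebra_morphism R B (mx_ralgebra R (fd_dim X)) (fun b => S *m fd_act X b *m invmx S).
  split=> [a b|a b|r].
  - by rewrite actD mulmxDr mulmxDl.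
  - by rewrite actM -[RHS]/(_ *m _) !mulmxA mulmxKV.
  - by rewrite actA mul_mx_scalar -scalemxAl mulmxV // scalemx1.
have tr x y : adj G x y -> (S *m x *m invmx S)^T = S *m y *m invmx S.
  rewrite /adj -SE => xy; rewrite !trmx_mul trmx_inv Ss.
  have -> : S *m y = invmx S *m (S *m S *m y) by rewrite !mulmxA mulVmx // mul1mx.
  by rewrite -xy !mulmxA mulmxK.
exists (FdMod m); split.
  exists S, (invmx S); split; rewrite ?mulmxV ?mulVmx // => b /=.
  by rewrite mulmxKV.
split=> [d a /GA[a' ha' aa']|x].
  by exists a' => //; exact: tr aa'.
by rewrite /cact /= (tr _ _ (GE x)) -scalemxAr -scalemxAl.
Qed.
End DiracStar.

Section AdaptedStar.
Variables (R : realType) (AV : superalgebra R) (p n : nat).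
Local Notation B := (stensor (Cl R p n) AV).
Hypothesis AV_decomp :
  forall a : AV, exists a0 a1, [/\ homog false a0, homog true a1 & a = a0 + a1].

Lemma adapted_star (X : fdmod B) : adapted X -> star_closed X.
Proof.
case=> hA hE b; elim/clif_ind: b => [x|a|r|x y [x' xE] [y' yE]|x y [x' xE] [y' yE]].
- by exists (alg B (clsq R x) * clg AV x); rewrite hE actM actA mul_scalar_mx.
- have [a0 [a1 [h0 h1 ->]]] := AV_decomp a.
  have [[a0' _ E0] [a1' _ E1]] := (hA _ _ h0, hA _ _ h1).
  exists (st_inr _ (a0' + a1')); rewrite -[RHS]/(aact X _) aactD -E0 -E1.
  by rewrite -[X in X^T]/(aact X _) aactD linearD.
- by exists (alg B r); rewrite actA tr_scalar_mx.
- by exists (x' + y'); rewrite !actD linearD /= xE yE.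
- by exists (y' * x'); rewrite !actM trmx_mul xE yE.
Qed.
End AdaptedStar.

(** * The algebraic classification *)

Section Restriction.
Variables (R : realType) (B B' : ralgebra R) (f : B -> B') (f_m : algebra_morphism f).
Hypothesis ss : forall X : fdmod B, exists Y, fd_iso X Y /\ star_closed Y.
Hypothesis ss' : forall X : fdmod B', exists Y, fd_iso X Y /\ star_closed Y.

Lemma res_iso (X Y : fdmod B') : fd_iso X Y -> fd_iso (fd_res f_m X) (fd_res f_m Y).
Proof. by case=> P [Q [PQ QP iP]]; exists P, Q; split=> // b; exact: iP. Qed.

Lemma res_add (X Y : fdmod B') :
  fd_iso (fd_res f_m (fd_add X Y)) (fd_add (fd_res f_m X) (fd_res f_m Y)).
Proof. by exists 1%:M, 1%:M; split=> [||b]; rewrite ?mul1mx ?mulmx1. Qed.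

Lemma modresB : {morph modres f_m : x y / x - y}.
Proof. by move=> x y; exact: lift_is_additive. Qed.

Lemma modres0 : modres f_m 0 = 0.
Proof. by rewrite -[X in modres _ X](subrr 0) modresB subrr. Qed.

Lemma modresD x y : modres f_m (x + y) = modres f_m x + modres f_m y.
Proof.
have N z : modres f_m (- z) = - modres f_m z by rewrite -sub0r modresB modres0 sub0r.
by rewrite -[in LHS](opprK y) modresB N opprK.
Qed.

(** [modres] restricts a chosen representative of each class and extends linearly; additivity of
    restriction makes the formula hold for every module. *)
Lemma modres_modclass (Z : fdmod B') : modres f_m (modclass Z) = modclass (fd_res f_m Z).
Proof.
have [s dZ] := decomp_ex ss' Z; rewrite (modclassE dZ).
elim: s Z dZ => [|S s IH] Z /=.
  move=> Z0; rewrite /irrsum big_nil modres0.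
  have d0 : decomp [::] (fd_res f_m Z) by [].
  by rewrite (modclassE d0) /irrsum big_nil.
case=> Z' [dZ' ZE]; rewrite /irrsum big_cons modresD -/(irrsum s) (IH _ dZ').
have iZ := fd_iso_trans (res_iso ZE) (res_add _ _).
rewrite (modclass_iso ss iZ) (modclassD ss); congr (_ + _).
rewrite /modres liftU scale1r; apply: (modclass_iso ss); apply: res_iso.
by apply/pi_irr; rewrite reprK.
Qed.

Lemma cokerclsB x y : cokercls f_m (x - y) = cokercls f_m x - cokercls f_m y.
Proof. by rewrite /cokercls raddfB. Qed.

Lemma cokerclsD x y : cokercls f_m (x + y) = cokercls f_m x + cokercls f_m y.
Proof. by rewrite /cokercls raddfD. Qed.

Lemma cokercls_eq0 x : cokercls f_m x = 0 <-> exists y, modres f_m y = x.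
Proof.
split=> [|[y yx]].
  rewrite -(subrr (cokercls f_m 0)) -cokerclsB subrr => /eqP.
  by rewrite -Quotient.idealrBE subr0 => /asboolP.
rewrite -(subrr (cokercls f_m 0)) -cokerclsB subrr; apply/eqP.
by rewrite -Quotient.idealrBE subr0; apply/asboolP; exists y.
Qed.

Lemma coker_res (Z : fdmod B') : cokercls f_m (modclass (fd_res f_m Z)) = 0.
Proof. by apply/cokercls_eq0; exists (modclass Z); exact: modres_modclass. Qed.

(** The difference of the classes lies in the image of restriction. Written as a difference of two
    modules it is distributed over both sides, and the equality of classes becomes an
    isomorphism. *)
Lemma coker_eq (X Y : fdmod B) :
    cokercls f_m (modclass X) = cokercls f_m (modclass Y) ->
  exists Z Z', fd_iso (fd_add X (fd_res f_m Z)) (fd_add Y (fd_res f_m Z')).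
Proof.
move=> XY; have /cokercls_eq0[y yE] : cokercls f_m (modclass X - modclass Y) = 0.
  by rewrite cokerclsB XY subrr.
have [Z' [Z yZ]] := modgrp_modclass y; exists Z, Z'; apply: (modclass_inj ss).
rewrite !(modclassD ss) -!modres_modclass.
move: yE; rewrite yZ modresB => /eqP; rewrite subr_eq addrAC eq_sym subr_eq => /eqP ->.
by rewrite addrC.
Qed.
End Restriction.

(** * Mass terms on a module and extensions to two Clifford generators *)

Section Masses.
Variables (R : realType) (AV : superalgebra R).
Local Notation B := (stensor (Cl R 0 1) AV).
Local Notation B2 := (stensor (Cl R 0 2) AV).
Hypothesis AV_decomp :
  forall a : AV, exists a0 a1, [/\ homog false a0, homog true a1 & a = a0 + a1].
Implicit Types X Y : fdmod B.

Definition mact X : 'M[R]_(fd_dim X) := fd_act X (mass_gen AV).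

Lemma mactE X : mact X = cact X (inr ord0). Proof. by []. Qed.

Lemma mact_sq X : mact X *m mact X = 1%:M.
Proof. by rewrite mactE cact_sq. Qed.

Lemma intertw_gen X Y (P : 'M[R]_(fd_dim Y, fd_dim X)) :
    (forall d a, homog d a -> P *m aact X a = aact Y a *m P) ->
    P *m mact X = mact Y *m P ->
  intertw P.
Proof.
move=> Pa Pm; elim/clif_ind => [[[]//|j]|a|r|x y Px Py|x y Px Py].
- by rewrite (ord1 j); exact: Pm.
- have [a0 [a1 [h0 h1 ->]]] := AV_decomp a.
  rewrite -/(aact X _) -/(aact Y _) !aactD mulmxDr mulmxDl.
  by rewrite (Pa _ _ h0) (Pa _ _ h1).
- by rewrite !actA mul_mx_scalar mul_scalar_mx.
- by rewrite !actD mulmxDr mulmxDl Px Py.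
- by rewrite !actM mulmxA Px -mulmxA Py mulmxA.
Qed.

(** The matrices that may replace [mact X] as the action of the mass generator; that these
    conditions suffice is [fdmass_twist]. *)
Definition fdmass X (M : 'M[R]_(fd_dim X)) :=
  M *m M = 1%:M /\
  forall d a, homog d a -> aact X a *m M = (-1) ^+ d *: (M *m aact X a).

Definition acomm X (P : 'M[R]_(fd_dim X)) :=
  forall d a, homog d a -> P *m aact X a = aact X a *m P.

Lemma fdmass_mact X : fdmass (mact X).
Proof. by split=> [|d a ad]; [exact: mact_sq|rewrite mactE; exact: cact_swap]. Qed.

Lemma fdmassM X M N : @fdmass X M -> @fdmass X N -> acomm (M *m N).
Proof.
move=> [_ Ma] [_ Na] d a ad; apply: esym; rewrite mulmxA (Ma _ _ ad) -scalemxAl -mulmxA (Na _ _ ad).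
by rewrite -scalemxAr scalerA sign_sq scale1r mulmxA.
Qed.

Lemma acomm_intertw X P : acomm P -> P *m mact X = mact X *m P -> @intertw R B X X P.
Proof. exact: intertw_gen. Qed.

Lemma intertw_acomm X P : @intertw R B X X P -> acomm P.
Proof. by move=> iP d a _; exact: iP. Qed.

Lemma fdmass_conj X M (k k' : 'M[R]_(fd_dim X)) : fdmass M -> acomm k -> acomm k' ->
  k' *m k = 1%:M -> k *m k' = 1%:M -> @fdmass X (k *m M *m k').
Proof.
move=> [MM Ma] kc kc' kk' k'k; split=> [|d a ad].
  by rewrite !mulmxA -(mulmxA _ k' k) kk' mulmx1 -(mulmxA k) MM mulmx1.
rewrite !mulmxA -(kc _ _ ad) -(mulmxA k) (Ma _ _ ad) -scalemxAr -scalemxAl.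
by rewrite -!mulmxA (kc' _ _ ad).
Qed.

Lemma mx_sign n k (x : 'M[R]_n) :
  (-1) ^+ k * (x : mx_ralgebra R n) = (-1) ^+ k *: x.
Proof. by rewrite -[LHS]alg_sign; exact: mul_scalar_mx. Qed.

Lemma fdmass_twist X M : @fdmass X M -> exists F : B -> 'M[R]_(fd_dim X),
  [/\ @algebra_morphism R B (mx_ralgebra R _) F, F (mass_gen AV) = M
    & forall a, F (st_inr _ a) = aact X a].
Proof.
move=> [MM Ma]; pose g (x : 'I_0 + 'I_1) : mx_ralgebra R (fd_dim X) := M.
have [| |d a x ad|F [Fm FE Fa]] := @clif_lift_ex _ 0 1 AV (mx_ralgebra R (fd_dim X)) (aact X) g (aact_m X).
- by move=> [[]//|j].
- by move=> [[]//|j] [[]//|j'] /eqP[]; rewrite (ord1 j) (ord1 j').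
- by apply: etrans (Ma _ _ ad) (esym (mx_sign _ _)).
- by exists F; split=> //; exact: FE.
Qed.

(** [J] stands for the product of the second Clifford generator with the mass generator; as a
    product of two odd elements it commutes with [AV] without signs. *)
Definition clext X (J : 'M[R]_(fd_dim X)) :=
  [/\ acomm J, J *m mact X = - (mact X *m J) & J *m J = (-1)%:M].

Local Notation res := (fd_res (st12_morphism AV)).

Lemma st12_mass : st12 (mass_gen AV) = clg AV (inr ord0 : ('I_0 + 'I_2)%type).
Proof.
rewrite /st12 /st_map /mass_gen /st_inl.
rewrite (plift_gen (st_map_rel (@cl_incl_morphism R 0 1 2 isT) (@cl_incl_homog R 0 1 2 isT))) /=.
rewrite /cl12 /cl_incl /cl_gen (plift_gen (@cl_incl_rel R 0 1 2 isT)) /=.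
by congr (clg AV (inr _)); exact: val_inj.
Qed.

Lemma st12_inr (a : AV) : st12 (st_inr (Cl R 0 1) a) = st_inr (Cl R 0 2) a.
Proof.
rewrite /st12 /st_map /st_inr.
by rewrite (plift_gen (st_map_rel (@cl_incl_morphism R 0 1 2 isT) (@cl_incl_homog R 0 1 2 isT))).
Qed.

Lemma clext_res (Z : fdmod B2) : exists J, @clext (res Z) J.
Proof.
pose e2 := cact Z (inr ord_max); pose m := cact Z (inr ord0).
have mE : mact (res Z) = m by rewrite /mact /= st12_mass.
have aE a : aact (res Z) a = aact Z a by rewrite /aact /= st12_inr.
have em : e2 *m m = - (m *m e2) by exact: cact_anti.
have ee : e2 *m e2 = 1%:M by rewrite cact_sq.
have mm : m *m m = 1%:M by rewrite cact_sq.
exists (e2 *m m); split.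
- move=> d a ad; apply: esym; rewrite aE.
  have E1 := cact_swap Z (inr ord0) ad; have E2 := cact_swap Z (inr ord_max) ad.
  by rewrite mulmxA E2 -scalemxAl -mulmxA E1 -scalemxAr scalerA sign_sq scale1r !mulmxA.
- by rewrite mE {1}em mulNmx mulmxA.
- rewrite {2}em mulmxN mulmxA -(mulmxA e2 m m) mm mulmx1 ee.
  by apply/matrixP=> i j; rewrite !mxE mulNrn.
Qed.

Lemma clext_iso X J : @clext X J -> exists Z : fdmod B2, fd_iso (res Z) X.
Proof.
move=> [Jc Jm JJ]; set m := mact X in Jm.
(* The mass generator squares to 1, so the second generator is recovered as [J *m m]. *)
pose g (x : 'I_0 + 'I_2) : mx_ralgebra R (fd_dim X) :=
  if x is inr j then (if j == ord0 then m else J *m m) else 0.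
have mm : m *m m = 1%:M := mact_sq X.
have [_ Ma] := fdmass_mact X.
have mJ : m *m J = - (J *m m) by rewrite Jm opprK.
have JmJm : J *m m *m (J *m m) = 1%:M.
  by rewrite mulmxA -(mulmxA J) mJ mulmxN mulNmx mulmxA JJ mul_scalar_mx scaleN1r mulNmx opprK mm.
have [|x y xy|d a x ad|F [Fm FE Fa]] := @clif_lift_ex _ 0 2 AV (mx_ralgebra R (fd_dim X)) (aact X) g (aact_m X).
- by move=> [[]//|j]; rewrite /g; case: ifP.
- case: x y xy => [[]//|j] [[]//|j'] xy; rewrite /g.
  case: ifP => [/eqP j0|j0]; case: ifP => [/eqP j'0|j'0].
  + by rewrite j0 j'0 eqxx in xy.
  + rewrite -[LHS]/(m *m (J *m m)) -[RHS]/(- (J *m m *m m)).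
    by rewrite mulmxA mJ mulNmx -mulmxA.
  + rewrite -[LHS]/(J *m m *m m) -[RHS]/(- (m *m (J *m m))).
    by rewrite mulmxA mJ mulNmx opprK.
  + case/eqP: xy; congr inr; apply: val_inj; move: j0 j'0.
    by case: j j' => [[|[|]]//= ?] [[|[|]]//= ?].
- case: x => [[]//|j]; apply: etrans (esym (mx_sign _ _)); rewrite /g.
  case: ifP => _; first exact: Ma.
  rewrite -[LHS]/(aact X a *m (J *m m)) -[X in _ *: X]/(J *m m *m aact X a).
  by rewrite mulmxA -(Jc _ _ ad) -mulmxA (Ma _ _ ad) -scalemxAr mulmxA.
- exists (FdMod Fm); exists 1%:M, 1%:M; rewrite ?mul1mx ?mulmx1; split=> //.
  apply: intertw_gen => [d a ad|]; rewrite mul1mx mulmx1.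
    by rewrite /aact /= st12_inr Fa.
  by rewrite /mact /= st12_mass FE.
Qed.

Hypothesis ad1 : forall X, exists Y, fd_iso X Y /\ adapted Y.
Hypothesis ad2 : forall X : fdmod B2, exists Y : fdmod B2, fd_iso X Y /\ adapted Y.

Lemma ss1 X : exists Y, fd_iso X Y /\ star_closed Y.
Proof. by have [Y [XY aY]] := ad1 X; exists Y; split=> //; exact: adapted_star. Qed.
Lemma ss2 (X : fdmod B2) : exists Y : fdmod B2, fd_iso X Y /\ star_closed Y.
Proof. by have [Y [XY aY]] := ad2 X; exists Y; split=> //; exact: adapted_star. Qed.

Lemma algcls_iso X Y : fd_iso X Y -> algcls X = algcls Y.
Proof. by move=> XY; rewrite /algcls (modclass_iso ss1 XY). Qed.

Lemma algclsD X Y : algcls (fd_add X Y) = algcls X + algcls Y.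
Proof. by rewrite /algcls (modclassD ss1) cokerclsD. Qed.

Lemma algcls_clext X J : @clext X J -> algcls X = 0.
Proof.
move=> /clext_iso[Z ZX]; rewrite -(algcls_iso ZX).
exact: (coker_res (st12_morphism AV) ss1 ss2).
Qed.

Lemma algcls_eq X Y : algcls X = algcls Y -> exists X' Y' J J',
  [/\ @clext X' J, @clext Y' J' & fd_iso (fd_add X X') (fd_add Y Y')].
Proof.
move=> /(coker_eq ss1 ss2)[Z [Z' XY]].
have [[J JZ] [J' JZ']] := (clext_res Z, clext_res Z').
by exists (res Z), (res Z'), J, J'.
Qed.

(** The inverse is the same module with the opposite mass generator: on the sum of the two, the
    quarter turn exchanging the copies commutes with [AV] and anticommutes with the mass, so the sum
    has class 0. *)
Lemma algcls_opp X : exists Y, algcls Y = - algcls X.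
Proof.
have [_ Ma] := fdmass_mact X.
have mN : fdmass (- mact X).
  split=> [|d a ad]; first by rewrite mulmxN mulNmx opprK mact_sq.
  by rewrite mulmxN mulNmx (Ma _ _ ad) scalerN.
have [F [Fm Fg Fa]] := fdmass_twist mN; exists (FdMod Fm).
set Y := FdMod Fm; apply/eqP; rewrite -addr_eq0 addrC -algclsD; apply/eqP.
have mY : mact Y = - mact X by [].
have aY a : aact Y a = aact X a by exact: Fa.
have aE a : aact (fd_add X Y) a = block_mx (aact X a) 0 0 (aact X a).
  exact: (congr1 (fun Q : 'M[R]_(fd_dim X) => block_mx (aact X a) 0 0 Q) (aY a)).
pose N := fd_dim X; pose mN2 := @mulmx R (N + N) (N + N) (N + N).
apply: (@algcls_clext (fd_add X Y) (block_mx 0 (- 1%:M) 1%:M 0 : 'M[R]_(N + N))); split.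
- move=> d a ad; rewrite aE.
  rewrite -[LHS]/(mN2 _ _).
  rewrite -[RHS]/(mN2 _ _).
  rewrite /mN2 !mulmx_block !(mul0mx, mulmx0, mulNmx, mulmxN).
  by rewrite !(mul0mx, mulmx0, mul1mx, mulmx1, addr0, add0r).
- have mE : mact (fd_add X Y) = block_mx (mact X) 0 0 (- mact X).
    exact: (congr1 (fun Q : 'M[R]_(fd_dim X) => block_mx (mact X) 0 0 Q) mY).
  rewrite mE.
  rewrite -[LHS]/(mN2 _ _).
  rewrite -[RHS]/(- (mN2 _ _)).
  rewrite /mN2 !mulmx_block opp_block_mx !(mul0mx, mulmx0, mul1mx, mulmx1, mulNmx, mulmxN).
  by rewrite !(mul0mx, mulmx0, mul1mx, mulmx1, oppr0, opprK, addr0, add0r).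
- rewrite -[LHS]/(mN2 _ _).
  rewrite /mN2 mulmx_block !(mul0mx, mulmx0, mul1mx, mulmx1, addr0, add0r).
  by rewrite -[RHS]/((-1)%:M : 'M[R]_(N + N)) scalar_mx_block; congr block_mx;
    apply/matrixP=> i j; rewrite !mxE mulNrn.
Qed.

Lemma algcls_surj (x : algclass AV) : exists X, algcls X = x.
Proof.
have -> : x = cokercls (st12_morphism AV) (repr x) by rewrite /cokercls reprK.
have [X [Y ->]] := modgrp_modclass (repr x).
have [Z ZY] := algcls_opp Y; exists (fd_add X Z).
by rewrite algclsD ZY cokerclsB.
Qed.
End Masses.

(** * Paths of mass terms on a module *)

Section Paths.
Variables (R : realType) (AV : superalgebra R).
Local Notation B := (stensor (Cl R 0 1) AV).
Implicit Types X Y : fdmod B.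

(** Paths are defined on the whole line, so that continuity needs no subspace topology; [clamp]
    extends a path from the unit interval. *)
Definition fdjoin X (M M' : 'M[R]_(fd_dim X)) := exists p : R -> 'M[R]_(fd_dim X),
  [/\ continuous p, forall t, fdmass (p t), p 0 = M & p 1 = M'].

Definition clamp (t : R) : R := Num.max 0 (Num.min 1 t).

Lemma clamp_continuous : continuous clamp.
Proof.
move=> t; apply: (@continuous_max R R (fun=> 0) (fun t => Num.min 1 t)).
  exact: cst_continuous.
apply: (@continuous_min R R (fun=> 1) id); [exact: cst_continuous|exact: cvg_id].
Qed.

Lemma clamp_itv t : 0 <= clamp t <= 1.
Proof. by rewrite /clamp le_max lexx /= ge_max ler01 ge_min lexx. Qed.

Lemma clamp_id t : 0 <= t <= 1 -> clamp t = t.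
Proof. by case/andP=> t0 t1; rewrite /clamp (min_r t1) (max_r t0). Qed.

Lemma acomm1 X : acomm (1%:M : 'M[R]_(fd_dim X)).
Proof. by move=> d a _; rewrite mul1mx mulmx1. Qed.
Lemma acommD X (P Q : 'M[R]_(fd_dim X)) : acomm P -> acomm Q -> acomm (P + Q).
Proof. by move=> hP hQ d a ad; rewrite mulmxDl mulmxDr (hP _ _ ad) (hQ _ _ ad). Qed.
Lemma acommN X (P : 'M[R]_(fd_dim X)) : acomm P -> acomm (- P).
Proof. by move=> hP d a ad; rewrite mulNmx mulmxN (hP _ _ ad). Qed.
Lemma acommZ X r (P : 'M[R]_(fd_dim X)) : acomm P -> acomm (r *: P).
Proof. by move=> hP d a ad; rewrite -scalemxAl -scalemxAr (hP _ _ ad). Qed.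
Lemma acommM X (P Q : 'M[R]_(fd_dim X)) : acomm P -> acomm Q -> acomm (P *m Q).
Proof. by move=> hP hQ d a ad; rewrite -mulmxA (hQ _ _ ad) mulmxA (hP _ _ ad) mulmxA. Qed.

Lemma commV n (P Q : 'M[R]_n) : P \in unitmx -> P *m Q = Q *m P -> invmx P *m Q = Q *m invmx P.
Proof. by move=> Pu PQ; rewrite -[RHS](mulKmx Pu) (mulmxA P) PQ mulmxK. Qed.

Lemma acommV X (P : 'M[R]_(fd_dim X)) : P \in unitmx -> acomm P -> acomm (invmx P).
Proof. by move=> Pu hP d a ad; exact: commV Pu (hP _ _ ad). Qed.

(** Mass terms are not closed under convex combinations; the segment is taken among the invertible
    matrices that commute with [AV], which act on mass terms by conjugation. *)
Lemma straight_join X (M k : 'M[R]_(fd_dim X)) : fdmass M -> acomm k ->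
    (forall t, 0 <= t <= 1 -> (1 - t)%:M + t *: k \in unitmx) ->
  fdjoin M (k *m M *m invmx k).
Proof.
move=> hM hk ku; pose K t := (1 - clamp t)%:M + clamp t *: k.
have Ku t : K t \in unitmx by apply: ku; exact: clamp_itv.
have Kc : continuous K.
  move=> t; apply: mx_cvgD; last by apply: mx_cvgZ; [exact: clamp_continuous|exact: mx_cvg_cst].
  under eq_fun do rewrite -scalemx1; rewrite -scalemx1.
  apply: mx_cvgZ; last exact: mx_cvg_cst.
  by apply: cvgB; [exact: cvg_cst|exact: clamp_continuous].
exists (fun t => K t *m M *m invmx (K t)); split.
- move=> t; apply: mx_cvgM; last by apply: mx_cvgV => //; exact: Kc.
  by apply: mx_cvgM; [exact: Kc|exact: mx_cvg_cst].
- move=> t; have Kh : acomm (K t).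
    apply: acommD; last exact: acommZ.
    by rewrite -scalemx1; apply/acommZ/acomm1.
  by apply: fdmass_conj => //; [exact: acommV|rewrite mulVmx|rewrite mulmxV].
- by rewrite /K clamp_id ?lexx ?ler01 // subr0 scale0r addr0 invmx1 mul1mx mulmx1.
- by rewrite /K clamp_id ?lexx ?ler01 // subrr scale1r raddf0 add0r.
Qed.

(** [K] is a complex structure on the image of [E], so the conjugating matrix is multiplication by i
    there and the identity on the kernel of [E]. *)
Lemma rotation_join X (M E K : 'M[R]_(fd_dim X)) : fdmass M -> acomm E -> acomm K ->
    E *m E = E -> E *m K = K -> K *m E = K -> K *m K = - E ->
  fdjoin M ((1%:M - E + K) *m M *m (1%:M - E - K)).
Proof.
move=> hM hE hK EE EK KE KK.
(* On the image of [E] this inverts the complex number x + iy; the segment from 1 to i does not pass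
   through 0. *)
have inv x y : x ^+ 2 + y ^+ 2 != 0 ->
    (1%:M - E + (x *: E + y *: K)) *m
    (1%:M - E + (x ^+ 2 + y ^+ 2)^-1 *: (x *: E - y *: K)) = 1%:M.
  move=> d0.
  have E2 : (1%:M - E) *m (1%:M - E) = 1%:M - E.
    by rewrite mulmxBr mulmx1 mulmxBl mul1mx EE subrr subr0.
  have E0 : (1%:M - E) *m (x *: E - y *: K) = 0.
    rewrite mulmxBl mul1mx mulmxBr -!scalemxAr EE EK subrr //.
  have E1 : (x *: E + y *: K) *m (1%:M - E) = 0.
    by rewrite mulmxBr mulmx1 mulmxDl -!scalemxAl EE KE subrr.
  have E3 : (x *: E + y *: K) *m (x *: E - y *: K) = (x ^+ 2 + y ^+ 2) *: E.
    rewrite mulmxDl !mulmxBr -!scalemxAl -!scalemxAr EE EK KE KK !scalerA (mulrC y x).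
    by rewrite scalerN opprK subrKA scalerDl !expr2.
  move: (1%:M - E) E2 E0 E1 (subrK E 1%:M) => F E2.
  move: (x *: E + y *: K) (x *: E - y *: K) E3 => P Q E3 E0 E1 FE.
  rewrite mulmxDl !mulmxDr E2 E1 -!scalemxAr E0 scaler0 addr0 add0r E3.
  by rewrite scalerA mulVf // scale1r FE.
have kI := inv 0 1; rewrite expr0n expr1n add0r invr1 !scale1r scale0r !add0r in kI.
have kI1 : (1%:M - E + K) *m (1%:M - E - K) = 1%:M by apply: kI; exact: oner_neq0.
have [ku _] := mulmx1_unit kI1.
have -> : 1%:M - E - K = invmx (1%:M - E + K).
  by rewrite -[LHS](mulKmx ku) kI1 mulmx1.
apply: straight_join => // [|t _].
  by apply: acommD => //; apply: acommD; [exact: acomm1|exact: acommN].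
have d0 : (1 - t) ^+ 2 + t ^+ 2 != 0.
  by apply: lt0r_neq0; nra.
have -> : (1 - t)%:M + t *: (1%:M - E + K) = 1%:M - E + ((1 - t) *: E + t *: K).
  by apply/matrixP=> i j; rewrite !mxE; case: (i == j); rewrite ?mulr1n ?mulr0n; ring.
by have [] := mulmx1_unit (inv _ _ d0).
Qed.
End Paths.

(** * The spectral splitting of a mass term *)

Section Bicommutant.
Variables (R : realType) (n : nat) (s : 'M[R]_n).
Implicit Types P Q T : 'M[R]_n.

(** Stands for the functions of [s]: closed under sums, products, inverses and positive roots, they
    commute with each other and with everything that commutes with [s]. *)
Definition bicom P := forall Q, Q *m s = s *m Q -> Q *m P = P *m Q.

Lemma bicom_id : bicom s. Proof. by []. Qed.
Lemma bicom_scalar r : bicom r%:M. Proof. by move=> Q _; rewrite scalar_mxC. Qed.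
Lemma bicomD P Q : bicom P -> bicom Q -> bicom (P + Q).
Proof. by move=> hP hQ T hT; rewrite mulmxDl mulmxDr hP ?hQ. Qed.
Lemma bicomN P : bicom P -> bicom (- P).
Proof. by move=> hP T hT; rewrite mulNmx mulmxN hP. Qed.
Lemma bicomZ r P : bicom P -> bicom (r *: P).
Proof. by move=> hP T hT; rewrite -scalemxAl -scalemxAr hP. Qed.
Lemma bicomM P Q : bicom P -> bicom Q -> bicom (P *m Q).
Proof. by move=> hP hQ T hT; rewrite mulmxA hP // -mulmxA hQ // mulmxA. Qed.
Lemma bicomV P : P \in unitmx -> bicom P -> bicom (invmx P).
Proof. by move=> Pu hP T hT; apply/esym/commV => //; rewrite hP. Qed.
Lemma bicom_sqrt T : posd T -> bicom (T *m T) -> bicom T.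
Proof. by move=> Tp hT Q hQ; apply: sqrt_intertwine => //; exact: hT. Qed.
Lemma bicomC P Q : bicom P -> bicom Q -> P *m Q = Q *m P.
Proof. by move=> hP hQ; apply: hQ; apply/esym/hP. Qed.
End Bicommutant.

Lemma sqrt_unique (R : realType) n (T T' : 'M[R]_n) :
  posd T -> posd T' -> T *m T = T' *m T' -> T = T'.
Proof.
move=> Tp T'p E; have := @sqrt_intertwine _ _ _ T' T 1%:M T'p Tp.
by rewrite !mul1mx !mulmx1 E; exact.
Qed.

Definition sqrtm (R : realType) n (A : 'M[R]_n) : 'M[R]_n :=
  xget 0 [set T : 'M[R]_n | posd T /\ T *m T = A].

Lemma sqrtmP (R : realType) n (A : 'M[R]_n) : posd A ->
  posd (sqrtm A) /\ sqrtm A *m sqrtm A = A.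
Proof.
move=> /posd_sqrt[T hT]; rewrite /sqrtm.
by case: xgetP => [T' _ //|/(_ T)]; case.
Qed.

Lemma posdV (R : realType) n (A : 'M[R]_n) : posd A -> posd (invmx A).
Proof.
move=> Ap; have Au := posd_unit Ap.
have -> : invmx A = (invmx A)^T *m A *m invmx A.
  by rewrite trmx_inv (proj1 Ap) mulVmx // mul1mx.
apply: posd_congr => // v Av.
by rewrite -[v]mul1mx -(mulmxV Au) -mulmxA Av mulmx0.
Qed.

Lemma posd_scalar (R : realType) n r : 0 < r -> posd (r%:M : 'M[R]_n).
Proof.
move=> r0; split=> [|v v0]; first by rewrite tr_scalar_mx.
by rewrite mul_mx_scalar -scalemxAl mxE mulr_gt0 // dot_self_gt0.
Qed.

Lemma posdDp (R : realType) n (A A' : 'M[R]_n) : posd A -> posd A' -> posd (A + A').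
Proof. by move=> Ap A'p; apply: posdD => //; [case: A'p|move=> v; exact: posd_ge0]. Qed.

Section Splits.
Variables (R : realType) (B : ralgebra R).
Implicit Types X Y Z : fdmod B.

Definition splits X (e : 'M[R]_(fd_dim X)) Y (u : 'M[R]_(fd_dim X, fd_dim Y)) v :=
  [/\ intertw u, @intertw R B X Y v, v *m u = 1%:M & u *m v = e].

Lemma splits_iso X X' (e : 'M[R]_(fd_dim X)) (e' : 'M[R]_(fd_dim X'))
    (k : 'M[R]_(fd_dim X', fd_dim X)) k' Y u v Y' u' v' :
  intertw k -> @intertw R B X' X k' -> k' *m k = 1%:M -> k *m k' = 1%:M ->
  k *m e = e' *m k ->
  @splits X e Y u v -> @splits X' e' Y' u' v' -> fd_iso Y Y'.
Proof.
move=> ik ik' k'k kk' ke [iu iv vu uv] [iu' iv' vu' uv'].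
have k'e : k' *m e' = e *m k'.
  by rewrite -[RHS]mul1mx -k'k -!mulmxA (mulmxA k) ke -!mulmxA kk' mulmx1.
apply/fd_isoP; exists (v' *m k *m u), (v *m k' *m u'); split.
- by do ?apply: intertwM.
- by do ?apply: intertwM.
- rewrite !mulmxA -(mulmxA _ u v) uv -(mulmxA v') ke -(mulmxA v') -(mulmxA e') kk'.
  by rewrite mulmx1 -uv' mulmxA vu' mul1mx vu'.
- rewrite !mulmxA -(mulmxA _ u' v') uv' -(mulmxA v) k'e -(mulmxA v) -(mulmxA e) k'k.
  by rewrite mulmx1 -uv mulmxA vu mul1mx vu.
Qed.

Lemma splits_add X (e g : 'M[R]_(fd_dim X)) Y u v Z w z Y' u' v' :
  e *m g = 0 -> g *m e = 0 -> @splits X e Y u v -> @splits X g Z w z ->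
  @splits X (e + g) Y' u' v' -> fd_iso Y' (fd_add Y Z).
Proof.
move=> eg ge [iu iv vu uv] [iw iz zw wz] [iu' iv' vu' uv'].
have eu : e *m u = u by rewrite -uv -mulmxA vu mulmx1.
have gw : g *m w = w by rewrite -wz -mulmxA zw mulmx1.
have ve : v *m e = v by rewrite -uv mulmxA vu mul1mx.
have zg : z *m g = z by rewrite -wz mulmxA zw mul1mx.
have gu : g *m u = 0 by rewrite -eu mulmxA ge mul0mx.
have ew : e *m w = 0 by rewrite -gw mulmxA eg mul0mx.
have vw : v *m w = 0 by rewrite -ve -mulmxA ew mulmx0.
have zu : z *m u = 0 by rewrite -zg -mulmxA gu mulmx0.
have E1 : u' *m (v' *m u) = u by rewrite mulmxA uv' mulmxDl eu gu addr0.
have E2 : u' *m (v' *m w) = w by rewrite mulmxA uv' mulmxDl ew gw add0r.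
apply: (@biprod_iso _ _ _ _ _ (v' *m u) (v *m u') (v' *m w) (z *m u')).
split; split; try exact: intertwM.
- by rewrite -mulmxA E1.
- by rewrite -mulmxA E2.
- by rewrite -mulmxA E2.
- by rewrite -mulmxA E1.
- rewrite !mulmxA -!(mulmxA v') uv wz -mulmxDr -mulmxDl -uv' -mulmxA vu' mulmx1.
  exact: vu'.
Qed.
End Splits.

Section Spectral.
Variables (R : realType) (AV : superalgebra R).
Local Notation B := (stensor (Cl R 0 1) AV).
Hypothesis AV_decomp :
  forall a : AV, exists a0 a1, [/\ homog false a0, homog true a1 & a = a0 + a1].
Variables (X : fdmod B) (Xa : adapted X).
Local Notation n := (fd_dim X).
Local Notation m := (mact X).
Local Notation acomm := (@acomm R AV X).
Local Notation fdmass := (@fdmass R AV X).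
Implicit Types M S Q sg : 'M[R]_n.

(** For an involution, the projection onto its eigenspace for -1, on which [m *m sg] agrees with
    [- m]. *)
Definition negproj sg : 'M[R]_n := 2^-1 *: (1%:M - sg).

Lemma negproj_idem sg : sg *m sg = 1%:M -> negproj sg *m negproj sg = negproj sg.
Proof.
move=> ss; rewrite /negproj -scalemxAl -scalemxAr mulmxBr mulmx1 mulmxBl mul1mx ss.
by apply/matrixP=> i j; rewrite !mxE; field.
Qed.

Lemma negproj_intertw sg : @intertw R B X X sg -> @intertw R B X X (negproj sg).
Proof. by move=> is_; apply/intertwZ/intertwB => //; exact: intertw1. Qed.

(** The matrix [k] satisfies [k *m sg = sg' *m k]; being invertible, it maps the first eigenspace
    onto the second. *)
Lemma negproj_close sg sg' Y u v Y' u' v' : sg *m sg = 1%:M -> sg' *m sg' = 1%:M ->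
  @intertw R B X X sg -> @intertw R B X X sg' -> 1%:M + sg' *m sg \in unitmx ->
  @splits R B X (negproj sg) Y u v -> @splits R B X (negproj sg') Y' u' v' -> fd_iso Y Y'.
Proof.
move=> ss ss' is_ is' ku; set k := 1%:M + sg' *m sg.
have ik : @intertw R B X X k by apply: intertwD; [exact: intertw1|exact: intertwM].
have ik' : @intertw R B X X (invmx k) by move=> b; exact: commV ku (ik b).
apply: (splits_iso ik ik'); rewrite ?mulVmx ?mulmxV //.
rewrite /negproj -scalemxAr -scalemxAl; congr (_ *: _).
rewrite mulmxBr mulmxBl mulmx1 mul1mx; congr (_ - _).
by rewrite /k mulmxDl mulmxDr mul1mx mulmx1 -mulmxA ss mulmx1 mulmxA ss' mul1mx addrC.
Qed.

Lemma mT : m^T = m.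
Proof. by rewrite mactE (proj2 Xa) scale1r. Qed.

Lemma mm : m *m m = 1%:M. Proof. exact: mact_sq. Qed.

Lemma involution_mass sg : @intertw R B X X sg -> sg *m sg = 1%:M -> fdmass (m *m sg).
Proof.
move=> is_ ss; have sm : sg *m m = m *m sg := is_ _; have mm_ := mm.
have [_ ma] := fdmass_mact X; split=> [|d a ad].
  by rewrite mulmxA -(mulmxA m) sm mulmxA mm_ mul1mx.
by rewrite mulmxA (ma _ _ ad) -scalemxAl -!mulmxA (intertw_acomm is_ ad).
Qed.

Lemma fdmassT M : fdmass M -> fdmass M^T.
Proof.
move=> [MM Ma]; split=> [|d a ad]; first by rewrite -trmx_mul MM trmx1.
have [a' ad' aE] := proj1 Xa _ _ ad.
have := congr1 trmx (Ma _ _ ad'); rewrite linearZ /= !trmx_mul -aE trmxK => ->.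
by rewrite scalerA sign_sq scale1r.
Qed.

Lemma acomm_sqrt T : posd T -> acomm (T *m T) -> acomm T.
Proof.
move=> Tp hT d a ad; apply/esym/sqrt_intertwine => //.
exact: esym (hT _ _ ad).
Qed.

Lemma fdmass_unit M : fdmass M -> M \in unitmx.
Proof. by case=> /mulmx1_unit[]. Qed.

Section Polar.
Variable M : 'M[R]_n.
Hypothesis hM : fdmass M.

Definition pabs := sqrtm (M^T *m M).
(** By [pabsMpabs] this is also M |M|^-1, the orthogonal factor of the polar decomposition. *)
Definition porth := pabs *m M.

Let pabsP := sqrtmP (posd_trmul (fdmass_unit hM)).

Lemma pabs_posd : posd pabs. Proof. exact: (proj1 pabsP). Qed.
Lemma pabs_sq : pabs *m pabs = M^T *m M. Proof. exact: (proj2 pabsP). Qed.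

Lemma pabs_acomm : acomm pabs.
Proof.
apply: acomm_sqrt; first exact: pabs_posd.
by rewrite pabs_sq; apply: fdmassM; [exact: fdmassT|].
Qed.

(** As [M] is an involution, M M^T is the inverse of M^T M. Hence [M] intertwines M^T M with its
    inverse, and therefore |M| with its inverse. *)
Lemma pabsMpabs : pabs *m M *m pabs = M.
Proof.
have pu := posd_unit pabs_posd; have [MM _] := hM.
have E : M *m (pabs *m pabs) = (invmx pabs *m invmx pabs) *m M.
  have h : M *m M^T = invmx pabs *m invmx pabs.
    apply: (can_inj (mulmxK pu)); rewrite -(mulmxA (invmx _)) mulVmx // mulmx1.
    apply: (can_inj (mulmxK pu)); rewrite mulVmx // -!mulmxA pabs_sq !mulmxA.
    by rewrite -(mulmxA M) -trmx_mul MM trmx1 mulmx1.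
  by rewrite pabs_sq mulmxA h.
have := sqrt_intertwine (posdV pabs_posd) pabs_posd E.
by rewrite -mulmxA => ->; rewrite mulmxA mulmxV // mul1mx.
Qed.

Lemma porth_mass : fdmass porth.
Proof.
have [MM Ma] := hM; split=> [|d a ad].
  by rewrite /porth mulmxA pabsMpabs.
by rewrite /porth mulmxA -(pabs_acomm ad) -mulmxA (Ma _ _ ad) -scalemxAr mulmxA.
Qed.

Lemma porth_sym : porth^T = porth.
Proof.
have [MM _] := hM; rewrite /porth trmx_mul (proj1 pabs_posd).
have -> : M^T = pabs *m pabs *m M by rewrite pabs_sq -mulmxA MM mulmx1.
by rewrite -!mulmxA (mulmxA pabs M) pabsMpabs.
Qed.

Lemma join_porth : fdjoin M porth.
Proof.
have [cp cE] := sqrtmP pabs_posd; set c := sqrtm pabs in cp cE.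
have cu := posd_unit cp.
(* For the square root c of |M| the same argument gives M c^-1 = c M, whence c M c^-1 = |M| M. The
   segment from 1 to c stays positive definite. *)
have -> : porth = c *m M *m invmx c.
  apply: (can_inj (mulmxK cu)); rewrite mulmxKV // /porth.
  have E : (c *m M) *m pabs = invmx pabs *m (c *m M).
    have pu := posd_unit pabs_posd.
    rewrite -[LHS](mulKmx pu); congr (_ *m _).
    rewrite !mulmxA (_ : pabs *m c = c *m pabs); last by rewrite -cE mulmxA.
    by rewrite -!mulmxA (mulmxA pabs) pabsMpabs.
  have := @sqrt_intertwine R n n (invmx c) c (c *m M) (posdV cp) cp.
  rewrite cE E => /(_ _) h.
  have h1 : c *m M *m c = invmx c *m (c *m M).
    apply: h; congr (_ *m _); have pu := posd_unit pabs_posd.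
    apply: (can_inj (mulmxK pu)); rewrite mulVmx // -cE !mulmxA.
    by rewrite -(mulmxA (invmx c)) mulVmx // mulmx1 mulVmx.
  by rewrite -cE -!mulmxA (mulmxA c M) h1 mulKVmx.
apply: straight_join => //.
  by apply: acomm_sqrt cp _; rewrite cE; exact: pabs_acomm.
move=> t /andP[t0 t1]; apply: posd_unit.
have [->|tn0] := eqVneq t 0; first by rewrite subr0 scale0r addr0; exact: posd1.
have tp : 0 < t by rewrite lt_def tn0.
have tcp : posd (t *: c).
  split=> [|v v0]; first by rewrite linearZ /= (proj1 cp).
  by rewrite -scalemxAr -scalemxAl mxE mulr_gt0 //; exact: (proj2 cp).
rewrite addrC; apply: posdD => //; first by rewrite tr_scalar_mx.
move=> v; rewrite mul_mx_scalar -scalemxAl mxE mulr_ge0 ?subr_ge0 //.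
exact: dot_self_ge0.
Qed.
End Polar.

Section Sign.
Variables (Q : 'M[R]_n) (hQ : fdmass Q) (Qs : Q^T = Q).

(* As Q and m are both mass terms, [acommutator] is an endomorphism of the module X,
   symmetric because Q is: its spectral projections split X into submodules. *)
Definition acommutator := Q *m m + m *m Q.
Local Notation s := acommutator.
Definition shifted (t : R) := s - t%:M.
Definition sabs t := sqrtm (shifted t *m shifted t).
Definition sgn t := shifted t *m invmx (sabs t).

Let QQ : Q *m Q = 1%:M. Proof. by case: hQ. Qed.

Lemma s_sym : s^T = s.
Proof. by rewrite /s linearD /= !trmx_mul mT Qs addrC. Qed.

Lemma s_Q : Q *m s = s *m Q.
Proof. by rewrite mulmxDr mulmxDl !mulmxA QQ mul1mx -!mulmxA QQ mulmx1 addrC. Qed.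

Lemma s_m : m *m s = s *m m.
Proof. by rewrite mulmxDr mulmxDl !mulmxA mm mul1mx -!mulmxA mm mulmx1 addrC. Qed.

Lemma s_acomm : acomm s.
Proof. by apply: acommD; apply: fdmassM => //; exact: fdmass_mact. Qed.

Lemma s_intertw : @intertw R B X X s.
Proof. by apply: intertw_gen => //; [exact: s_acomm|rewrite s_m]. Qed.

Lemma bicom_intertw F : bicom s F -> @intertw R B X X F.
Proof. by move=> hF b; apply/esym/hF/esym/s_intertw. Qed.

Lemma sE k (w : 'M[R]_(n, k)) : s *m w = Q *m (m *m w) + m *m (Q *m w).
Proof. by rewrite mulmxDl -!mulmxA. Qed.

Local Opaque acommutator.

Lemma shifted_bicom t : bicom s (shifted t).
Proof. by apply: bicomD; [exact: bicom_id|apply/bicomN/bicom_scalar]. Qed.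

Lemma shifted_sym t : (shifted t)^T = shifted t.
Proof. by rewrite /shifted linearB /= s_sym tr_scalar_mx. Qed.

Section Regular.
Variable t : R.
Hypothesis tu : shifted t \in unitmx.

Lemma sabsP : posd (sabs t) /\ sabs t *m sabs t = shifted t *m shifted t.
Proof. by apply: sqrtmP; apply: posd_sqr => //; exact: shifted_sym. Qed.

Lemma sabs_bicom : bicom s (sabs t).
Proof.
have [p E] := sabsP; apply: bicom_sqrt p _; rewrite E.
by apply: bicomM; exact: shifted_bicom.
Qed.

Lemma sgn_bicom : bicom s (sgn t).
Proof.
apply: bicomM; first exact: shifted_bicom.
by apply: bicomV; [exact: posd_unit (proj1 sabsP)|exact: sabs_bicom].
Qed.

Lemma sgn_sabs : sgn t *m sabs t = shifted t.
Proof. by rewrite /sgn mulmxKV // posd_unit //; case: sabsP. Qed.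

Local Opaque shifted sabs.

Lemma sgn_sq : sgn t *m sgn t = 1%:M.
Proof.
have [p E] := sabsP; have bu := posd_unit p.
apply: (can_inj (mulmxK bu)); apply: (can_inj (mulmxK bu)); rewrite mul1mx E.
rewrite -(mulmxA (sgn t) (sgn t)) sgn_sabs -mulmxA.
by rewrite (bicomC (shifted_bicom t) sabs_bicom) mulmxA sgn_sabs.
Qed.

Lemma sgn_sym : (sgn t)^T = sgn t.
Proof.
have [p _] := sabsP; rewrite /sgn trmx_mul trmx_inv (proj1 p) shifted_sym.
by apply: bicomC (shifted_bicom t); apply: bicomV; [exact: posd_unit|exact: sabs_bicom].
Qed.

Local Opaque sgn.

Lemma sgn_intertw : @intertw R B X X (sgn t).
Proof. exact/bicom_intertw/sgn_bicom. Qed.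

Lemma s_sgn k (F : 'M[R]_(n, k)) : sgn t *m F = F -> s *m F = (sabs t + t%:M) *m F.
Proof.
move=> sF; rewrite [RHS]mulmxDl -{2}sF mulmxA -(bicomC sgn_bicom sabs_bicom) sgn_sabs.
by rewrite -mulmxDl subrK.
Qed.

Lemma s_sgnN k (F : 'M[R]_(n, k)) : sgn t *m F = - F -> s *m F = (t%:M - sabs t) *m F.
Proof.
move=> sF; have : sabs t *m F = - (shifted t *m F).
  by rewrite -sgn_sabs (bicomC sgn_bicom sabs_bicom) -mulmxA sF mulmxN opprK.
by move=> E; rewrite mulmxBl E opprK -mulmxDl addrC subrK.
Qed.

Lemma fdmass_sgn : fdmass (m *m sgn t).
Proof. exact: involution_mass sgn_intertw sgn_sq. Qed.

Hypotheses (tl : -2 < t) (tr : t < 2).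

(** On the part of [v] fixed by the sign, Qm is -1 and so s = -2, whereas s > t > -2 there; on the
    part where the sign is -1, Qm is 1 and so s = 2, whereas s < t < 2. *)
Lemma sgn_kernel (v : 'cV[R]_n) : Q *m (m *m (sgn t *m v)) = - v -> v = 0.
Proof.
move=> E; have is_ := sgn_intertw; have sm : sgn t *m m = m *m sgn t := is_ _.
have sQ : sgn t *m Q = Q *m sgn t by apply/esym/sgn_bicom/s_Q.
have sgn2 : sgn t *m (sgn t *m v) = v by rewrite mulmxA sgn_sq mul1mx.
have E2 : Q *m (m *m v) = - (sgn t *m v).
  have := congr1 (mulmx (sgn t)) E.
  by rewrite mulmxA sQ -mulmxA (mulmxA (sgn t) m) sm -mulmxA sgn2 mulmxN.
have anti (w : 'cV[R]_n) : Q *m (m *m w) = - w -> m *m (Q *m w) = - w.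
  move=> h; have := congr1 (fun z => m *m (Q *m z)) h.
  by rewrite /= !mulmxN [in LHS](mulmxA Q Q) QQ mul1mx [in LHS]mulmxA mm mul1mx => {2}->; rewrite opprK.
have same (w : 'cV[R]_n) : Q *m (m *m w) = w -> m *m (Q *m w) = w.
  move=> h; have := congr1 (fun z => m *m (Q *m z)) h.
  by rewrite /= [in LHS](mulmxA Q Q) QQ mul1mx [in LHS]mulmxA mm mul1mx => <-.
have [p _] := sabsP.
have wp : v + sgn t *m v = 0.
  set w := v + _; have sw : sgn t *m w = w by rewrite mulmxDr sgn2 addrC.
  have h : Q *m (m *m w) = - w by rewrite !mulmxDr E E2 opprD addrC.
  have sw2 : s *m w = - (2 *: w).
    by rewrite sE h (anti _ h) -opprD scaler_nat mulr2n.
  have pp : posd (sabs t + (t + 2)%:M).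
    by apply: posdDp => //; apply: posd_scalar; rewrite -ltrBlDr sub0r.
  rewrite -(mulKmx (posd_unit pp) w) (_ : _ *m w = 0) ?mulmx0 //.
  have := s_sgn sw; rewrite sw2 => /eqP; rewrite eq_sym -subr_eq0 opprK => /eqP <-.
  by rewrite -mul_scalar_mx -mulmxDl -addrA -raddfD.
have wm : v - sgn t *m v = 0.
  set w := v - _; have sw : sgn t *m w = - w by rewrite mulmxBr sgn2 opprB.
  have h : Q *m (m *m w) = w by rewrite !mulmxBr E E2 opprK addrC.
  have sw2 : s *m w = 2 *: w.
    by rewrite sE h (same _ h) scaler_nat mulr2n.
  have pp : posd (sabs t + (2 - t)%:M).
    by apply: posdDp => //; apply: posd_scalar; rewrite subr_gt0.
  rewrite -(mulKmx (posd_unit pp) w) (_ : _ *m w = 0) ?mulmx0 //.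
  have := s_sgnN sw; rewrite sw2 => /eqP; rewrite -subr_eq0 => /eqP <-.
  by rewrite -mul_scalar_mx -mulmxBl opprB addrCA -raddfB.
have : v *+ 2 = 0 by rewrite mulr2n -[RHS](addr0 0) -{1}wp -wm addrACA subrr addr0.
by rewrite -scaler_nat => /eqP; rewrite scaler_eq0 pnatr_eq0 => /eqP.
Qed.

Lemma join_sgn : fdjoin (m *m sgn t) Q.
Proof.
set N := m *m sgn t; have hN : fdmass N := fdmass_sgn.
have NT : N^T *m N = 1%:M.
  by move: sgn_sym sgn_sq; rewrite /N; move: (sgn t) => g gT gg;
     rewrite trmx_mul gT mT mulmxA -(mulmxA g) mm mulmx1.
have NE (v : 'cV[R]_n) : N *m v = m *m (sgn t *m v).
  by rewrite /N; move: (sgn t) => g; rewrite mulmxA.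
have {NE} ker1 (v : 'cV[R]_n) : Q *m (N *m v) = - v -> v = 0.
  by rewrite NE; exact: sgn_kernel.
clearbody N.
(* [Q *m N] is orthogonal, so its real eigenvalues have absolute value 1 and only -1 has to be
   excluded. *)
have kernel (v : 'cV[R]_n) r : 1 <= r -> Q *m (N *m v) = - (r *: v) -> v = 0.
  move=> r1 E; have e : (v^T *m v) 0 0 = r ^+ 2 * (v^T *m v) 0 0.
    have := congr1 (fun w => (w^T *m w) 0 0) E => /=.
    have -> : (Q *m (N *m v))^T *m (Q *m (N *m v)) = v^T *m v.
      by rewrite !trmx_mul Qs !mulmxA -(mulmxA _ Q Q) QQ mulmx1 -(mulmxA _ N^T) NT mulmx1.
    rewrite mulmxN linearN /= mulNmx opprK -scalemxAr linearZ -scalemxAl scalerA => h.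
    by rewrite [LHS]h mxE expr2.
  have [->//|v0] := eqVneq v 0; have vp := dot_self_gt0 v0.
  have r2 : r = 1.
    have /eqP := e; rewrite -subr_eq0 -[X in X - _]mul1r -mulrBl mulf_eq0 (gt_eqF vp) orbF.
    rewrite subr_eq0 eq_sym sqrf_eq1 => /orP[/eqP //|/eqP rN].
    by move: r1; rewrite rN => /(lt_le_trans ltr01); rewrite ltr0N1.
  by apply: ker1; rewrite E r2 scale1r.
(* [Q] and [N] are involutions, so [Q *m k = k *m N]. The factor 1/2 stops the segment halfway
   between 1 and QN: for 0 < r <= 1 a null vector of (1 - r) + r k is an eigenvector of QN for -(2 /
   r - 1), which is at most -1. *)
pose k := 2^-1 *: (1%:M + Q *m N).
have kU : k \in unitmx.
  apply: unitmx_inj0 => v; rewrite -scalemxAl => /eqP; rewrite scaler_eq0 invr_eq0 pnatr_eq0 /=.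
  rewrite mulmxDl mul1mx addrC addr_eq0 -mulmxA => /eqP E.
  by apply: (kernel v 1) => //; rewrite scale1r.
have [NN _] := hN.
have -> : Q = k *m N *m invmx k.
  apply: (can_inj (mulmxK kU)); rewrite mulmxKV // /k -scalemxAl -scalemxAr.
  congr (_ *: _); rewrite mulmxDl mulmxDr mul1mx mulmx1 -mulmxA NN mulmx1 mulmxA QQ mul1mx.
  exact: addrC.
apply: straight_join => //.
  by apply/acommZ/acommD; [exact: acomm1|exact: fdmassM].
move=> r /andP[r0 r1]; apply: unitmx_inj0 => v; rewrite /k.
have [->|rn0] := eqVneq r 0; first by rewrite subr0 scale0r addr0 mul1mx.
have rp : 0 < r by rewrite lt_def rn0.
move=> E; apply: (kernel v (2 / r - 1)).
  by rewrite lerBrDr ler_pdivlMr //; lra.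
have E2 : (1 - r / 2) *: v + (r / 2) *: (Q *m (N *m v)) = 0.
  rewrite -E scalerA mulmxDl mul_scalar_mx -scalemxAl mulmxDl mul1mx -mulmxA scalerDr addrA.
  by rewrite -scalerDl; congr (_ *: _ + _); field.
have := congr1 (fun w => (2 / r) *: w) E2; rewrite scaler0 scalerDr !scalerA.
have -> : 2 / r * (r / 2) = 1 by field.
rewrite scale1r addrC => /eqP; rewrite addr_eq0 => /eqP ->.
by congr (- (_ *: _)); field.
Qed.
End Regular.
End Sign.
End Spectral.

(** * Rotating sign changes *)

Section Flips.
Variables (R : realType) (AV : superalgebra R).
Local Notation B := (stensor (Cl R 0 1) AV).
Variable V : fdmod B.
Local Notation n := (fd_dim V).
Local Notation m := (mact V).

Definition flip k (u : 'M[R]_(n, k)) v : 'M[R]_n := m *m (1%:M - 2 *: (u *m v)).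

Definition emb X (u : 'M[R]_(n, fd_dim X)) v := @splits R B V (u *m v) X u v.

Lemma embP X u v : intertw u -> intertw v -> v *m u = 1%:M -> @emb X u v.
Proof. by []. Qed.

Lemma flip_involution X u v (sg := 1%:M - 2 *: (u *m v)) : @emb X u v ->
  [/\ @intertw R B V V sg, sg *m sg = 1%:M & @splits R B V (negproj sg) X u v].
Proof.
move=> [iu iv vu _]; have ee : u *m v *m (u *m v) = u *m v.
  by rewrite mulmxA -(mulmxA u) vu mulmx1.
have ie : @intertw R B V V (u *m v) by apply: intertwM.
rewrite /sg; split.
- by apply/intertwB/intertwZ => //; exact: intertw1.
- move: (u *m v) ee {ie} => e ee.
  rewrite mulmxBr mulmx1 mulmxBl mul1mx -scalemxAl -scalemxAr ee.
  by apply/matrixP=> i j; rewrite !mxE; ring.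
- split=> //; rewrite /negproj; move: (u *m v) => e.
  by apply/matrixP=> i j; rewrite !mxE; field.
Qed.

Lemma flip_mass X u v : @emb X u v -> @fdmass R AV V (flip u v).
Proof. by case/flip_involution=> is_ ss _; exact: involution_mass. Qed.

(** The quarter turn [K] in the sum of the two copies of [X] commutes with the whole algebra, so
    conjugation by it leaves [m] alone and carries one reflection to the other. *)
Lemma flip_rotate X u v u' v' : @emb X u v -> @emb X u' v' ->
  v *m u' = 0 -> v' *m u = 0 -> fdjoin (flip u v) (flip u' v').
Proof.
move=> he he' vu' v'u; have hM := flip_mass he.
case: he he' => [iu iv vu _] [iu' iv' v'u'1 _].
pose E := u *m v + u' *m v'; pose K := u' *m v - u *m v'.
have iE : @intertw R B V V E by apply: intertwD; apply: intertwM.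
have iK : @intertw R B V V K by apply: intertwB; apply: intertwM.
have Eu : E *m u = u by rewrite mulmxDl -!mulmxA vu v'u mulmx1 mulmx0 addr0.
have Eu' : E *m u' = u' by rewrite mulmxDl -!mulmxA vu' v'u'1 mulmx1 mulmx0 add0r.
have vE : v *m E = v by rewrite mulmxDr !mulmxA vu vu' mul1mx mul0mx addr0.
have v'E : v' *m E = v' by rewrite mulmxDr !mulmxA v'u v'u'1 mul1mx mul0mx add0r.
have Ku : K *m u = u' by rewrite mulmxBl -!mulmxA vu v'u mulmx1 mulmx0 subr0.
have Ku' : K *m u' = - u by rewrite mulmxBl -!mulmxA vu' v'u'1 mulmx1 mulmx0 sub0r.
have vK : v *m K = - v' by rewrite mulmxBr !mulmxA vu vu' mul1mx mul0mx sub0r.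
have EE : E *m E = E by rewrite {2}/E mulmxDr !mulmxA Eu Eu'.
have EK : E *m K = K by rewrite {1}/K mulmxBr !mulmxA Eu Eu'.
have KE : K *m E = K by rewrite {1}/K mulmxBl -!mulmxA vE v'E.
have KK : K *m K = - E.
  by rewrite {2}/K mulmxBr !mulmxA Ku Ku' mulNmx opprD addrC.
clearbody E K.
have := rotation_join hM (intertw_acomm iE) (intertw_acomm iK) EE EK KE KK.
have il : @intertw R B V V (1%:M - E + K).
  by apply: intertwD => //; apply: intertwB => //; exact: intertw1.
have lm : (1%:M - E + K) *m m = m *m (1%:M - E + K) := il _.
suff -> : (1%:M - E + K) *m flip u v *m (1%:M - E - K) = flip u' v' by [].
have lu : (1%:M - E + K) *m u = u' by rewrite mulmxDl mulmxBl mul1mx Eu Ku subrr add0r.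
have vr : v *m (1%:M - E - K) = v' by rewrite !mulmxBr mulmx1 vE vK subrr sub0r opprK.
have lr : (1%:M - E + K) *m (1%:M - E - K) = 1%:M.
  rewrite !(mulmxDl, mulmxDr, mulmxN, mulNmx) !(mulmx1, mul1mx) EE EK KE KK.
  by apply/matrixP=> i j; rewrite !mxE; ring.
rewrite /flip mulmxA lm -!mulmxA; congr (m *m _).
rewrite mulmxBl mulmxBr mul1mx lr -scalemxAl -scalemxAr; congr (_ - 2 *: _).
by rewrite -mulmxA vr mulmxA lu.
Qed.

(* The rotation by J on the summand Z anticommutes with the mass generator, so that
   conjugating by it changes the sign of the mass on Z. *)
Lemma flip_absorb X Z u v w z J : @emb X u v -> @emb Z w z -> z *m u = 0 -> v *m w = 0 ->
  @clext R AV Z J -> fdjoin (flip u v) (m *m (1%:M - 2 *: (u *m v + w *m z))).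
Proof.
move=> he [iw iz zw _] zu vw [Ja Jm JJ]; have hM := flip_mass he.
case: he => [iu iv vu _].
pose E := w *m z; pose K := w *m J *m z.
have iE : @intertw R B V V E by apply: intertwM.
have aK : @acomm R AV V K.
  move=> d a ad; rewrite /K -mulmxA; have -> : z *m aact V a = aact Z a *m z by apply: iz.
  have wa : w *m aact Z a = aact V a *m w by apply: iw.
  by rewrite !mulmxA -(mulmxA w) (Ja _ _ ad) mulmxA wa.
have Km : K *m m = - (m *m K).
  rewrite /K -mulmxA; have -> : z *m m = mact Z *m z by apply: iz.
  have wm : w *m mact Z = m *m w by apply: iw.
  by rewrite !mulmxA -(mulmxA w) Jm mulmxN mulmxA wm mulNmx.
have Ew : E *m w = w by rewrite -mulmxA zw mulmx1.
have zE : z *m E = z by rewrite mulmxA zw mul1mx.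
have Em : E *m m = m *m E by apply: iE.
have EE : E *m E = E by rewrite {2}/E mulmxA Ew.
have EK : E *m K = K by rewrite /K !(mulmxA E) Ew.
have KE : K *m E = K by rewrite /K -(mulmxA _ z E) zE.
have KK : K *m K = - E.
  by rewrite /K !mulmxA -(mulmxA _ z w) zw mulmx1 -(mulmxA w) JJ mul_mx_scalar scaleN1r mulNmx.
have Eu : E *m u = 0 by rewrite -mulmxA zu mulmx0.
have Ku : K *m u = 0 by rewrite -mulmxA zu mulmx0.
have vE : v *m E = 0 by rewrite mulmxA vw mul0mx.
have vK : v *m K = 0 by rewrite /K !mulmxA vw !mul0mx.
have wz : E = w *m z by [].
clearbody E K.
have := rotation_join hM (intertw_acomm iE) aK EE EK KE KK.
suff -> : (1%:M - E + K) *m flip u v *m (1%:M - E - K) = m *m (1%:M - 2 *: (u *m v + w *m z)) by [].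
have lm : (1%:M - E + K) *m m = m *m (1%:M - E - K).
  by rewrite mulmxDl mulmxBl mul1mx Em Km !mulmxBr mulmx1.
have lu : (1%:M - E - K) *m u = u.
  by rewrite !mulmxBl mul1mx Eu Ku !subr0.
have vr : v *m (1%:M - E - K) = v.
  by rewrite !mulmxBr mulmx1 vE vK !subr0.
(* The rotation passes [m] as its inverse; two equal quarter turns then meet and compose to the half
   turn, which is -1 on the image of [w]. *)
have rr : (1%:M - E - K) *m (1%:M - E - K) = 1%:M - E - E.
  rewrite !(mulmxDl, mulmxDr, mulmxN, mulNmx) !(mulmx1, mul1mx) EE EK KE KK.
  by apply/matrixP=> i j; rewrite !mxE; ring.
rewrite /flip mulmxA lm -!mulmxA; congr (m *m _).
move: (1%:M - E - K) lu vr rr {lm} => L lu vr rr.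
rewrite mulmxBl mul1mx -scalemxAl -(mulmxA u) vr mulmxBr rr -scalemxAr (mulmxA L) lu.
by rewrite wz; move: (u *m v) (w *m z) => e g; apply/matrixP=> i j; rewrite !mxE; ring.
Qed.

Lemma emb_add X Z u v : @emb (fd_add X Z) u v ->
  [/\ @emb X (u *m fd_in1 X Z) (fd_pr1 X Z *m v), @emb Z (u *m fd_in2 X Z) (fd_pr2 X Z *m v),
     fd_pr2 X Z *m v *m (u *m fd_in1 X Z) = 0, fd_pr1 X Z *m v *m (u *m fd_in2 X Z) = 0
   & u *m fd_in1 X Z *m (fd_pr1 X Z *m v) + u *m fd_in2 X Z *m (fd_pr2 X Z *m v) = u *m v].
Proof.
move=> [iu iv vu _]; have [[ia ib ia' ib'] [ba ba' d1 d2 t]] := biprod_add X Z.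
have cut k l (p : 'M[R]_(k, fd_dim (fd_add X Z))) (q : 'M[R]_(fd_dim (fd_add X Z), l)) :
    p *m v *m (u *m q) = p *m q.
  by rewrite mulmxA -(mulmxA p) vu mulmx1.
split; rewrite ?cut //.
- by apply: embP; [exact: intertwM|exact: intertwM|rewrite cut].
- by apply: embP; [exact: intertwM|exact: intertwM|rewrite cut].
- by rewrite -!(mulmxA u) -mulmxDr !mulmxA -mulmxDl t mul1mx.
Qed.

Lemma flip_add_clext X Z u v J : @emb (fd_add X Z) u v -> @clext R AV Z J ->
  fdjoin (flip (u *m fd_in1 X Z) (fd_pr1 X Z *m v)) (flip u v).
Proof.
move=> /emb_add[e1 e2 c1 c2 s] hJ.
by have := flip_absorb e1 e2 c1 c2 hJ; rewrite s.
Qed.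

End Flips.

(** * The space of mass terms *)

Section Stages.
Variables (R : realType) (AV : superalgebra R).
Local Notation B := (stensor (Cl R 0 1) AV).
Variable W : nat -> irrmod B.
Local Notation U := (univ W).
Local Notation dW k := (fd_dim (irr_mod (W k))).

Definition stg N : fdmod B := fd_dsum (fun i : 'I_N => irr_mod (W i)).

Definition uinc_comp N (x : 'cV[R]_(fd_dim (stg N))) k : 'cV[R]_(dW k) :=
  match pselect (k < N)%N with
  | left h => submxcol x (Ordinal h)
  | right _ => 0
  end.

Lemma uinc_comp_lt N x (i : 'I_N) : uinc_comp x i = submxcol x i.
Proof.
rewrite /uinc_comp; case: pselect => [h|[]//].
by case: i h => k hk h; rewrite (bool_irrelevance hk h).
Qed.

Lemma uinc_comp_ge N (x : 'cV[R]_(fd_dim (stg N))) k : (N <= k)%N -> uinc_comp x k = 0.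
Proof. by rewrite /uinc_comp leqNgt => /negP; case: pselect. Qed.

Lemma uinc_fin N (x : 'cV[R]_(fd_dim (stg N))) :
  exists N0, forall k, (N0 <= k)%N -> uinc_comp x k = 0.
Proof. by exists N => k; exact: uinc_comp_ge. Qed.

Definition uinc N x : U := Universe (@uinc_fin N x).

Lemma universe_lt N (u v : U) : (forall i : 'I_N, u i = v i) ->
  (forall k, (N <= k)%N -> u k = v k) -> u = v.
Proof.
move=> h1 h2; apply/universeP => k; have [kN|Nk] := ltnP k N; last exact: h2.
exact: (h1 (Ordinal kN)).
Qed.

Lemma ucompD (u v : U) k : (u + v) k = u k + v k. Proof. by []. Qed.
Lemma ucompB (u v : U) k : (u - v) k = u k - v k. Proof. by []. Qed.
Lemma ucompZ r (u : U) k : (r *: u) k = r *: u k. Proof. by []. Qed.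
Lemma ucomp_act b (u : U) k : ubact W b u k = fd_act (W k) b *m u k. Proof. by []. Qed.
Lemma ucompI N x k : @uinc N x k = uinc_comp x k. Proof. by []. Qed.

Lemma uinc_is_linear N : linear (@uinc N).
Proof.
move=> r x y; apply: (@universe_lt N) => [i|k Nk].
  rewrite ucompD ucompZ !ucompI !uinc_comp_lt.
  by apply/matrixP=> a b; rewrite !mxE.
by rewrite ucompD ucompZ !ucompI !uinc_comp_ge // scaler0 addr0.
Qed.
HB.instance Definition _ N := GRing.isLinear.Build R _ U _ (@uinc N) (@uinc_is_linear N).

Definition uprj N (u : U) : 'cV[R]_(fd_dim (stg N)) := \mxcol_(i < N) u i.

Lemma uprj_is_linear N : linear (@uprj N).
Proof. by move=> r u v; apply/matrixP=> i j; rewrite !mxE. Qed.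
HB.instance Definition _ N := GRing.isLinear.Build R U _ _ (@uprj N) (@uprj_is_linear N).

Lemma uincK N x : uprj N (uinc x) = x.
Proof. by apply/mxcolP => i; rewrite mxcolK; exact: uinc_comp_lt. Qed.

Lemma uinc_stage N (x : 'cV[R]_(fd_dim (stg N))) : ustage N (uinc x).
Proof. by move=> k; exact: uinc_comp_ge. Qed.

Lemma uinc_uprj N (u : U) : ustage N u -> uinc (uprj N u) = u.
Proof.
move=> uN; apply: (@universe_lt N) => [i|k Nk]; last by rewrite uN //; exact: uinc_comp_ge.
by rewrite [LHS]uinc_comp_lt mxcolK.
Qed.

Lemma uprj_tail N (u : U) : utail N u -> uprj N u = 0.
Proof. by move=> uN; apply/mxcolP => i; rewrite mxcolK uN // submxcol0. Qed.

Lemma utail_rest N (u : U) : utail N (u - uinc (uprj N u)).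
Proof.
move=> k kN; rewrite ucompB ucompI.
by have := uinc_comp_lt (uprj N u) (Ordinal kN) => /= ->; rewrite mxcolK subrr.
Qed.

Lemma uprj_act N b (u : U) : uprj N (ubact W b u) = fd_act (stg N) b *m uprj N u.
Proof. by rewrite /uprj /= /fd_dsum_act mul_mxdiag_mxcol. Qed.

Lemma uinc_act N b (x : 'cV[R]_(fd_dim (stg N))) :
  ubact W b (uinc x) = uinc (fd_act (stg N) b *m x).
Proof.
rewrite -[in RHS](uincK x) -uprj_act uinc_uprj // => k Nk.
by rewrite ucomp_act ucompI uinc_comp_ge // mulmx0.
Qed.

Lemma mulmx_cV m n (A C : 'M[R]_(m, n)) : (forall x : 'cV_n, A *m x = C *m x) -> A = C.
Proof.
by move=> h; apply/matrixP=> i j; have := congr1 (fun z : 'cV_m => z i 0) (h (delta_mx j 0));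
  rewrite -!colE !mxE.
Qed.

Lemma uinc_basis N (x : 'cV[R]_(fd_dim (stg N))) :
  uinc x = \sum_j x j 0 *: ubasis (tagnat.sig2 j) :> U.
Proof.
have st (j : 'I_(fd_dim (stg N))) : ustage N (ubasis (tagnat.sig2 j) : U).
  move=> k Nk; apply/matrixP=> a b; rewrite !mxE.
  by rewrite (gtn_eqF (leq_trans (ltn_ord (tagnat.sig1 j)) Nk)).
have sE (u : U) : ustage N u -> u = uinc (uprj N u) by move=> h; rewrite uinc_uprj.
have ub (j : 'I_(fd_dim (stg N))) : ubasis (tagnat.sig2 j) = uinc (delta_mx j 0) :> U.
  rewrite [LHS]sE //; congr uinc; apply/matrixP=> r c; rewrite (ord1 c) !mxE eqxx andbT.
  by have := tagnat.eq_Rank (tagnat.sig2 r) (tagnat.sig2 j); rewrite !tagnat.sig2K => <-.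
under eq_bigr => j _ do rewrite ub -linearZ /=.
by rewrite -raddf_sum /=; congr uinc; rewrite {1}(matrix_sum_delta x); apply: eq_bigr => j _; exact: big_ord1.
Qed.

Lemma ublockE N (M : {linear U -> U}) (x : 'cV[R]_(fd_dim (stg N))) :
  uprj N (M (uinc x)) = ublock N M *m x.
Proof.
rewrite uinc_basis raddf_sum /= raddf_sum /=; apply/matrixP=> i c; rewrite (ord1 c) !mxE summxE.
by apply: eq_bigr => j _; rewrite !linearZ /= !mxE mulrC.
Qed.

Section Op.
Variables (N : nat) (A : 'M[R]_(fd_dim (stg N))).

Definition uop (u : U) : U := uinc (A *m uprj N u) + mass0 W (u - uinc (uprj N u)).

Lemma rest_linear r (u v : U) : r *: u + v - uinc (uprj N (r *: u + v)) =
  r *: (u - uinc (uprj N u)) + (v - uinc (uprj N v)).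
Proof. by rewrite uprj_is_linear uinc_is_linear scalerBr opprD addrACA. Qed.

Lemma uop_is_linear : linear uop.
Proof.
move=> r u v; rewrite /uop rest_linear uprj_is_linear mulmxDr -scalemxAr uinc_is_linear.
by rewrite linearP scalerDr addrACA.
Qed.
HB.instance Definition _ := GRing.isLinear.Build R U U _ uop uop_is_linear.

Lemma uop_stage : mass_stage N uop.
Proof.
split=> u uN; rewrite /uop.
  by rewrite uinc_uprj // subrr raddf0 addr0; exact: uinc_stage.
by rewrite uprj_tail // mulmx0 (raddf0 (@uinc N)) subr0 add0r.
Qed.

Lemma ublock_uop : ublock N uop = A.
Proof.
apply: mulmx_cV => x.
by rewrite -(ublockE uop) /= /uop uincK subrr raddf0 addr0 uincK.
Qed.

(** The witness acts by the twisted representation on the stage and by the given one on the tail. *)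
Lemma uop_rep : @fdmass R AV (stg N) A -> exists f : B -> U -> U,
  [/\ Defs.is_action f, forall a, f (st_inr _ a) = ubact W (st_inr _ a)
      & f (mass_gen AV) = uop].
Proof.
move=> hA; have [F [Fm Fg Fa]] := fdmass_twist hA.
pose f b (u : U) : U := uinc (F b *m uprj N u) + ubact W b (u - uinc (uprj N u)).
have [aL aD aM aA] := uact_action (fun n => irr_mod (W n)).
have rest b u : uprj N (ubact W b (u - uinc (uprj N u))) = 0.
  by rewrite uprj_act raddfB /= uincK subrr mulmx0.
have fprj b u : uprj N (f b u) = F b *m uprj N u.
  by rewrite /f raddfD /= uincK rest addr0.
exists f; split.
- split=> [b r u v|a b u|a b u|r u]; rewrite /f.
  + rewrite rest_linear uprj_is_linear mulmxDr -scalemxAr uinc_is_linear.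
    by rewrite linearP scalerDr addrACA.
  + have -> : F (a + b) = F a + F b by apply: (amorphD Fm).
    rewrite mulmxDl raddfD /=.
    by rewrite -[uact (a + b) _]/(uact (a + b) _) aD addrACA.
  + rewrite -/(f b u) fprj; have -> : F (a * b) = F a *m F b by apply: (amorphM Fm).
    rewrite mulmxA; congr (_ + _).
    by rewrite /f [uinc _ + _]addrC addrK; exact: aM.
  + have -> : F (alg B r) = r%:M by apply: (amorphA Fm).
    rewrite mul_scalar_mx linearZ /= aA scalerBr addrC subrK //.
- move=> a; apply/funext => u; rewrite /f Fa -[aact (stg N) a]/(fd_act (stg N) _).
  by rewrite -uinc_act -linearD /= addrC subrK.
- by apply/funext => u; rewrite /f Fg.
Qed.
End Op.

Lemma uop_fin N A : exists n, mass_stage n (@uop N A).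
Proof. by exists N; exact: uop_stage. Qed.

Definition umass N A (hA : @fdmass R AV (stg N) A) : mass W :=
  Mass (uop_fin A) (uop_rep hA).
End Stages.

Section MassSpace.
Variables (R : realType) (AV : superalgebra R).
Local Notation B := (stensor (Cl R 0 1) AV).
Variable W : nat -> irrmod B.
Local Notation U := (univ W).
Local Notation dW k := (fd_dim (irr_mod (W k))).
Local Notation stg := (stg W).
Implicit Types M L : mass W.

Lemma linear_fun_eq (V : lmodType R) (f g : {linear V -> V}) : f =1 g -> f = g.
Proof.
case: f g => f [[f1] [f2]] [g [[g1] [g2]]] /= /funext E.
by case: _ / E in g1 g2 *; rewrite (Prop_irrelevance f1 g1) (Prop_irrelevance f2 g2).
Qed.

Lemma mass_eq M L : (forall u, M u = L u) -> M = L.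
Proof.
case: M L => f f1 f2 [g g1 g2] /= /linear_fun_eq E.
by case: _ / E in g1 g2 *; rewrite (Prop_irrelevance f1 g1) (Prop_irrelevance f2 g2).
Qed.

Lemma mass_stageS N n M : (N <= n)%N -> mass_stage N M -> mass_stage n M.
Proof.
move=> Nn [h1 h2]; split=> u un; last first.
  by apply: h2 => k kN; apply: un; exact: leq_trans kN Nn.
pose v := uinc (uprj N u).
have -> : M u = M v + mass0 W (u - v).
  by rewrite -(h2 (u - v)); [rewrite -raddfD addrC subrK|exact: utail_rest].
move=> k nk; rewrite ucompD ucomp_act ucompB un // (uinc_stage _ (leq_trans Nn nk)) subrr mulmx0.
by rewrite (h1 v (uinc_stage _)) ?addr0 //; exact: leq_trans Nn nk.
Qed.

Lemma uop_ublock N M u : mass_stage N M -> uop (ublock N M) u = M u.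
Proof.
move=> [h1 h2]; rewrite /uop -ublockE -(h2 _ (utail_rest u)) uinc_uprj.
  by rewrite -raddfD /= addrC subrK.
by apply: h1; exact: uinc_stage.
Qed.

Lemma mass_sq M u : M (M u) = u.
Proof.
have [f [[_ _ fM fA] _ fm]] := mass_rep M.
rewrite -fm -fM -[mass_gen AV]/(clg AV (inr ord0 : ('I_0 + 'I_1)%type)) clg_sq fA.
exact: scale1r.
Qed.

Lemma mass_anti M d a u : homog d a ->
  ubact W (st_inr _ a) (M u) = (-1) ^+ d *: M (ubact W (st_inr _ a) u).
Proof.
move=> ad; have [f [[fL fD fM fA] fa fm]] := mass_rep M.
rewrite -fm -fa -!fM -[mass_gen AV]/(clg AV (inr ord0 : ('I_0 + 'I_1)%type)).
by rewrite (clg_swap _ ad) -alg_sign fM fA.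
Qed.

Lemma ublock_mass N M : mass_stage N M -> @fdmass R AV (stg N) (ublock N M).
Proof.
move=> hM; split=> [|d a ad]; apply: mulmx_cV => x.
  rewrite -mulmxA -ublockE -ublockE mul1mx uinc_uprj; last by apply: (proj1 hM); exact: uinc_stage.
  by rewrite mass_sq uincK.
rewrite -mulmxA -scalemxAl -mulmxA -!ublockE -[aact _ a]/(fd_act _ _) -uprj_act (mass_anti _ _ ad).
by rewrite linearZ /= uinc_act.
Qed.

Lemma umass_ublock N M (hM : mass_stage N M) hA :
  @umass R AV W N (ublock N M) hA = M.
Proof. by apply: mass_eq => u; exact: uop_ublock. Qed.

Lemma umass_stage N A hA : mass_stage N (@umass R AV W N A hA).
Proof. exact: uop_stage. Qed.

Lemma ublock_umass N A hA : ublock N (@umass R AV W N A hA) = A.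
Proof. exact: ublock_uop. Qed.

(** An open set of the limit topology is tested on its trace on the one stage that contains the
    path. *)
Lemma umass_continuous N (p : R -> 'M[R]_(fd_dim (stg N))) (hp : forall t, fdmass (p t)) :
  continuous p -> continuous (fun t => umass (hp t)).
Proof.
move=> pc t O [Q [Qo Qt sO]].
have [P Po E] := Qo N.
have PE r : P (p r) -> O (umass (hp r)).
  move=> Pr; apply: sO.
  suff : ([set M : mass W | mass_stage N M] `&` Q) (umass (hp r)) by case.
  by rewrite E; split; [exact: umass_stage|rewrite /= ublock_umass].
have Pt : P (p t).
  suff : ([set M : mass W | mass_stage N M] `&` [set M : mass W | P (ublock N M)]) (umass (hp t)).
    by case=> _; rewrite /= ublock_umass.
  by rewrite -E; split; [exact: umass_stage|].
have : nbhs (p t) P by exact: open_nbhs_nbhs.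
by move=> /pc h; exact: (@filterS _ (nbhs t) _ (p @^-1` P) _ PE h).
Qed.

Lemma uinc_cvg (T : Type) (F : set_system T) (FF : Filter F) n
    (f : T -> 'cV[R]_(fd_dim (stg n))) l k (a : 'I_(dW k)) :
  f x @[x --> F] --> l -> uinc (f x) k a 0 @[x --> F] --> uinc l k a 0.
Proof.
move=> fl; under eq_fun do rewrite ucompI; rewrite ucompI /uinc_comp.
case: pselect => [h|_]; last by under eq_fun do rewrite mxE; rewrite ?mxE; exact: cvg_cst.
have sE (y : 'cV[R]_(fd_dim (stg n))) :
  submxcol y (Ordinal h) a 0 = y (tagnat.Rank (Ordinal h) a) 0 by rewrite mxE.
suff : f x (tagnat.Rank (Ordinal h) a) 0 @[x --> F] --> l (tagnat.Rank (Ordinal h) a) 0.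
  have -> : (fun x => f x (tagnat.Rank (Ordinal h) a) 0) =
      (fun x => submxcol (f x) (Ordinal h) a 0) by apply/funext => x; rewrite sE.
  by rewrite -sE.
by move/mx_cvgP: fl; exact.
Qed.

Lemma uop_cvg (T : Type) (F : set_system T) (FF : Filter F) n
    (f : T -> 'M[R]_(fd_dim (stg n))) A (b : U) k (a : 'I_(dW k)) :
  f x @[x --> F] --> A -> uop (f x) b k a 0 @[x --> F] --> uop A b k a 0.
Proof.
move=> fA; have e (C : 'M[R]_(fd_dim (stg n))) :
    uop C b k a 0 = uinc (C *m uprj n b) k a 0 + mass0 W (b - uinc (uprj n b)) k a 0.
  by rewrite /uop ucompD mxE.
under eq_fun do rewrite e; rewrite ?e.
apply: cvgD; last exact: cvg_cst.
by apply: uinc_cvg; apply: mx_cvgM => //; exact: mx_cvg_cst.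
Qed.

Lemma ublock_uop_cvg (T : Type) (F : set_system T) (FF : Filter F) N n
    (f : T -> 'M[R]_(fd_dim (stg n))) A :
  f x @[x --> F] --> A -> ublock N (uop (f x)) @[x --> F] --> ublock N (uop A).
Proof.
move=> fA; apply/mx_cvgP => i j.
by under eq_fun do rewrite mxE mxE; rewrite mxE mxE; exact: uop_cvg.
Qed.

(** On stage [n] a mass is recovered from its block [ublock n] by [uop], so [ublock N] is there a
    continuous function of [ublock n]. *)
Lemma ublock_continuous N : continuous (fun M : mass W => ublock N M).
Proof.
move=> M P; rewrite nbhsE => -[Q [Qo QM] sQ].
exists [set L : mass W | Q (ublock N L)]; split=> [n|//|L /= /sQ//].
exists [set A : 'M[R]_(fd_dim (stg n)) | Q (ublock N (@uop R AV W n A))].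
  apply: (@open_comp _ _ (fun A : 'M[R]_(fd_dim (stg n)) => ublock N (@uop R AV W n A))) => //.
  by move=> A _; exact: (@ublock_uop_cvg _ (nbhs A) (nbhs_filter A) N n id A cvg_id).
apply/seteqP; split=> L /= [hL].
  have -> : ublock N L = ublock N (@uop R AV W n (ublock n L)); last by [].
  by congr ublock; apply/funext => u; rewrite uop_ublock.
have -> : ublock N (@uop R AV W n (ublock n L)) = ublock N L; last by [].
by congr ublock; apply/funext => u; rewrite uop_ublock.
Qed.
End MassSpace.

Lemma continuous_funcomp (T1 T2 T3 : topologicalType) (f : T1 -> T2) (g : T2 -> T3) :
  continuous f -> continuous g -> continuous (fun x => g (f x)).
Proof. by move=> fc gc x; exact: continuous_comp (fc x) (gc _). Qed.

Section FdJoin.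
Variables (R : realType) (AV : superalgebra R) (X : fdmod (stensor (Cl R 0 1) AV)).
Implicit Types M L N : 'M[R]_(fd_dim X).

Lemma fdjoin_sym M L : fdjoin M L -> fdjoin L M.
Proof.
move=> [p [pc hp p0 p1]]; exists (fun t => p (1 - t)); split=> //.
- apply: (continuous_funcomp _ pc) => t.
  by apply: cvgB; [exact: cvg_cst|exact: cvg_id].
- by rewrite subr0.
- by rewrite subrr.
Qed.

Lemma fdjoin_trans M L N : fdjoin M L -> fdjoin L N -> fdjoin M N.
Proof.
move=> [p [pc hp p0 p1]] [r [rc hr r0 r1]].
have c0 (t : R) : t <= 0 -> clamp t = 0.
  by move=> t0; rewrite /clamp (min_r (le_trans t0 ler01)) (max_l t0).
have c1 (t : R) : 1 <= t -> clamp t = 1.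
  by move=> t1; rewrite /clamp (min_l t1) (max_r ler01).
(* At every t one of the two path terms equals [L], so the concatenation is a single formula and
   needs no gluing. *)
pose h t := p (clamp (2 * t)) + r (clamp (2 * t - 1)) - L.
have hE t : h t = p (clamp (2 * t)) \/ h t = r (clamp (2 * t - 1)).
  have [t1|/ltW t1] := leP (2 * t) 1.
    by left; rewrite /h (c0 (_ - 1)) ?subr_le0 // r0 addrK.
  by right; rewrite /h (c1 _ t1) p1 addrC addKr.
have c2 : continuous (fun t : R => clamp (2 * t)).
  apply: (continuous_funcomp _ (@clamp_continuous R)) => t.
  by apply: cvgM; [exact: cvg_cst|exact: cvg_id].
have c3 : continuous (fun t : R => clamp (2 * t - 1)).
  apply: (continuous_funcomp _ (@clamp_continuous R)) => t.
  by apply: cvgB; [apply: cvgM; [exact: cvg_cst|exact: cvg_id]|exact: cvg_cst].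
have pc2 : continuous (fun t : R => p (clamp (2 * t))).
  exact: continuous_funcomp c2 pc.
have rc2 : continuous (fun t : R => r (clamp (2 * t - 1))).
  exact: continuous_funcomp c3 rc.
exists h; split.
- move=> t; apply: mx_cvgD; last exact: mx_cvg_cst.
  by apply: mx_cvgD; [exact: pc2|exact: rc2].
- by move=> t; case: (hE t) => ->.
- by rewrite /h mulr0 (c0 0) // (c0 (0 - 1)) ?sub0r ?oppr_le0 ?ler01 // p0 r0 addrK.
- rewrite /h mulr1 (c1 2) ?ler1n // (c1 (2 - 1)) ?p1 ?r1; first by rewrite addrC addKr.
  by rewrite lerBrDr -[1 + 1]/(2%:R).
Qed.
End FdJoin.

(** * Paths of masses and path components *)

Section MassPaths.
Variables (R : realType) (AV : superalgebra R).
Local Notation B := (stensor (Cl R 0 1) AV).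
Variable W : nat -> irrmod B.
Local Notation U := (univ W).
Local Notation stg := (stg W).
Implicit Types M L : mass W.

Lemma path_of_fdjoin N A C hA hC :
  @fdjoin R AV (stg N) A C -> path_joined (@umass R AV W N A hA) (@umass R AV W N C hC).
Proof.
move=> [p [pc hp p0 p1]]; exists (fun t => umass (hp t)); split.
- by apply: continuous_subspaceT; exact: umass_continuous.
- by apply: mass_eq => u; rewrite /= p0.
- by apply: mass_eq => u; rewrite /= p1.
Qed.

Lemma path_of_stage N M L : mass_stage N M -> mass_stage N L ->
  @fdjoin R AV (stg N) (ublock N M) (ublock N L) -> path_joined M L.
Proof.
move=> hM hL j.
have := path_of_fdjoin (ublock_mass hM) (ublock_mass hL) j.
by rewrite !umass_ublock.
Qed.

Lemma near_neq m n (A C : 'M[R]_(m, n)) : A <> C -> \forall D \near A, D <> C.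
Proof.
move=> AC; have [i [j ij]] : exists i j, A i j != C i j.
  apply: contrapT => h; apply: AC; apply/matrixP => i j; apply: contrapT => ij.
  by apply: h; exists i, j; apply/eqP.
have h : nbhs (A i j) (fun z : R => z != C i j).
  by apply: open_nbhs_nbhs; split=> //; exact: open_neq.
have /(_ _ h) := @coord_continuous R m n i j A.
apply: (@filterS _ (nbhs A) _ (fun D : 'M[R]_(m, n) => D i j != C i j)) => D /eqP Dij DC.
by apply: Dij; rewrite DC.
Qed.

(* If f met masses f (s n) outside every stage n, the complements O n of the tails of this
   sequence would be an increasing open cover of the compact path. *)
Lemma one_stage (f : R -> mass W) : continuous f ->
  exists N, forall t, 0 <= t <= 1 -> mass_stage N (f t).
Proof.
move=> fc; apply: contrapT => nh.
have /choice[s sP] : forall n, exists t : R, 0 <= t <= 1 /\ ~ mass_stage n (f t).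
  move=> n; apply: contrapT => h; apply: nh; exists n => t t01.
  by apply: contrapT => ht; apply: h; exists t.
pose O n := [set M : mass W | forall k, (n <= k)%N -> M <> f (s k)].
have Oo n : mass_open (O n).
  (* On stage [j] only the finitely many k < j impose a condition: for j <= k the mass [f (s k)]
     lies outside stage k, hence outside stage j. *)
  move=> j; pose S := [set A : 'M[R]_(\sum_(k < j) fd_dim (W k)) | forall k : 'I_j,
    (n <= k)%N -> mass_stage j (f (s k)) -> A <> ublock j (f (s k))].
  exists S.
    rewrite openE => A SA; apply: (@filter_forall _ _ (fun (k : 'I_j)
      (D : 'M[R]_(\sum_(k < j) fd_dim (W k))) =>
      (n <= k)%N -> mass_stage j (f (s k)) -> D <> ublock j (f (s k))) (nbhs A)) => k.
    have [nk|nk] := pselect ((n <= k)%N /\ mass_stage j (f (s k))); last first.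
      by apply: nearW => D k1 k2; case: nk.
    case: nk => nk sk; apply: filterS (near_neq (SA k nk sk)) => D DC _ _; exact: DC.
  apply/seteqP; split=> M /= [jM h]; split=> //.
    move=> k nk sk MC; apply: (h k nk); apply: mass_eq => u.
    by rewrite -(uop_ublock u jM) -(uop_ublock u sk) MC.
  move=> k nk Mk; have sk : mass_stage j (f (s k)) by rewrite -Mk.
  have [jk|kj] := leqP j k; first exact: (proj2 (sP k) (mass_stageS jk sk)).
  by apply: (h (Ordinal kj)) => //; rewrite Mk.
have OS n k M : (n <= k)%N -> O n M -> O k M.
  by move=> nk h l kl; apply: h; exact: leq_trans nk kl.
have Oin M : exists n, O n M.
  have [j jM] := mass_fin M; exists j => k jk Mk.
  by apply: (proj2 (sP k)); rewrite -Mk; exact: mass_stageS jM.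
have [] : exists n, forall t, 0 <= t <= 1 -> O n (f t).
  have : \forall n \near \oo, `[0%R, 1%R] `<=` (fun t => O n (f t)).
    have /compact_near_coveringP cov := @segment_compact R 0 1; apply: cov => t _.
     have [n On] := Oin (f t).
    have ft : nbhs (f t) (O n) by exists (O n); split; [exact: Oo|exact: On|].
    exists (f @^-1` (O n), [set k | (n <= k)%N]).
      by split; [exact: fc ft|exists n].
    by case=> r k [/= Or nk]; exact: OS Or.
  case=> n _ /(_ n (leqnn n)) h; exists n => t t01; apply: h.
  by rewrite /= in_itv.
move=> n h; have [t01 _] := sP n; exact: (h _ t01 n (leqnn n)).
Qed.

Lemma path_stage M L : path_joined M L -> exists N, forall n, (N <= n)%N ->
  [/\ mass_stage n M, mass_stage n L & @fdjoin R AV (stg n) (ublock n M) (ublock n L)].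
Proof.
move=> [g [gc g0 g1]]; pose f t := g (clamp t).
have fc : continuous f.
  move=> t; have /subspace_continuousP h := gc.
  have ct : `[0%R, 1%R]%classic (clamp t) by rewrite /= in_itv; exact: clamp_itv.
  apply: cvg_comp (h _ ct) => P wP.
  have := @clamp_continuous R t _ wP; apply: (@filterS _ (nbhs t)) => r; apply.
  by rewrite /= in_itv; exact: clamp_itv.
have [N hN] := one_stage fc.
have f01 t : f (clamp t) = f t by rewrite /f (clamp_id (clamp_itv t)).
have fN t : mass_stage N (f t) by rewrite -f01; apply: hN; exact: clamp_itv.
have f0 : f 0 = M by rewrite /f clamp_id ?lexx ?ler01.
have f1 : f 1 = L by rewrite /f clamp_id ?lexx ?ler01.
exists N => n Nn; have fn t : mass_stage n (f t) by exact: mass_stageS (fN t).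
split; [by rewrite -f0|by rewrite -f1|].
exists (fun t => ublock n (f t)); split; rewrite ?f0 ?f1 //.
- exact: continuous_funcomp fc (@ublock_continuous R AV W n).
- by move=> t; exact: ublock_mass.
Qed.

Lemma path_refl M : path_joined M M.
Proof. by exists (fun=> M); split=> //; apply: continuous_subspaceT => t; exact: cvg_cst. Qed.

Lemma path_sym M L : path_joined M L -> path_joined L M.
Proof.
move=> /path_stage[N /(_ N (leqnn N))[hM hL j]].
by apply: (path_of_stage hL hM); exact: fdjoin_sym.
Qed.

Lemma path_trans M L K : path_joined M L -> path_joined L K -> path_joined M K.
Proof.
move=> /path_stage[N hN] /path_stage[N' hN'].
have [h1 h2 j] := hN _ (leq_maxl N N'); have [_ h3 j'] := hN' _ (leq_maxr N N').
by apply: (path_of_stage h1 h3); exact: fdjoin_trans j j'.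
Qed.

Lemma pi0_ofP M L : pi0_of M = pi0_of L <-> path_joined M L.
Proof.
split=> [/(congr1 (@proj1_sig _ _)) /= h|ML].
  by rewrite h; exact: path_refl.
have E : path_joined M = path_joined L.
  apply/seteqP; split=> K; first exact: path_trans (path_sym ML).
  exact: path_trans ML.
exact: eq_exist.
Qed.

Lemma pi0_ofE (P : pi0 W) : exists M, P = pi0_of M.
Proof.
by case: P => P [M E]; exists M; exact: eq_exist.
Qed.
End MassPaths.

(** * The class of the negative spectral subspace as an invariant of paths *)

Section Invariant.
Variables (R : realType) (AV : superalgebra R).
Local Notation B := (stensor (Cl R 0 1) AV).
Local Notation B2 := (stensor (Cl R 0 2) AV).
Hypothesis AV_decomp :
  forall a : AV, exists a0 a1, [/\ homog false a0, homog true a1 & a = a0 + a1].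
Hypothesis ad1 : forall X : fdmod B, exists Y : fdmod B, fd_iso X Y /\ adapted Y.
Hypothesis ad2 : forall X : fdmod B2, exists Y : fdmod B2, fd_iso X Y /\ adapted Y.

Lemma posdD_scalar n (A : 'M[R]_n) r : posd A -> 0 <= r -> posd (A + r%:M).
Proof.
move=> Ap r0; apply: posdD => //; first by rewrite tr_scalar_mx.
by move=> v; rewrite mul_mx_scalar -scalemxAl mxE mulr_ge0 // dot_self_ge0.
Qed.

Lemma clext_split (X : fdmod B) (g J : 'M[R]_(fd_dim X)) Z w z : @splits R B X g Z w z ->
  acomm J -> J *m mact X = - (mact X *m J) -> J *m J = - g -> J *m g = g *m J ->
  clext (z *m J *m w).
Proof.
move=> [iw iz zw wz] Ja Jm JJ Jg.
have wE : mact X *m w = w *m mact Z by apply/esym/iw.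
have zE : mact Z *m z = z *m mact X by apply/esym/iz.
have waE a : aact X a *m w = w *m aact Z a by apply/esym/iw.
have zaE a : aact Z a *m z = z *m aact X a by apply/esym/iz.
split.
- by move=> d a ad; rewrite !mulmxA zaE -!mulmxA -waE !mulmxA -(mulmxA z) (Ja _ _ ad) !mulmxA.
- rewrite !mulmxA zE -!mulmxA -wE (mulmxA J) Jm mulNmx mulmxN; congr (- _).
  by rewrite !mulmxA.
- have zg : z *m g = z by rewrite -wz mulmxA zw mul1mx.
  rewrite !mulmxA -(mulmxA _ w z) wz -(mulmxA z) Jg mulmxA zg -(mulmxA z) JJ.
  by rewrite mulmxN zg mulNmx zw; apply/matrixP=> i j; rewrite !mxE mulNrn.
Qed.

Lemma involutions_commutator n (a c : 'M[R]_n) : a *m a = 1%:M -> c *m c = 1%:M ->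
  let K := a *m c - c *m a in let s := a *m c + c *m a in
  [/\ K *m c = - (c *m K), K *m s = s *m K & K *m K = (s + 2%:M) *m (s - 2%:M)].
Proof.
move=> aa cc /=.
have e1 : a *m c *m (c *m a) = 1%:M by rewrite mulmxA -(mulmxA a) cc mulmx1.
have e2 : c *m a *m (a *m c) = 1%:M by rewrite mulmxA -(mulmxA c) aa mulmx1.
split.
- by rewrite mulmxBl mulmxBr !mulmxA cc mul1mx -(mulmxA a) cc mulmx1 opprB.
- rewrite !(mulmxDl, mulmxDr, mulmxN, mulNmx) e1 e2.
  by apply/matrixP=> i j; rewrite !mxE; ring.
- rewrite !(mulmxDl, mulmxDr, mulmxN, mulNmx) !(mul_mx_scalar, mul_scalar_mx) e1 e2.
  by apply/matrixP=> i j; rewrite !mxE; ring.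
Qed.

Lemma commuting_sq n (a b c : 'M[R]_n) : a *m b = b *m a -> a *m c = c *m a ->
  c *m b = b *m c -> c *m c = c ->
  a *m b *m c *m (a *m b *m c) = a *m a *m (b *m b) *m c.
Proof.
move=> ab ac cb cc; rewrite -!mulmxA; congr (_ *m _).
by rewrite (mulmxA c a) -ac -(mulmxA a c) (mulmxA c b) cb -(mulmxA b c) cc (mulmxA b a) -ab -mulmxA.
Qed.

Section Indep.
Variables (X : fdmod B) (Xa : adapted X) (Q : 'M[R]_(fd_dim X)).
Hypotheses (hQ : fdmass Q) (Qs : Q^T = Q).
Variables (t t' : R).
Hypotheses (tu : shifted Q t \in unitmx) (tu' : shifted Q t' \in unitmx) (tt' : t <= t').
Hypotheses (tl : -2 < t) (tr : t' < 2).
Local Notation s := (acommutator Q).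
Local Notation m := (mact X).
Local Notation sg := (sgn Q t).
Local Notation sg' := (sgn Q t').

Local Opaque acommutator.

(** Up to a factor 4, [f] is the product of the spectral projections onto s < t and s > t'. It
    vanishes as t <= t', and its expansion is the claim. *)
Lemma sgn_mul : sg *m sg' = 1%:M + sg' - sg.
Proof.
have b1 := sgn_bicom Xa Qs tu; have b2 := sgn_bicom Xa Qs tu'.
have c := bicomC b1 b2; have q1 := sgn_sq Xa Qs tu; have q2 := sgn_sq Xa Qs tu'.
have [p1 _] := sabsP Xa Qs tu; have [p2 _] := sabsP Xa Qs tu'.
have := s_sgnN Xa Qs tu (k := fd_dim X); have := s_sgn Xa Qs tu' (k := fd_dim X).
move: b1 b2 c q1 q2 p1 p2; move: (sgn Q t) (sgn Q t') (sabs Q t) (sabs Q t') => g g' b b'.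
move=> b1 b2 c q1 q2 p1 p2 h' h.
pose f := (1%:M - g) *m (1%:M + g').
have gf : g *m f = - f.
  by rewrite /f mulmxA mulmxBr q1 mulmx1 -mulNmx opprB.
have gf' : g' *m f = f.
  rewrite /f mulmxA (_ : g' *m (1%:M - g) = (1%:M - g) *m g'); last first.
    by rewrite mulmxBr mulmxBl c mulmx1 mul1mx.
  by rewrite -mulmxA; congr (_ *m _); rewrite mulmxDr mulmx1 q2 addrC.
have f0 : f = 0.
  have pp : posd (b + b' + (t' - t)%:M) by apply: posdD_scalar; [exact: posdDp|rewrite subr_ge0].
  rewrite -(mulKmx (posd_unit pp) f) (_ : _ *m f = 0) ?mulmx0 //.
  have /eqP := h' _ gf'; rewrite (h _ gf) -subr_eq0 -mulmxBl => /eqP e.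
  rewrite -[RHS]oppr0 -[in RHS]e -mulNmx; congr (_ *m _).
  by apply/matrixP=> i j; rewrite !mxE; move: (i == j) => [] /=; ring.
move: f0; rewrite /f mulmxBl mul1mx mulmxDr mulmx1 => /eqP; rewrite opprD addrA subr_eq0 => /eqP <-.
by [].
Qed.

(* The two splittings differ by the spectral subspace of [acommutator Q] between t and t',
   where |s| < 2; there K = [Q, m] satisfies K^2 = s^2 - 4 < 0, and K / sqrt(4 - s^2)
   extends the action to Cl^{0,2}. *)
Lemma sgn_algcls Y u v Y' u' v' : @splits R B X (negproj sg) Y u v ->
  @splits R B X (negproj sg') Y' u' v' -> algcls Y = algcls Y'.
Proof.
have b1 := sgn_bicom Xa Qs tu; have b2 := sgn_bicom Xa Qs tu'.
have c := bicomC b1 b2; have q1 := sgn_sq Xa Qs tu; have q2 := sgn_sq Xa Qs tu'.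
have [p1 _] := sabsP Xa Qs tu; have [p2 _] := sabsP Xa Qs tu'.
have bb := sabs_bicom Xa Qs tu; have bb' := sabs_bicom Xa Qs tu'.
have gg := sgn_mul.
have h := @s_sgn R AV X Xa Q Qs t tu (fd_dim X); have h' := @s_sgnN R AV X Xa Q Qs t' tu' (fd_dim X).
move: b1 b2 c q1 q2 p1 p2 bb bb' gg h h'; move: (sgn Q t) (sgn Q t') (sabs Q t) (sabs Q t') => g g' b b'.
move=> b1 b2 c q1 q2 p1 p2 bb bb' gg h h' sp sp'.
pose d : 'M[R]_(fd_dim X) := 2^-1 *: (g - g').
have dd : d *m d = d.
  rewrite /d -scalemxAl -scalemxAr mulmxBr !mulmxBl q1 q2 -c gg.
  by apply/matrixP=> i j; rewrite !mxE; field.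
have ed : negproj g *m d = 0.
  rewrite /d /negproj -scalemxAl -scalemxAr mulmxBl mul1mx mulmxBr q1 gg.
  by apply/matrixP=> i j; rewrite !mxE; field.
have de : d *m negproj g = 0.
  rewrite /d /negproj -scalemxAl -scalemxAr mulmxBr mulmx1 mulmxBl q1 -c gg.
  by apply/matrixP=> i j; rewrite !mxE; field.
have eE : negproj g' = negproj g + d.
  by rewrite /d /negproj; apply/matrixP=> i j; rewrite !mxE; field.
have bd : bicom s d by apply/bicomZ/bicomD => //; exact: bicomN.
have id_ : @intertw R B X X d by apply: bicom_intertw bd.
have [Z [w [z [iw iz zw wz]]]] := split_idempotent id_ dd.
have sZ : @splits R B X d Z w z by split.
rewrite eE in sp'; rewrite (algcls_iso AV_decomp ad1 (splits_add ed de sp sZ sp')).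
rewrite (algclsD AV_decomp ad1).
suff [J hJ] : exists J, @clext R AV Z J by rewrite (algcls_clext AV_decomp ad1 ad2 hJ) addr0.
(* On the image of [d], [P1] agrees with s + 2 and [P2] with 2 - s; but they are positive definite
   on all of [X], so their roots exist and are invertible without restricting to that image. *)
pose P1 : 'M[R]_(fd_dim X) := b + (t + 2)%:M; pose P2 : 'M[R]_(fd_dim X) := b' + (2 - t')%:M.
have P1p : posd P1 by apply: posdD_scalar => //; rewrite -lerBlDr sub0r ltW.
have P2p : posd P2 by apply: posdD_scalar => //; rewrite subr_ge0 ltW.
have P1b : bicom s P1 by apply: bicomD => //; exact: bicom_scalar.
have P2b : bicom s P2 by apply: bicomD => //; exact: bicom_scalar.
have gd : g *m d = d.
  rewrite /d -scalemxAr mulmxBr q1 gg.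
  by apply/matrixP=> i j; rewrite !mxE; field.
have g'd : g' *m d = - d.
  rewrite /d -scalemxAr mulmxBr q2 -c gg.
  by apply/matrixP=> i j; rewrite !mxE; field.
have e1 : (s + 2%:M) *m d = P1 *m d.
  have -> : P1 = b + t%:M + 2%:M by rewrite /P1 raddfD /= addrA.
  by rewrite mulmxDl (h _ gd) [RHS]mulmxDl.
have e2 : (2%:M - s) *m d = P2 *m d.
  have -> : P2 = 2%:M - (t'%:M - b') by rewrite /P2 raddfB /= opprB addrCA.
  by rewrite mulmxBl (h' _ g'd) [RHS]mulmxBl.
have [S1p S1E] := sqrtmP P1p; have [S2p S2E] := sqrtmP P2p.
set S1 := sqrtm P1 in S1p S1E; set S2 := sqrtm P2 in S2p S2E.
have S1u := posd_unit S1p; have S2u := posd_unit S2p.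
have S1b : bicom s S1 by apply: bicom_sqrt => //; rewrite S1E.
have S2b : bicom s S2 by apply: bicom_sqrt => //; rewrite S2E.
(* On the image of [d] this is the inverse square root of 4 - s^2. *)
pose r := invmx S1 *m invmx S2.
have rb : bicom s r by apply: bicomM; exact: bicomV.
have rr : r *m r *m (P1 *m P2) = 1%:M.
  have cS : S1 *m S2 = S2 *m S1 := bicomC S1b S2b.
  have rS : r *m (S1 *m S2) = 1%:M by rewrite cS /r mulmxA mulmxKV // mulVmx.
  have -> : P1 *m P2 = S1 *m S2 *m (S1 *m S2).
    by rewrite -S1E -S2E -!mulmxA; congr (_ *m _); rewrite !mulmxA cS.
  by move: r (S1 *m S2) rS {rb} => r0 T rT; rewrite mulmxA -(mulmxA r0 r0) rT mulmx1.
pose K := Q *m m - m *m Q.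
have [QQ _] := hQ; have mm_ := mm X.
have Ka : acomm K.
  by apply: acommD; [|apply: acommN]; apply: fdmassM => //; exact: fdmass_mact.
have [Km Ks KK] := involutions_commutator QQ mm_.
rewrite -[Q *m m - _]/K -[Q *m m + _]/(acommutator Q) in Km Ks KK.
have Kr : K *m r = r *m K by apply: rb.
have Kd : K *m d = d *m K by apply: bd.
have dr : d *m r = r *m d := bicomC bd rb.
exists (z *m (K *m r *m d) *m w); apply: (clext_split sZ).
- apply: acommM; first apply: acommM => //.
    by move=> e a ae; apply/esym/rb; apply/esym; exact: (s_acomm hQ) ae.
  by move=> e a ae; apply/esym/bd; apply/esym; exact: (s_acomm hQ) ae.
- have mr : m *m r = r *m m by apply/rb/s_m.
  have md : m *m d = d *m m by apply/bd/s_m.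
  by rewrite -mulmxA -md mulmxA -(mulmxA K) -mr mulmxA Km !mulNmx -!mulmxA.
- rewrite (commuting_sq Kr Kd dr dd) KK.
  have sb a : bicom s (s + a%:M) by apply: bicomD; [exact: bicom_id|exact: bicom_scalar].
  have sb2 : bicom s (s - 2%:M) by apply: bicomD; [exact: bicom_id|apply/bicomN/bicom_scalar].
  have -> : (s + 2%:M) *m (s - 2%:M) *m (r *m r) = r *m r *m ((s + 2%:M) *m (s - 2%:M)).
    by apply: bicomC; apply: bicomM.
  have e3 : (s - 2%:M) *m d = - (P2 *m d) by rewrite -e2 -mulNmx opprB.
  have e4 : (s + 2%:M) *m (P2 *m d) = P1 *m P2 *m d.
    by rewrite mulmxA (bicomC (sb 2) P2b) -mulmxA e1 mulmxA (bicomC P2b P1b).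
  move: (r *m r) rr e3 e4 => r2 rr e3 e4.
  by rewrite -(mulmxA r2) -(mulmxA _ _ d) e3 mulmxN e4 mulmxN mulmxA rr mul1mx.
- move: r Kr dr {rb rr} => r Kr dr.
  by rewrite !mulmxA -(mulmxA _ d d) dd -Kd -(mulmxA K d) dr mulmxA -(mulmxA _ d d) dd.
Qed.
End Indep.

Section Class.
Variables (X : fdmod B) (Xa : adapted X).
Local Notation n := (fd_dim X).
Local Notation m := (mact X).
Implicit Types M Q : 'M[R]_n.

(** A relation rather than a function, with any regular [t] allowed; that all choices give the same
    class is [mass_inv_fun]. *)
Definition mass_inv M x := exists (t : R) Y u v, [/\ -2 < t, t < 2, shifted (porth M) t \in unitmx,
  @splits R B X (negproj (sgn (porth M) t)) Y u v & algcls Y = x].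

Lemma mass_inv_fun M x y : fdmass M -> mass_inv M x -> mass_inv M y -> x = y.
Proof.
move=> hM [t [Y [u [v [tl tr tu sp <-]]]]] [t' [Y' [u' [v' [tl' tr' tu' sp' <-]]]]].
have hQ := porth_mass Xa hM; have Qs := porth_sym hM.
have [tt'|/ltW t't] := leP t t'.
  by apply: sgn_algcls sp sp'.
by apply: esym; apply: sgn_algcls sp' sp.
Qed.

(** The n + 1 points k / (n + 1) of [0, 1) cannot all be roots of a characteristic polynomial of
    degree n. *)
Lemma regular_ex Q : exists t, [/\ -2 < t, t < 2 & shifted Q t \in unitmx].
Proof.
pose r := [seq (k%:R / n.+1%:R : R) | k <- iota 0 n.+1].
have ru : uniq r.
  rewrite map_inj_uniq ?iota_uniq // => k l /(mulIf _) kl; apply/eqP.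
  by rewrite -(eqr_nat R) kl // invr_eq0 pnatr_eq0.
have : ~~ all (root (char_poly (acommutator Q))) r.
  apply/negP => ra; have := max_poly_roots (monic_neq0 (char_poly_monic _)) ra ru.
  by rewrite size_char_poly size_map size_iota ltnn.
case/allPn => t /mapP[k]; rewrite mem_iota add0n => /andP[_ kn] -> kr.
have t0 : 0 <= (k%:R / n.+1%:R : R) by rewrite divr_ge0.
have t1 : (k%:R / n.+1%:R : R) < 1 by rewrite ltr_pdivrMr ?ltr0n // mul1r ltr_nat.
exists (k%:R / n.+1%:R); split.
- by apply: lt_le_trans t0; rewrite oppr_lt0 ltr0n.
- by apply: lt_trans t1 _; rewrite ltr1n.
- move: kr; rewrite -eigenvalue_root_char /eigenvalue negbK /eigenspace kermx_eq0.
  by rewrite row_free_unit.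
Qed.

Lemma mass_inv_ex M : fdmass M -> exists x, mass_inv M x.
Proof.
move=> hM; have hQ := porth_mass Xa hM; have Qs := porth_sym hM.
have [t [tl tr tu]] := regular_ex (porth M).
have ie := negproj_intertw (sgn_intertw AV_decomp Xa hQ Qs tu).
have [Y [u [v [iu iv vu uv]]]] := split_idempotent ie (negproj_idem (sgn_sq Xa Qs tu)).
by exists (algcls Y), t, Y, u, v; split=> //; split.
Qed.

Lemma porth_cvg (T : Type) (F : set_system T) (FF : Filter F) (f : T -> 'M[R]_n) M :
  (forall x, fdmass (f x)) -> fdmass M -> f x @[x --> F] --> M ->
  porth (f x) @[x --> F] --> porth M.
Proof.
move=> hf hM fM; apply: mx_cvgM => //; apply: mx_cvg_sqrt.
- by apply: nearW => x; exact: pabs_posd.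
- exact: pabs_posd.
- have -> : (fun x => pabs (f x) *m pabs (f x)) = (fun x => (f x)^T *m f x).
    by apply/funext => x; exact: pabs_sq.
  by rewrite pabs_sq //; apply: mx_cvgM => //; exact: mx_cvgT.
Qed.

Lemma sgn_cvg (T : Type) (F : set_system T) (FF : Filter F) (f : T -> 'M[R]_n) Q t :
  (forall x, (f x)^T = f x) -> Q^T = Q -> shifted Q t \in unitmx -> f x @[x --> F] --> Q ->
  sgn (f x) t @[x --> F] --> sgn Q t.
Proof.
move=> fs Qs tu fQ.
have sc : shifted (f x) t @[x --> F] --> shifted Q t.
  by apply: mx_cvgD; [apply: mx_cvgD; apply: mx_cvgM => //; exact: mx_cvg_cst|exact: mx_cvg_cst].
have nu := near_unitmx tu sc.
have [Qp QE] := sabsP Xa Qs tu.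
apply: mx_cvgM => //; apply: mx_cvgV; first exact: posd_unit.
apply: mx_cvg_sqrt => //.
  by apply: filterS (nu _) => x xu; exact: proj1 (sabsP Xa (fs x) xu).
rewrite QE; apply: cvg_trans (mx_cvgM sc sc); apply: near_eq_cvg.
by apply: filterS (nu _) => x xu; rewrite (proj2 (sabsP Xa (fs x) xu)).
Qed.

(** The same [t] stays regular nearby, and nearby sign operators have isomorphic negative
    eigenspaces by [negproj_close]. *)
Lemma mass_inv_near (p : R -> 'M[R]_n) r x : continuous p -> (forall t, fdmass (p t)) ->
  mass_inv (p r) x -> \forall r' \near r, mass_inv (p r') x.
Proof.
move=> pc hp [t [Y [u [v [tl tr tu sp Yx]]]]].
have qc : porth (p r') @[r' --> r] --> porth (p r) by apply: porth_cvg => //; exact: pc.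
have qs r' : (porth (p r'))^T = porth (p r') by exact: porth_sym.
have gc : sgn (porth (p r')) t @[r' --> r] --> sgn (porth (p r)) t by exact: sgn_cvg.
have sc : shifted (porth (p r')) t @[r' --> r] --> shifted (porth (p r)) t.
  by apply: mx_cvgD; [apply: mx_cvgD; apply: mx_cvgM => //; exact: mx_cvg_cst|exact: mx_cvg_cst].
have kc : 1%:M + sgn (porth (p r')) t *m sgn (porth (p r)) t @[r' --> r] -->
    1%:M + sgn (porth (p r)) t *m sgn (porth (p r)) t.
  by apply: mx_cvgD; [exact: mx_cvg_cst|apply: mx_cvgM => //; exact: mx_cvg_cst].
(* At the limit point itself the intertwiner is twice the identity. *)
have ku : 1%:M + sgn (porth (p r)) t *m sgn (porth (p r)) t \in unitmx.
  by rewrite sgn_sq //; apply/posd_unit/posdDp; exact: posd1.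
have n1 : \forall r' \near r, shifted (porth (p r')) t \in unitmx by exact: near_unitmx sc.
have n2 : \forall r' \near r, 1%:M + sgn (porth (p r')) t *m sgn (porth (p r)) t \in unitmx.
  exact: near_unitmx kc.
near=> r'.
have tu' : shifted (porth (p r')) t \in unitmx by near: r'.
have ku' : 1%:M + sgn (porth (p r')) t *m sgn (porth (p r)) t \in unitmx by near: r'.
have hq r' := porth_mass Xa (hp r').
have is_ := sgn_intertw AV_decomp Xa (hq r) (qs r) tu.
have is' := sgn_intertw AV_decomp Xa (hq r') (qs r') tu'.
have sq := sgn_sq Xa (qs r) tu; have sq' := sgn_sq Xa (qs r') tu'.
have ie := negproj_intertw is'.
have [Y' [u' [v' [iu iv vu uv]]]] := split_idempotent ie (negproj_idem sq').
have sp' : @splits R B X (negproj (sgn (porth (p r')) t)) Y' u' v' by split.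
exists t, Y', u', v'; split=> //; rewrite -Yx; apply/esym/(algcls_iso AV_decomp ad1).
exact: negproj_close sq sq' is_ is' ku' sp sp'.
Unshelve. all: by end_near. Qed.

(** The parameters with value [x] form an open set, and so do those with another value; the line is
    connected. *)
Lemma mass_inv_const (p : R -> 'M[R]_n) x : continuous p -> (forall t, fdmass (p t)) ->
  mass_inv (p 0) x -> forall r, mass_inv (p r) x.
Proof.
move=> pc hp p0; pose A := [set r | mass_inv (p r) x].
have Ao : open A by rewrite openE => r Ar; exact: mass_inv_near.
have Ac : closed A.
  rewrite -openC openE => r /= Ar; have [y ry] := mass_inv_ex (hp r).
  have xy : y <> x by move=> yx; apply: Ar; rewrite /A /= -yx.
  near=> r'; move=> Ar'; apply: xy; apply: (mass_inv_fun (hp r')) Ar'.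
  by near: r'; exact: mass_inv_near.
have /(_ A) : connected [set: R] by apply/connected_intervalP => a b _ _ c _.
move=> h.
suff AT : A = setT by move=> r; have : A r by rewrite AT.
apply: h; first by exists 0.
- by exists A => //; rewrite setTI.
- by exists A => //; rewrite setTI.
Unshelve. all: by end_near. Qed.

(** As [sg] need not be symmetric, the polar part of [m *m sg] enters: it is [m *m rho] for an
    involution [rho] that commutes with [m]. Then s = 2 rho and t = 0 is regular. Since [rho *m sg]
    is the positive definite matrix [a], the involutions [rho] and [sg] have isomorphic negative
    eigenspaces. *)
Lemma mass_inv_involution sg Y u v : @intertw R B X X sg -> sg *m sg = 1%:M ->
  @splits R B X (negproj sg) Y u v -> mass_inv (m *m sg) (algcls Y).
Proof.
move=> is_ ss sp; have mm_ := mm X; have mT_ := mT Xa.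
have sm : sg *m m = m *m sg := is_ _.
have hM := involution_mass is_ ss.
have hQ := porth_mass Xa hM; have Qs := porth_sym hM.
have ap := pabs_posd hM; have ac := pabs_acomm Xa hM; have asq := pabs_sq hM.
have QE : porth (m *m sg) = pabs (m *m sg) *m (m *m sg) by [].
move: hQ Qs ap ac asq QE; move: (pabs (m *m sg)) => a hQ Qs ap ac asq QE.
have smT : sg^T *m m = m *m sg^T.
  by have := congr1 trmx sm; rewrite !trmx_mul mT_.
have am : m *m a = a *m m.
  apply: sqrt_intertwine => //; rewrite asq.
  have -> : (m *m sg)^T *m (m *m sg) = sg^T *m sg.
    by rewrite trmx_mul mT_ mulmxA -(mulmxA _ m m) mm_ mulmx1.
  by rewrite mulmxA -smT -!mulmxA sm.
pose rho := a *m sg.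
have QmE : porth (m *m sg) = m *m rho by rewrite QE /rho !mulmxA am.
have ir : @intertw R B X X rho.
  by apply: intertwM is_ _; apply: acomm_intertw => //; rewrite am.
have rm : rho *m m = m *m rho := ir _.
have rE : rho = a *m sg by []; clearbody rho.
have rr : rho *m rho = 1%:M.
  by have [+ _] := hQ; rewrite QmE -{1}rm -(mulmxA rho) (mulmxA m m) mm_ mul1mx.
have rT : rho^T = rho.
  have := Qs; rewrite QmE trmx_mul mT_ => e.
  by rewrite -[LHS]mulmx1 -mm_ mulmxA e -rm -mulmxA mm_ mulmx1.
have sE : shifted (porth (m *m sg)) 0 = 2 *: rho.
  rewrite /shifted /acommutator QmE -(mulmxA m rho m) rm (mulmxA m m) mm_ mul1mx.
  by rewrite raddf0 subr0 scaler_nat mulr2n.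
have ru : rho \in unitmx by have [] := mulmx1_unit rr.
have su : shifted (porth (m *m sg)) 0 \in unitmx.
  by rewrite sE unitmxZ // unitfE pnatr_eq0.
have gE : sgn (porth (m *m sg)) 0 = rho.
  have [bp bE] := sabsP Xa Qs su.
  have b2 : sabs (porth (m *m sg)) 0 = 2%:M.
    apply: sqrt_unique => //; first by apply: posd_scalar; rewrite ltr0n.
    by rewrite bE sE -scalemxAl -scalemxAr rr scalerA mul_scalar_mx scalemx1 scale_scalar_mx.
  rewrite /sgn b2 sE invmx_scalar mul_mx_scalar scalerA.
  have -> : (2^-1 * 2 : R) = 1 by field.
  by rewrite scale1r.
have ie := negproj_intertw ir.
have [Y' [u' [v' [iu iv vu uv]]]] := split_idempotent ie (negproj_idem rr).
have sp' : @splits R B X (negproj rho) Y' u' v' by split.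
exists 0, Y', u', v'; split=> //; rewrite ?oppr_lt0 ?ltr0n ?gE //.
apply/esym/(algcls_iso AV_decomp ad1); apply: (negproj_close ss rr is_ ir _ sp sp').
rewrite rE -mulmxA ss mulmx1; apply: posd_unit; rewrite addrC.
by apply: posdD_scalar.
Qed.
End Class.

Section Transport.
Variables (X X' : fdmod B) (P : 'M[R]_(fd_dim X', fd_dim X)) (Q : 'M[R]_(fd_dim X, fd_dim X')).
Hypotheses (iP : @intertw R B X X' P) (iQ : @intertw R B X' X Q).
Hypotheses (PQ : P *m Q = 1%:M) (QP : Q *m P = 1%:M).

Lemma fdmass_iso (M : 'M[R]_(fd_dim X)) : fdmass M -> @fdmass R AV X' (P *m M *m Q).
Proof.
move=> [MM Ma]; split=> [|d a ad].
  by rewrite !mulmxA -(mulmxA _ Q P) QP mulmx1 -(mulmxA P) MM mulmx1.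
have ea : aact X' a *m P = P *m aact X a by apply/esym/iP.
have eb : Q *m aact X' a = aact X a *m Q by apply: iQ.
rewrite -(mulmxA _ Q (aact X' a)) eb !mulmxA ea -(mulmxA P) (Ma _ _ ad).
by rewrite -scalemxAr -scalemxAl !mulmxA.
Qed.

Lemma fdjoin_iso (M N : 'M[R]_(fd_dim X)) : fdjoin M N ->
  @fdjoin R AV X' (P *m M *m Q) (P *m N *m Q).
Proof.
move=> [p [pc hp p0 p1]]; exists (fun t => P *m p t *m Q); split.
- move=> t; apply: mx_cvgM; last exact: mx_cvg_cst.
  by apply: mx_cvgM; [exact: mx_cvg_cst|exact: pc].
- by move=> t; exact: fdmass_iso.
- by rewrite p0.
- by rewrite p1.
Qed.
End Transport.

(** The spectral argument runs on an adapted copy of [X], from which the two paths are carried back;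
    they meet in the polar part. *)
Lemma fd_surj X (M : 'M[R]_(fd_dim X)) : fdmass M -> exists sg N,
  [/\ @intertw R B X X sg, sg *m sg = 1%:M, fdjoin M N & fdjoin (mact X *m sg) N].
Proof.
move=> hM; have [X' [/fd_isoP[P [Q [iP iQ PQ QP]]] Xa]] := ad1 X.
have hM' := fdmass_iso iP iQ PQ QP hM; set M' := _ *m Q in hM'.
have hQ := porth_mass Xa hM'; have Qs := porth_sym hM'.
have [t [tl tr tu]] := regular_ex (porth M').
have j1 := fdjoin_iso iQ iP QP PQ (join_porth Xa hM').
have j2 := fdjoin_iso iQ iP QP PQ (join_sgn AV_decomp Xa hQ Qs tu tl tr).
have is_ := sgn_intertw AV_decomp Xa hQ Qs tu; have ss := sgn_sq Xa Qs tu.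
exists (Q *m sgn (porth M') t *m P), (Q *m porth M' *m P); split.
- exact: (intertwM iP (intertwM is_ iQ)).
- move: (sgn _ _) ss => g gg.
  by rewrite !mulmxA -(mulmxA _ P Q) PQ mulmx1 -(mulmxA Q) gg mulmx1.
- move: j1; rewrite {1}/M' !mulmxA QP mul1mx -mulmxA QP mulmx1; exact.
- move: j2; have mQ : mact X *m Q = Q *m mact X' by apply/esym/iQ.
  by rewrite !mulmxA mQ.
Qed.

Lemma fd_inj X (sg sg' : 'M[R]_(fd_dim X)) Y u v Y' u' v' :
  @intertw R B X X sg -> @intertw R B X X sg' -> sg *m sg = 1%:M -> sg' *m sg' = 1%:M ->
  @splits R B X (negproj sg) Y u v -> @splits R B X (negproj sg') Y' u' v' ->
  fdjoin (mact X *m sg) (mact X *m sg') -> algcls Y = algcls Y'.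
Proof.
move=> is_ is' ss ss' sp sp' j.
have [X' [/fd_isoP[P [Q [iP iQ PQ QP]]] Xa]] := ad1 X.
have mP : P *m mact X = mact X' *m P by apply: iP.
have [p [pc hp p0 p1]] := fdjoin_iso iP iQ PQ QP j.
have tr (g : 'M[R]_(fd_dim X)) Z w z : @intertw R B X X g -> g *m g = 1%:M ->
    @splits R B X (negproj g) Z w z ->
    mass_inv (P *m (mact X *m g) *m Q) (algcls Z).
  move=> ig gg [iw iz zw wz].
  rewrite !mulmxA mP -2!mulmxA; apply: (@mass_inv_involution X' Xa (P *m (g *m Q)) Z (P *m w) (z *m Q)).
  - exact: (intertwM (intertwM iQ ig) iP).
  - by rewrite -!mulmxA (mulmxA Q) QP mul1mx (mulmxA g) gg mul1mx.
  - split; [exact: intertwM|exact: intertwM| |].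
      by rewrite -mulmxA (mulmxA Q) QP mul1mx.
    rewrite mulmxA -(mulmxA P) wz /negproj -scalemxAr -scalemxAl; congr (_ *: _).
    by rewrite mulmxBr mulmx1 mulmxBl PQ -mulmxA.
have h := mass_inv_const Xa pc hp.
apply: (@mass_inv_fun X' Xa (p 1)) => //; last by rewrite p1; exact: tr sp'.
by apply: h; rewrite p0; exact: tr sp.
Qed.
End Invariant.

(** * Sign changes in the universe *)

Section LinearMatrix.
Variables (R : realType) (a b : nat) (f : 'cV[R]_a -> 'cV[R]_b).

Definition lin_matrix : 'M[R]_(b, a) := \matrix_(i, j) f (delta_mx j 0) i 0.

Lemma lin_matrixE : linear f -> forall x, f x = lin_matrix *m x.
Proof.
move=> fl x; pose g : {linear 'cV[R]_a -> 'cV[R]_b} := HB.pack f (GRing.isLinear.Build R _ _ _ f fl).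
have f0 : f 0 = 0 by have := fl (-1) 0 0; rewrite scaler0 addr0 scaleN1r addNr.
have fZ r y : f (r *: y) = r *: f y by have := fl r y 0; rewrite !addr0 f0 addr0.
rewrite -[f]/(g : _ -> _) {1}(matrix_sum_delta x) raddf_sum /=.
apply/matrixP=> i j; rewrite (ord1 j) summxE mxE; apply: eq_bigr => k _.
by rewrite big_ord1 fZ !mxE mulrC.
Qed.
End LinearMatrix.

Section UniverseSplits.
Variables (R : realType) (AV : superalgebra R).
Local Notation B := (stensor (Cl R 0 1) AV).
Variable W : nat -> irrmod B.
Local Notation U := (univ W).
Local Notation dW k := (fd_dim (irr_mod (W k))).
Local Notation stg := (stg W).
Implicit Types (M L : mass W) (X Y Z : fdmod B).

Definition usingle_comp k (x : 'cV[R]_(dW k)) n : 'cV[R]_(dW n) :=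
  match pselect (k = n) with
  | left e => eq_rect k (fun n => 'cV[R]_(dW n)) x n e
  | right _ => 0
  end.

Lemma usingle_comp_eq k x : @usingle_comp k x k = x.
Proof. by rewrite /usingle_comp; case: pselect => // e; rewrite (Prop_irrelevance e erefl). Qed.

Lemma usingle_comp_ne k (x : 'cV[R]_(dW k)) n : n <> k -> usingle_comp x n = 0.
Proof. by move=> nk; rewrite /usingle_comp; case: pselect => // e; case: nk. Qed.

Lemma usingle_fin k (x : 'cV[R]_(dW k)) : exists N, forall n, (N <= n)%N -> usingle_comp x n = 0.
Proof. by exists k.+1 => n kn; apply: usingle_comp_ne => e; rewrite e ltnn in kn. Qed.

Definition usingle k x : U := Universe (@usingle_fin k x).

Lemma usingle_eq k x : @usingle k x k = x. Proof. exact: usingle_comp_eq. Qed.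
Lemma usingle_ne k (x : 'cV[R]_(dW k)) n : n <> k -> usingle x n = 0.
Proof. exact: usingle_comp_ne. Qed.

Lemma usingleP k x (u : U) : u k = x -> (forall n, n <> k -> u n = 0) -> u = @usingle k x.
Proof.
move=> uk un; apply/universeP => n; have [->|nk] := pselect (n = k).
  by rewrite usingle_eq.
by rewrite un // usingle_ne.
Qed.

Lemma usingle_is_linear k : linear (@usingle k).
Proof.
move=> r x y; apply/esym/usingleP => [|n nk]; rewrite ucompD ucompZ ?usingle_eq //.
by rewrite !usingle_ne // scaler0 addr0.
Qed.

Lemma usingle_act k b (x : 'cV[R]_(dW k)) :
  ubact W b (usingle x) = usingle (fd_act (W k) b *m x).
Proof.
apply: usingleP => [|n nk]; rewrite ucomp_act ?usingle_eq //.
by rewrite usingle_ne // mulmx0.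
Qed.

(* A split embedding of X into the universe whose image lies in the sum of the W_k,
   N <= k < N', and whose retraction vanishes on the other summands. *)
Record usplit X N N' (j : 'cV[R]_(fd_dim X) -> U) (v : U -> 'cV[R]_(fd_dim X)) : Prop := USplit {
  usj_lin : linear j;
  usv_lin : linear v;
  usj_act : forall b x, j (fd_act X b *m x) = ubact W b (j x);
  usv_act : forall b w, v (ubact W b w) = fd_act X b *m v w;
  usK : forall x, v (j x) = x;
  usj_tail : forall x, utail N (j x);
  usj_stage : forall x, ustage N' (j x);
  usv_stage : forall w, ustage N w -> v w = 0;
  usv_tail : forall w, utail N' w -> v w = 0
}.

Lemma usplit_iso X Y N N' j v P Q : @usplit X N N' j v -> intertw P -> @intertw R B Y X Q ->
  P *m Q = 1%:M -> @usplit Y N N' (fun y => j (Q *m y)) (fun w => P *m v w).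
Proof.
case=> jl vl ja va K jt js vs vt iP iQ PQ; split.
- by move=> r x y; rewrite mulmxDr -scalemxAr jl.
- by move=> r x y; rewrite vl mulmxDr -scalemxAr.
- by move=> b x; rewrite mulmxA iQ -mulmxA ja.
- by move=> b w; rewrite va mulmxA iP -mulmxA.
- by move=> x; rewrite K mulmxA PQ mul1mx.
- by move=> x; exact: jt.
- by move=> x; exact: js.
- by move=> w h; rewrite vs // mulmx0.
- by move=> w h; rewrite vt // mulmx0.
Qed.

Lemma usplit_zero X N : fd_dim X = 0%N -> @usplit X N N (fun=> 0) (fun=> 0).
Proof.
move=> X0; have x0 (x : 'cV[R]_(fd_dim X)) : x = 0.
  by apply/matrixP => -[i iX]; exfalso; rewrite X0 in iX.
split=> //.
- by move=> r x y; rewrite scaler0 addr0.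
- by move=> r x y; rewrite scaler0 addr0.
- by move=> b x; rewrite raddf0.
Qed.

Lemma usplit_single k : @usplit (W k) k k.+1 (@usingle k) (fun w => w k).
Proof.
split=> //.
- exact: usingle_is_linear.
- by move=> b x; rewrite usingle_act.
- by move=> x; rewrite usingle_eq.
- by move=> x n nk; apply: usingle_ne => e; rewrite e ltnn in nk.
- by move=> x n nk; apply: usingle_ne => e; rewrite e ltnn in nk.
- by move=> w; exact.
- by move=> w; exact.
Qed.

Lemma usplit_widen X N N' n n' j v : @usplit X N N' j v -> (n <= N)%N -> (N' <= n')%N ->
  @usplit X n n' j v.
Proof.
case=> jl vl ja va K jt js vs vt nN Nn; split=> //.
- by move=> x k kn; apply: jt; exact: leq_trans kn nN.
- by move=> x k kn; apply: js; exact: leq_trans Nn kn.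
- by move=> w h; apply: vs => k kn; apply: h; exact: leq_trans nN kn.
- by move=> w h; apply: vt => k kn; apply: h; exact: leq_trans kn Nn.
Qed.

Lemma usplit_add X Y N N1 N2 j v j' v' : @usplit X N N1 j v -> @usplit Y N1 N2 j' v' ->
  (N <= N1 <= N2)%N ->
  @usplit (fd_add X Y) N N2 (fun x => j (fd_pr1 X Y *m x) + j' (fd_pr2 X Y *m x))
    (fun w => fd_in1 X Y *m v w + fd_in2 X Y *m v' w).
Proof.
move=> s s' /andP[n1 n2]; have sw := usplit_widen s (leqnn N) n2.
have sw' := usplit_widen s' n1 (leqnn N2).
have [[ia ib ia' ib'] [ba ba' d1 d2 t]] := biprod_add X Y.
case: s s' => jl vl ja va K jt js vs vt [jl' vl' ja' va' K' jt' js' vs' vt'].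
have vj x : v (j' x) = 0 by apply: vt; exact: jt'.
have vj' x : v' (j x) = 0 by apply: vs'; exact: js.
have vD u w : v (u + w) = v u + v w by have := vl 1 u w; rewrite !scale1r.
have vD' u w : v' (u + w) = v' u + v' w by have := vl' 1 u w; rewrite !scale1r.
split.
- by move=> r x y; rewrite !mulmxDr -!scalemxAr jl jl' scalerDr addrACA.
- by move=> r x y; rewrite vl vl' !mulmxDr -!scalemxAr scalerDr addrACA.
- by move=> b x; rewrite !mulmxA ib ib' -!mulmxA ja ja' raddfD.
- by move=> b w; rewrite va va' !mulmxA ia ia' -!mulmxA mulmxDr.
- move=> x; rewrite vD vD' K K' vj vj' add0r addr0 !mulmxA -mulmxDl.
  by move: x; rewrite -[fd_dim (fd_add X Y)]/(fd_dim X + fd_dim Y)%N in t * => x; rewrite t mul1mx.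
- move=> x k kN; rewrite ucompD (usj_tail sw) // (usj_tail sw') ?addr0 //.
- move=> x k kN; rewrite ucompD (usj_stage sw) // (usj_stage sw') ?addr0 //.
- by move=> w h; rewrite (usv_stage sw) // (usv_stage sw') // !mulmx0 addr0.
- by move=> w h; rewrite (usv_tail sw) // (usv_tail sw') // !mulmx0 addr0.
Qed.

Hypothesis AV_decomp :
  forall a : AV, exists a0 a1, [/\ homog false a0, homog true a1 & a = a0 + a1].
Hypothesis ad1 : forall X : fdmod B, exists Y : fdmod B, fd_iso X Y /\ adapted Y.
Hypothesis W_universal : forall (S : irrmod B) n, exists k, (n <= k)%N /\ fd_iso S (W k).

(** Each irreducible summand is placed in an isomorphic [W k] beyond those already used. Starting
    beyond [N] keeps the image disjoint from a given stage. *)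
Lemma room X N : exists N' j v, (N <= N')%N /\ @usplit X N N' j v.
Proof.
have [s sX] := decomp_ex (ss1 AV_decomp ad1) X.
elim: s X N sX => [|S s IH] X N /=.
  by move=> X0; exists N, (fun=> 0), (fun=> 0); split=> //; exact: usplit_zero.
case=> Y [sY /fd_iso_sym/fd_isoP[P [Q [iP iQ PQ QP]]]].
have [k [Nk /fd_iso_sym/fd_isoP[P' [Q' [iP' iQ' PQ' QP']]]]] := W_universal S N.
have [N2 [j [v [kN2 jv]]]] := IH Y k.+1 sY.
have s1 := usplit_iso (usplit_widen (usplit_single k) Nk (leqnn _)) iP' iQ' PQ'.
have s2 := usplit_add s1 jv.
have kk : (N <= k.+1 <= N2)%N by rewrite kN2 andbT (leq_trans Nk).
have s3 := usplit_iso (s2 kk) iP iQ PQ.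
exists N2; do 2 eexists; split; last exact: s3.
by apply: leq_trans kN2; exact: leq_trans Nk _.
Qed.

(** The retraction replaces the complement, which is its kernel. *)
Definition uflip X (j : 'cV[R]_(fd_dim X) -> U) (v : U -> 'cV[R]_(fd_dim X)) M :=
  forall w, M w = mass0 W (w - 2 *: j (v w)).

Section StageMatrices.
Variables (X : fdmod B) (N : nat) (j : 'cV[R]_(fd_dim X) -> U) (v : U -> 'cV[R]_(fd_dim X)).
Hypothesis s : @usplit X 0 N j v.

Definition usj : 'M[R]_(fd_dim (stg N), fd_dim X) := lin_matrix (fun x => uprj N (j x)).
Definition usv : 'M[R]_(fd_dim X, fd_dim (stg N)) := lin_matrix (fun x => v (uinc x)).

Lemma usjE x : uprj N (j x) = usj *m x.
Proof. by apply: (@lin_matrixE _ _ _ (fun x => uprj N (j x))) => r y z; rewrite (usj_lin s) uprj_is_linear. Qed.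
Lemma usvE x : v (uinc x) = usv *m x.
Proof. by apply: (@lin_matrixE _ _ _ (fun x => v (uinc x))) => r y z; rewrite uinc_is_linear (usv_lin s). Qed.
Lemma usj_uinc x : j x = uinc (usj *m x).
Proof. by rewrite -usjE uinc_uprj //; exact: usj_stage s _. Qed.
Lemma usv_uprj w : v w = usv *m uprj N w.
Proof.
have := usv_lin s 1 (uinc (uprj N w)) (w - uinc (uprj N w)).
rewrite !scale1r [uinc _ + _]addrC subrK => ->.
by rewrite (usv_tail s (utail_rest w)) addr0 usvE.
Qed.

Lemma usplit_emb : @emb R AV (stg N) X usj usv.
Proof.
apply: embP => [b|b|]; apply: mulmx_cV => x; rewrite -?mulmxA.
- by rewrite -!usjE (usj_act s) uprj_act.
- by rewrite -!usvE -(usv_act s) uinc_act.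
- by rewrite -usvE -usj_uinc (usK s) mul1mx.
Qed.

Lemma uflip_stage M : uflip j v M -> mass_stage N M /\ ublock N M = flip usj usv.
Proof.
move=> hM; have js := usj_stage s; split.
  split=> u uN; rewrite hM.
    move=> k Nk; rewrite ucomp_act ucompB ucompZ js // uN // scaler0 subr0 mulmx0 //.
  rewrite (usv_tail s uN); have := usj_lin s (-1) 0 0; rewrite scaler0 addr0 scaleN1r => /eqP.
  by rewrite addNr => /eqP ->; rewrite scaler0 subr0.
apply: mulmx_cV => x; rewrite -ublockE hM /mass0 uprj_act /flip -mulmxA; congr (_ *m _).
rewrite usvE usj_uinc -scaleNr addrC -uinc_is_linear uincK scaleNr addrC.
by rewrite mulmxBl mul1mx -scalemxAl mulmxA.
Qed.
End StageMatrices.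

Lemma emb_usplit X N u v : @emb R AV (stg N) X u v ->
  @usplit X 0 N (fun x => uinc (u *m x)) (fun w => v *m uprj N w).
Proof.
move=> [iu iv vu _]; split=> //.
- by move=> r x y; rewrite mulmxDr -scalemxAr uinc_is_linear.
- by move=> r x y; rewrite uprj_is_linear mulmxDr -scalemxAr.
- by move=> b x; rewrite uinc_act mulmxA iu mulmxA.
- by move=> b w; rewrite uprj_act mulmxA iv mulmxA.
- by move=> x; rewrite uincK mulmxA vu mul1mx.
- by move=> x; exact: uinc_stage.
- move=> w w0; have -> : w = 0 by apply/universeP => k; exact: w0.
  by rewrite raddf0 mulmx0.
- by move=> w wN; rewrite uprj_tail // mulmx0.
Qed.

Lemma emb_uflip X N u v (he : @emb R AV (stg N) X u v) :
  uflip (fun x => uinc (u *m x)) (fun w => v *m uprj N w) (umass (flip_mass he)).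
Proof.
move=> w; rewrite /= /uop /flip -mulmxA -[mact _]/(fd_act _ _) -uinc_act -/(mass0 W) -raddfD.
congr (mass0 W _); rewrite mulmxBl mul1mx -scalemxAl raddfB linearZ /= mulmxA.
by rewrite [LHS]addrC addrA subrK scalerN; congr (_ - _); exact: linearZ.
Qed.
End UniverseSplits.

Section LeftInverse.
Variables (R : realType) (B : ralgebra R).
Hypothesis ss : forall X : fdmod B, exists Y, fd_iso X Y /\ star_closed Y.

(** The least squares inverse in a star-closed copy of [V]; it intertwines because transposes of the
    action can be replaced by elements of the algebra. *)
Lemma intertw_left_inverse (X V : fdmod B) (u : 'M[R]_(fd_dim V, fd_dim X)) : intertw u ->
  (forall x : 'cV_(fd_dim X), u *m x = 0 -> x = 0) ->
  exists v, @intertw R B V X v /\ v *m u = 1%:M.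
Proof.
move=> iu inj; have [Y [/fd_isoP[P [Q [iP iQ PQ QP]]] Ys]] := ss V.
pose w := P *m u; have iw : @intertw R B X Y w by exact: intertwM iu iP.
pose G := w^T *m w; have Gu : G \in unitmx.
  apply: unitmx_inj0 => x Gx; apply: inj.
  have : w *m x = 0 by apply/dot_self_eq0; rewrite trmx_mul -mulmxA (mulmxA w^T) Gx mulmx0 mxE.
  by move=> wx; rewrite -[u]mul1mx -QP -!mulmxA (mulmxA P) wx mulmx0.
have iV : @intertw R B Y X (invmx G *m w^T).
  move=> b; have [b' bE] := Ys b.
  have e1 : w^T *m fd_act Y b = (fd_act X b')^T *m w^T.
    by rewrite -[fd_act Y b]trmxK bE -!trmx_mul iw.
  have e2 : G *m fd_act X b = (fd_act X b')^T *m G by rewrite -mulmxA iw mulmxA e1 -mulmxA.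
  clearbody G; rewrite -mulmxA e1 !mulmxA; congr (_ *m w^T).
  by rewrite -(mulmxK Gu (fd_act X b')^T) -e2 !mulmxA mulVmx // mul1mx.
exists (invmx G *m w^T *m P); split; first exact: intertwM iP iV.
by rewrite -!mulmxA -/w mulVmx.
Qed.
End LeftInverse.

Section SignChanges.
Variables (R : realType) (AV : superalgebra R).
Local Notation B := (stensor (Cl R 0 1) AV).
Local Notation B2 := (stensor (Cl R 0 2) AV).
Variable W : nat -> irrmod B.
Local Notation U := (univ W).
Local Notation stg := (stg W).
Implicit Types (M L : mass W) (X Y Z : fdmod B).

Definition signch X M := exists N j v, @usplit R AV W X 0 N j v /\ uflip j v M.

Lemma mass0_sq (u : U) : mass0 W (mass0 W u) = u.
Proof. exact: (mass_sq (base_mass W)). Qed.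

Lemma embedding_stage X (j : 'cV[R]_(fd_dim X) -> U) : linear j ->
  exists N, forall x, ustage N (j x).
Proof.
move=> jl; have /choice[n hn] : forall i : 'I_(fd_dim X), exists n, ustage n (j (delta_mx i 0)).
  by move=> i; have [n h] := ufin (j (delta_mx i 0)); exists n.
exists (\max_i n i)%N => x k kN.
have j0 : j 0 = 0 by have := jl (-1) 0 0; rewrite scaler0 addr0 scaleN1r addNr.
have jD y z : j (y + z) = j y + j z by have := jl 1 y z; rewrite !scale1r.
have jZ r y : j (r *: y) = r *: j y by have := jl r y 0; rewrite !addr0 j0 addr0.
have -> : x = \sum_i x i 0 *: delta_mx i 0.
  by rewrite {1}(matrix_sum_delta x); apply: eq_bigr => i _; rewrite big_ord1.
elim/big_rec: _ => [|i y _ IH]; first by rewrite j0.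
rewrite jD ucompD jZ ucompZ IH addr0 (hn i) ?scaler0 //.
by apply: leq_trans kN; exact: leq_bigmax.
Qed.

(** The complement determines a module retraction [v] of [j]. The point is that [v] vanishes on a
    tail of the universe, although nothing of the kind is assumed of [C]. *)
Lemma sign_change_signch X (j : 'cV[R]_(fd_dim X) -> U) C M :
  module_embedding j -> sign_change j C M -> signch X M.
Proof.
move=> [jl ji ja] [[C0 CD CB] [EC dec] Mj MC].
have j0 : j 0 = 0 by have := jl (-1) 0 0; rewrite scaler0 addr0 scaleN1r addNr.
have CZ r w : C w -> C (r *: w).
  by move=> Cw; have [_ _ _ <-] := uact_action (fun n => irr_mod (W n)); exact: CB.
have CN w : C w -> C (- w) by move=> /(CZ (-1)); rewrite scaleN1r.
have /choice[v vC] : forall w, exists x, C (w - j x).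
  move=> w; have [e [c [[x _ <-] Cc ->]]] := dec w.
  by exists x; rewrite addrC addKr.
have jB x y : j (x - y) = j x - j y.
  by have := jl (-1) y x; rewrite !scaleN1r ![- _ + _]addrC.
have vu w x : C (w - j x) -> v w = x.
  move=> Cx; have := CD _ _ Cx (CN _ (vC w)); rewrite opprB addrC addrA subrK -jB => Cj.
  have : (range j `&` C) (j (v w - x)).
    by split=> //; exists (v w - x).
  rewrite EC /= -j0 => /ji /eqP; rewrite subr_eq0 => /eqP //.
have vl : linear v.
  move=> r w w'; apply: vu; rewrite jl.
  have -> : r *: w + w' - (r *: j (v w) + j (v w')) = r *: (w - j (v w)) + (w' - j (v w')).
    by rewrite scalerBr opprD addrACA.
  by apply: CD; [exact/CZ/vC|exact: vC].
have va b w : v (ubact W b w) = fd_act X b *m v w.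
  by apply: vu; rewrite ja -raddfB; exact: CB.
have vK x : v (j x) = x by apply: vu; rewrite subrr.
have flp : uflip j v M.
  move=> w; have -> : M w = M (j (v w)) + M (w - j (v w)) by rewrite -raddfD addrC subrK.
  rewrite Mj (MC _ (vC w)) -raddfN -raddfD; congr (mass0 W _).
  by rewrite addrCA scaler_nat mulr2n opprD.
have [N1 hN1] := embedding_stage jl; have [N2 hN2] := mass_fin M.
exists (maxn N1 N2), j, v; split=> //; split=> //.
- by move=> x k kN; apply: hN1; exact: leq_trans (leq_maxl _ _) kN.
- move=> w w0; have -> : w = 0 by apply/universeP => k; exact: w0.
  by apply: vu; rewrite j0 subrr.
(* Beyond a stage of [M] the masses [M] and [mass0] agree, so [mass0] kills 2 j (v w); it is an
   involution and [j] is injective. *)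
- move=> w wN; have [_ hM] := mass_stageS (leq_maxr N1 N2) hN2.
  have := hM w wN; rewrite flp raddfB => /eqP; rewrite subr_eq -subr_eq0 opprD addNKr.
  rewrite oppr_eq0 => /eqP e; have := congr1 (mass0 W) e; rewrite mass0_sq raddf0 => /eqP.
  rewrite scaler_eq0 pnatr_eq0 /= => /eqP jv.
  by rewrite -[v w]vK jv; apply: vu; rewrite j0 subrr.
Qed.

Lemma usplit_sign_change X N j v M : @usplit R AV W X 0 N j v -> uflip j v M ->
  module_embedding j /\ sign_change j [set w | v w = 0] M.
Proof.
move=> [jl vl ja va K _ _ vs _] flp.
have v0 : v 0 = 0 by apply: vs => k.
have j0 : j 0 = 0 by have := jl (-1) 0 0; rewrite scaler0 addr0 scaleN1r addNr.
have vD w w' : v (w + w') = v w + v w' by have := vl 1 w w'; rewrite !scale1r.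
split; first by split=> //; exact: can_inj K.
split.
- split=> //= [w w' vw vw'|b w vw]; first by rewrite vD vw vw' addr0.
  by rewrite va vw mulmx0.
- split.
    apply/seteqP; split=> w /=; last by move=> ->; split=> //; exists 0.
    by move=> [[x _ <-]]; rewrite K => ->.
  move=> w; exists (j (v w)), (w - j (v w)); split; [by exists (v w)| |by rewrite addrC subrK].
  have := vl (-1) (j (v w)) w; rewrite !scaleN1r K addNr.
  by rewrite [- j _ + _]addrC.
- by move=> x; rewrite flp K scaler_nat mulr2n opprD addrA subrr add0r raddfN.
- by move=> w /= vw; rewrite flp vw j0 scaler0 subr0.
Qed.

Lemma uflip_mass X N j v : @usplit R AV W X 0 N j v -> exists M, uflip j v M.
Proof.
move=> s; have he := usplit_emb s; exists (umass (flip_mass he)) => w.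
by rewrite (emb_uflip he) -(usj_uinc s) // -(usv_uprj s).
Qed.

Hypothesis AV_decomp :
  forall a : AV, exists a0 a1, [/\ homog false a0, homog true a1 & a = a0 + a1].
Hypothesis ad1 : forall X : fdmod B, exists Y : fdmod B, fd_iso X Y /\ adapted Y.
Hypothesis ad2 : forall X : fdmod B2, exists Y : fdmod B2, fd_iso X Y /\ adapted Y.
Hypothesis W_universal : forall (S : irrmod B) n, exists k, (n <= k)%N /\ fd_iso S (W k).

Lemma usplit_ex X : exists N j v, @usplit R AV W X 0 N j v.
Proof.
have [N [j [v [_ s]]]] := room AV_decomp ad1 W_universal X 0.
by exists N, j, v.
Qed.

Lemma embedding_ex X : exists j : 'cV[R]_(fd_dim X) -> U, module_embedding j.
Proof.
have [N [j [v s]]] := usplit_ex X; have [M f] := uflip_mass s.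
by exists j; have [] := usplit_sign_change s f.
Qed.

(** The image of [j] lies in a finite stage, where complete reducibility gives a left inverse; the
    complement is its kernel together with the tail. *)
Lemma sign_change_ex X (j : 'cV[R]_(fd_dim X) -> U) : module_embedding j ->
  exists C M, sign_change j C M.
Proof.
move=> [jl ji ja]; have [N hN] := embedding_stage jl.
pose u := lin_matrix (fun x => uprj N (j x)).
have uE x : uprj N (j x) = u *m x.
  by apply: (@lin_matrixE _ _ _ (fun x => uprj N (j x))) => r y z; rewrite jl uprj_is_linear.
have jE x : j x = uinc (u *m x) by rewrite -uE uinc_uprj.
have j0 : j 0 = 0 by have := jl (-1) 0 0; rewrite scaler0 addr0 scaleN1r addNr.
have iu : @intertw R B X (stg N) u.
  by move=> b; apply: mulmx_cV => x; rewrite -!mulmxA -!uE ja uprj_act.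
have [v [iv vu]] : exists v, @intertw R B (stg N) X v /\ v *m u = 1%:M.
  apply: (intertw_left_inverse (ss1 AV_decomp ad1)) => // x ux; apply: ji.
  by rewrite jE ux raddf0 j0.
have he : @emb R AV (stg N) X u v by exact: embP.
have [_ sc] := usplit_sign_change (emb_usplit he) (emb_uflip he).
have -> : j = (fun x => uinc (u *m x)) by apply/funext.
by do 2 eexists; exact: sc.
Qed.

Lemma signch_ex X : exists M, signch X M.
Proof.
have [N [j [v s]]] := usplit_ex X; have [M f] := uflip_mass s.
by exists M, N, j, v.
Qed.

Lemma signch_emb X N u v (he : @emb R AV (stg N) X u v) : signch X (umass (flip_mass he)).
Proof. by do 3 eexists; split; [exact: emb_usplit he|exact: emb_uflip]. Qed.

Lemma signch_iso X Y M : fd_iso X Y -> signch X M -> signch Y M.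
Proof.
move=> /fd_isoP[P [Q [iP iQ PQ QP]]] [N [j [v [s f]]]].
exists N; do 2 eexists; split; first exact: usplit_iso s iP iQ PQ.
by move=> w; rewrite f mulmxA QP mul1mx.
Qed.

(* Both copies of X are rotated to a third one, disjoint from them. *)
Lemma signch_path X M L : signch X M -> signch X L -> path_joined M L.
Proof.
move=> [N1 [j [v [s f]]]] [N2 [j' [v' [s' f']]]].
have [N [j2 [v2 [N0 s2]]]] := room AV_decomp ad1 W_universal X (maxn N1 N2).
have N1m := leq_maxl N1 N2; have N2m := leq_maxr N1 N2.
have t := usplit_widen s (leqnn 0) (leq_trans N1m N0).
have t' := usplit_widen s' (leqnn 0) (leq_trans N2m N0).
have t2 := usplit_widen s2 (leq0n _) (leqnn N).
have e := usplit_emb t; have e' := usplit_emb t'; have e2 := usplit_emb t2.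
have [hM ME] := uflip_stage t f; have [hL LE] := uflip_stage t' f'.
apply: (path_of_stage hM hL); rewrite ME LE.
have ortho n k p (p0 : @usplit R AV W X 0 n k p) (p1 : @usplit R AV W X 0 N k p) :
    (n <= maxn N1 N2)%N -> usv N p *m usj N j2 = 0 /\ usv N v2 *m usj N k = 0.
  move=> nm; split; apply: mulmx_cV => x; rewrite mul0mx -mulmxA.
    rewrite -(usvE p1) -(usj_uinc t2); apply: (usv_tail p0) => i ni.
    by apply: (usj_tail s2); exact: leq_trans ni nm.
  rewrite -(usvE t2) -(usj_uinc p1); apply: (usv_stage s2) => i ni.
  by apply: (usj_stage p0); exact: leq_trans nm ni.
have [c1 c2] := ortho _ _ _ s t N1m; have [c3 c4] := ortho _ _ _ s' t' N2m.
apply: fdjoin_trans (flip_rotate e e2 c1 c2) _.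
exact: flip_rotate e2 e' c4 c3.
Qed.

(** One embedding of the sum restricts to an embedding of [X], and by [signch_path] the two given
    sign changes may be replaced by those of this embedding. *)
Lemma signch_absorb X Z J M L : @clext R AV Z J -> signch X M -> signch (fd_add X Z) L ->
  path_joined M L.
Proof.
move=> hJ hM hL; have [N [j [v s]]] := usplit_ex (fd_add X Z).
have e := usplit_emb s; have [e1 _ _ _ _] := emb_add e.
apply: path_trans (signch_path hM (signch_emb e1)) _.
apply: path_trans (signch_path (signch_emb e) hL).
exact/path_of_fdjoin/(flip_add_clext e hJ).
Qed.

Lemma signch_algcls X Y M L : algcls X = algcls Y -> signch X M -> signch Y L ->
  path_joined M L.
Proof.
move=> /(algcls_eq AV_decomp ad1 ad2)[X' [Y' [J [J' [hJ hJ' XY]]]]] hM hL.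
have [K hK] := signch_ex (fd_add X X').
apply: path_trans (signch_absorb hJ hM hK) _.
exact/path_sym/(signch_absorb hJ' hL)/(signch_iso XY hK).
Qed.

Lemma signch_surj M : exists X L, signch X L /\ path_joined M L.
Proof.
have [N hN] := mass_fin M; have hA := ublock_mass hN.
have [sg [C [is_ ss j1 j2]]] := fd_surj AV_decomp ad1 hA.
have [X [u [v [iu iv vu uv]]]] := split_idempotent (negproj_intertw is_) (negproj_idem ss).
have he : @emb R AV (stg N) X u v by exact: embP.
exists X, (umass (flip_mass he)); split; first exact: signch_emb.
apply: (path_of_stage hN (umass_stage _)); rewrite ublock_umass.
have -> : flip u v = mact (stg N) *m sg.
  rewrite /flip uv /negproj scalerA mulfV ?pnatr_eq0 // scale1r.
  by rewrite opprB addrCA subrr addr0.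
by apply: fdjoin_trans j1 _; exact: fdjoin_sym.
Qed.

Lemma signch_inj X Y M L : signch X M -> signch Y L -> path_joined M L -> algcls X = algcls Y.
Proof.
move=> [N1 [j [v [s f]]]] [N2 [j' [v' [s' f']]]] /path_stage[N0 hN].
pose N := maxn N0 (maxn N1 N2).
have n1 : (N1 <= N)%N by rewrite (leq_trans (leq_maxl N1 N2)) ?leq_maxr.
have n2 : (N2 <= N)%N by rewrite (leq_trans (leq_maxr N1 N2)) ?leq_maxr.
have t := usplit_widen s (leqnn 0) n1; have t' := usplit_widen s' (leqnn 0) n2.
have [_ _ jn] := hN N (leq_maxl _ _).
have [_ ME] := uflip_stage t f; have [_ LE] := uflip_stage t' f'.
rewrite ME LE in jn.
have [i1 q1 p1] := flip_involution (usplit_emb t).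
have [i2 q2 p2] := flip_involution (usplit_emb t').
exact: (fd_inj AV_decomp ad1 ad2 i1 i2 q1 q2 p1 p2 jn).
Qed.
End SignChanges.

(** * Direct sums of mass terms *)

Section DirectSums.
Variables (R : realType) (AV : superalgebra R).
Local Notation B := (stensor (Cl R 0 1) AV).
Variable W : nat -> irrmod B.
Local Notation U := (univ W).
Local Notation dW k := (fd_dim (irr_mod (W k))).
Local Notation stg := (stg W).
Implicit Types (M N L : mass W) (X Y Z : fdmod B).

(** [nat + nat] indexes the summands of two copies of the universe, with [bisel] and [biinj] as
    coordinates and inclusions. *)
Definition bicomp (c : nat + nat) : nat := match c with inl k => k | inr k => k end.

Definition bisel (c : nat + nat) (w : U * U) : 'cV[R]_(dW (bicomp c)) :=
  match c with inl k => w.1 k | inr k => w.2 k end.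

Definition biinj (c : nat + nat) : 'cV[R]_(dW (bicomp c)) -> U * U :=
  match c with inl k => fun x => (usingle x, 0) | inr k => fun x => (0, usingle x) end.

Lemma biselB c w w' : bisel c (w - w') = bisel c w - bisel c w'. Proof. by case: c. Qed.

Lemma biinjK c x : bisel c (biinj x) = x.
Proof. by case: c x => k x; exact: usingle_eq. Qed.

Lemma usingle0 k : @usingle R AV W k 0 = 0.
Proof. by apply/esym/usingleP. Qed.

Lemma biinj0 c : @biinj c 0 = 0.
Proof. by case: c => k /=; rewrite usingle0. Qed.

Lemma bisel_inj w w' : (forall c, bisel c w = bisel c w') -> w = w'.
Proof.
move=> h; case: w w' h => [u v] [u' v'] h; congr pair; apply/universeP => k.
  exact: (h (inl k)).
exact: (h (inr k)).
Qed.

Lemma ustage_sum K (u : U) : ustage K u -> u = \sum_(k < K) usingle (u k).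
Proof.
move=> uK; have sE (F : 'I_K -> U) n : (\sum_k F k) n = \sum_k F k n.
  exact: (big_morph (fun z : U => z n) (fun _ _ => erefl) erefl).
apply: (@universe_lt R AV W K) => [i|k Kk]; rewrite sE.
  rewrite (bigD1 i) // usingle_eq big1 => [|l /andP[_ li]]; first exact/esym/addr0.
  by apply: usingle_ne => e; case/eqP: li; exact: val_inj.
rewrite uK // big1 // => l _; apply: usingle_ne => e.
by move: Kk; rewrite e leqNgt ltn_ord.
Qed.

Lemma bisum (w : U * U) : exists K,
  w = \sum_(k < K) biinj (bisel (inl (k : nat)) w) + \sum_(k < K) biinj (bisel (inr (k : nat)) w).
Proof.
case: w => u v; have [K1 h1] := ufin u; have [K2 h2] := ufin v.
exists (maxn K1 K2); set K := maxn K1 K2.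
have uK : ustage K u by move=> k h; apply: h1; exact: leq_trans (leq_maxl _ _) h.
have vK : ustage K v by move=> k h; apply: h2; exact: leq_trans (leq_maxr _ _) h.
have e1 (F : 'I_K -> U) : \sum_k (F k, 0 : U) = (\sum_k F k, 0).
  by elim/big_rec2: _ => // i y1 y2 _ ->; congr pair; rewrite /= add0r.
have e2 (F : 'I_K -> U) : \sum_k (0 : U, F k) = (0, \sum_k F k).
  by elim/big_rec2: _ => // i y1 y2 _ ->; congr pair; rewrite /= add0r.
rewrite /= e1 e2; congr pair => /=.
  by rewrite addr0 -ustage_sum.
by rewrite add0r -ustage_sum.
Qed.

Variable Psi : {linear (U * U)%type -> U}.
Hypothesis Psi_bij : bijective Psi.
Hypothesis Psi_act : forall b u v, Psi (ubact W b u, ubact W b v) = ubact W b (Psi (u, v)).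
Variable sigma : nat + nat -> nat.
Hypothesis sigma_inj : injective sigma.
Hypothesis sigmaP : forall c x, @usummand R B W (sigma c) (Psi (@biinj c x)).

Lemma Psi_coord0 c w : bisel c w = 0 -> Psi w (sigma c) = 0.
Proof.
move=> w0; have t c' : Psi (biinj (bisel c' w)) (sigma c) = 0.
  have [->|cc] := pselect (c' = c); first by rewrite w0 biinj0 raddf0.
  by apply: sigmaP; apply/eqP => /sigma_inj/esym.
have [K wE] := bisum w; rewrite wE raddfD ucompD !raddf_sum.
have s0 (F : 'I_K -> U) n : (forall k, F k n = 0) -> (\sum_k F k) n = 0.
  move=> h; elim/big_rec: _ => // i y _ y0.
  by rewrite ucompD h y0 addr0.
by rewrite !s0 ?addr0 // => k; exact: t.
Qed.

Lemma Psi_coord c w : Psi w (sigma c) = 0 -> bisel c w = 0.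
Proof.
move=> w0; have h : Psi (w - biinj (bisel c w)) (sigma c) = 0.
  by apply: Psi_coord0; rewrite biselB biinjK subrr.
have h2 : Psi (biinj (bisel c w)) = 0.
  apply/universeP => k; have [->|/eqP kc] := pselect (k = sigma c); last exact: sigmaP.
  by move: h; rewrite raddfB ucompB w0 sub0r => /eqP; rewrite oppr_eq0 => /eqP.
have : biinj (bisel c w) = 0 by apply: (bij_inj Psi_bij); rewrite h2 raddf0.
by move=> e; rewrite -[bisel c w]biinjK e; case: c {w0 h h2 e}.
Qed.

(** A stage containing the images under [Psi] of the first [n] summands of both copies; the
    successor makes the largest index a strict bound. *)
Definition bistage n := (\max_(i < n) maxn (sigma (inl (i : nat))) (sigma (inr (i : nat)))).+1.

Lemma bistage_lt n c : (bicomp c < n)%N -> (sigma c < bistage n)%N.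
Proof.
move=> cn; rewrite ltnS; apply: leq_trans (leq_bigmax (Ordinal cn)).
by case: c cn => k /= kn; [exact: leq_maxl|exact: leq_maxr].
Qed.

Lemma Psi_tail n w : utail (bistage n) (Psi w) -> utail n w.1 /\ utail n w.2.
Proof.
move=> h; split=> k kn.
  by apply: (@Psi_coord (inl k)); apply: h; exact: (@bistage_lt n (inl k)).
by apply: (@Psi_coord (inr k)); apply: h; exact: (@bistage_lt n (inr k)).
Qed.

Lemma Psi_stage n (w : U * U) : ustage n w.1 -> ustage n w.2 -> ustage (bistage n) (Psi w).
Proof.
move=> h1 h2 k nk.
have [K wE] := bisum w; rewrite wE raddfD ucompD !raddf_sum.
have s0 (F : 'I_K -> U) : (forall i, F i k = 0) -> (\sum_i F i) k = 0.
  move=> h; elim/big_rec: _ => // i y _ y0.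
  by rewrite ucompD h y0 addr0.
have t c : Psi (biinj (bisel c w)) k = 0.
  have [cn|nc] := ltnP (bicomp c) n.
    by apply: sigmaP; apply/eqP => e; have := bistage_lt cn; rewrite -e ltnNge nk.
  have -> : bisel c w = 0 by case: c nc => i ni; [exact: h1|exact: h2].
  by rewrite biinj0 raddf0.
by rewrite !s0 ?addr0 // => i; exact: t.
Qed.

Lemma PsiD u v u' v' : Psi (u + u', v + v') = Psi (u, v) + Psi (u', v').
Proof. by rewrite -raddfD. Qed.
Lemma PsiB u v u' v' : Psi (u - u', v - v') = Psi (u, v) - Psi (u', v').
Proof. by rewrite -raddfB. Qed.
Lemma PsiZ r u v : Psi (r *: u, r *: v) = r *: Psi (u, v).
Proof. by rewrite -linearZ. Qed.
Lemma Psi_mass0 u v : Psi (mass0 W u, mass0 W v) = mass0 W (Psi (u, v)).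
Proof. exact: Psi_act. Qed.

Lemma dsum_stage n M N (L : U -> U) : mass_stage n M -> mass_stage n N ->
  (forall u v, L (Psi (u, v)) = Psi (M u, N v)) -> mass_stage (bistage n) L.
Proof.
move=> [hM tM] [hN tN] LE; have [g gK Kg] := Psi_bij; split=> w hw; rewrite -(Kg w); last first.
  rewrite -(Kg w) in hw; have [] := Psi_tail hw.
  by case: (g w) => u v /= hu hv; rewrite LE tM // tN // Psi_mass0.
rewrite -(Kg w) in hw; case: (g w) hw => u v hw; rewrite LE.
pose u0 := uinc (uprj n u); pose v0 := uinc (uprj n v).
have ME (K : mass W) (z : U) : (forall z', utail n z' -> K z' = mass0 W z') ->
    K z = K (uinc (uprj n z)) + mass0 W (z - uinc (uprj n z)).
  by move=> t; rewrite -(t _ (utail_rest z)) -raddfD addrC subrK.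
rewrite (ME M u tM) (ME N v tN) PsiD Psi_mass0.
have PE : Psi (u - u0, v - v0) = Psi (u, v) - Psi (u0, v0) by rewrite -raddfB.
rewrite PE => k nk; rewrite ucompD ucomp_act ucompB hw //.
have hs := @Psi_stage n (u0, v0) (uinc_stage _) (uinc_stage _).
rewrite hs // subrr mulmx0 addr0; apply: Psi_stage nk; [apply: hM|apply: hN]; exact: uinc_stage.
Qed.

Lemma dsum_ex M N : exists L, mass_dsum Psi M N L.
Proof.
have [g gK Kg] := Psi_bij.
have gl : linear g by move=> r w w'; apply: (bij_inj Psi_bij); rewrite linearP !Kg.
pose f (F G : U -> U) w := Psi (F (g w).1, G (g w).2).
have fl (F G : U -> U) : linear F -> linear G -> linear (f F G).
  by move=> Fl Gl r w w'; rewrite /f gl /= Fl Gl PsiD PsiZ.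
pose LL : {linear U -> U} := HB.pack (f M N)
  (GRing.isLinear.Build R U U _ (f M N) (fl M N (fun r => linearP M r) (fun r => linearP N r))).
have LE u v : LL (Psi (u, v)) = Psi (M u, N v) by rewrite [LHS]/(f M N _) /f gK.
have [n1 h1] := mass_fin M; have [n2 h2] := mass_fin N.
have Lfin : exists n, mass_stage n LL.
  exists (bistage (maxn n1 n2)); exact: dsum_stage (mass_stageS (leq_maxl n1 n2) h1) (mass_stageS (leq_maxr n1 n2) h2) LE.
have Lrep : exists F : B -> U -> U,
  [/\ Defs.is_action F, forall a, F (st_inr _ a) = ubact W (st_inr _ a) & F (mass_gen AV) = LL].
  have [F [[F1 F2 F3 F4] Fa Fm]] := mass_rep M; have [G [[G1 G2 G3 G4] Ga Gm]] := mass_rep N.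
  exists (fun b => f (F b) (G b)); split.
  - split=> [b|a b w|a b w|r w]; first exact: (fl _ _ (F1 b) (G1 b)).
    + by rewrite /f F2 G2 PsiD.
    + by rewrite /f F3 G3 gK.
    + by rewrite /f F4 G4 PsiZ -surjective_pairing Kg.
  - by move=> a; apply/funext => w; rewrite /f Fa Ga Psi_act -surjective_pairing Kg.
  - by apply/funext => w; rewrite /f Fm Gm.
by exists (Mass Lfin Lrep).
Qed.

Lemma dsum_path M M' N N' L L' : path_joined M M' -> path_joined N N' ->
  mass_dsum Psi M N L -> mass_dsum Psi M' N' L' -> path_joined L L'.
Proof.
move=> /path_stage[n1 h1] /path_stage[n2 h2] LE LE'.
have [hM hM' [p [pc hp p0 p1]]] := h1 _ (leq_maxl n1 n2).
have [hN hN' [r [rc hr r0 r1]]] := h2 _ (leq_maxr n1 n2).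
set n := maxn n1 n2 in hM hM' p pc hp p0 p1 hN hN' r rc hr r0 r1.
have hL := dsum_stage hM hN LE; have hL' := dsum_stage hM' hN' LE'.
apply: (path_of_stage hL hL').
have /choice[K KE] : forall t, exists K, mass_dsum Psi (umass (hp t)) (umass (hr t)) K.
  by move=> t; exact: dsum_ex.
have Ks t : mass_stage (bistage n) (K t).
  exact: dsum_stage (umass_stage (hp t)) (umass_stage (hr t)) (KE t).
have [g gK Kg] := Psi_bij.
have gl : linear g by move=> a w w'; apply: (bij_inj Psi_bij); rewrite linearP !Kg.
pose n' := bistage n.
pose f1 (x : 'cV[R]_(fd_dim (stg n))) := uprj n' (Psi (uinc x, 0)).
pose f2 (x : 'cV[R]_(fd_dim (stg n))) := uprj n' (Psi (0, uinc x)).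
pose q1 (x : 'cV[R]_(fd_dim (stg n'))) := uprj n (g (uinc x)).1.
pose q2 (x : 'cV[R]_(fd_dim (stg n'))) := uprj n (g (uinc x)).2.
pose rest (u : U) := mass0 W (u - uinc (uprj n u)).
pose c (x : 'cV[R]_(fd_dim (stg n'))) := uprj n' (Psi (rest (g (uinc x)).1, rest (g (uinc x)).2)).
have P1 a (x y : U) : Psi (a *: x + y, 0) = a *: Psi (x, 0) + Psi (y, 0).
  by rewrite -PsiZ -PsiD scaler0 addr0.
have P2 a (x y : U) : Psi (0, a *: x + y) = a *: Psi (0, x) + Psi (0, y).
  by rewrite -PsiZ -PsiD scaler0 addr0.
have f1l : linear f1 by move=> a x y; rewrite /f1 uinc_is_linear P1 uprj_is_linear.
have f2l : linear f2 by move=> a x y; rewrite /f2 uinc_is_linear P2 uprj_is_linear.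
have q1l : linear q1 by move=> a x y; rewrite /q1 uinc_is_linear gl /= uprj_is_linear.
have q2l : linear q2 by move=> a x y; rewrite /q2 uinc_is_linear gl /= uprj_is_linear.
have rl : linear rest by move=> a x y; rewrite /rest rest_linear linearP.
have cl : linear c.
  by move=> a x y; rewrite /c uinc_is_linear gl /= !rl PsiD PsiZ uprj_is_linear.
(* The block of the direct sum is affine in the blocks of its two terms, with constant coefficients;
   the tails contribute the constant [c]. Continuity follows. *)
have KB t : ublock n' (K t) =
    lin_matrix f1 *m p t *m lin_matrix q1 + lin_matrix f2 *m r t *m lin_matrix q2 + lin_matrix c.
  apply: mulmx_cV => x; rewrite -ublockE !mulmxDl -!mulmxA -!lin_matrixE //.
  rewrite -{1}(Kg (uinc x)) (surjective_pairing (g (uinc x))) KE /=.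
  rewrite /uop PsiD raddfD /=; congr (_ + _).
  rewrite -[X in Psi (X, _)]addr0 -[X in Psi (_, X)]add0r PsiD raddfD.
  by [].
exists (fun t => ublock n' (K t)); split.
- move=> t; have -> : (fun t => ublock n' (K t)) = (fun t => lin_matrix f1 *m p t *m lin_matrix q1 +
      lin_matrix f2 *m r t *m lin_matrix q2 + lin_matrix c) by apply/funext.
  apply: mx_cvgD; last exact: mx_cvg_cst.
  by apply: mx_cvgD; apply: mx_cvgM; try exact: mx_cvg_cst;
    apply: mx_cvgM; try exact: mx_cvg_cst; [exact: pc|exact: rc].
- by move=> t; exact: ublock_mass.
- congr ublock; apply/funext => w; rewrite -(Kg w) (surjective_pairing (g w)) KE LE /=.
  by rewrite p0 r0 !uop_ublock.
- congr ublock; apply/funext => w; rewrite -(Kg w) (surjective_pairing (g w)) KE LE' /=.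
  by rewrite p1 r1 !uop_ublock.
Qed.

Lemma dsum_signch X Y M N L : signch X M -> signch Y N -> mass_dsum Psi M N L ->
  signch (fd_add X Y) L.
Proof.
move=> [N1 [j [v [s f]]]] [N2 [j' [v' [s' f']]]] LE.
have [g gK Kg] := Psi_bij.
have gl : linear g by move=> a w w'; apply: (bij_inj Psi_bij); rewrite linearP !Kg.
have gact b w : g (ubact W b w) = (ubact W b (g w).1, ubact W b (g w).2).
  by apply: (bij_inj Psi_bij); rewrite Kg Psi_act -surjective_pairing Kg.
have [[ia ib ia' ib'] [ba ba' d1 d2 t]] := biprod_add X Y.
pose n := maxn N1 N2.
exists (bistage n), (fun x => Psi (j (fd_pr1 X Y *m x), j' (fd_pr2 X Y *m x))),
  (fun w => fd_in1 X Y *m v (g w).1 + fd_in2 X Y *m v' (g w).2).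
have pr1E w : fd_pr1 X Y *m (fd_in1 X Y *m v (g w).1 + fd_in2 X Y *m v' (g w).2) = v (g w).1.
  by rewrite mulmxDr !mulmxA ba d1 mul1mx mul0mx addr0.
have pr2E w : fd_pr2 X Y *m (fd_in1 X Y *m v (g w).1 + fd_in2 X Y *m v' (g w).2) = v' (g w).2.
  by rewrite mulmxDr !mulmxA ba' d2 mul1mx mul0mx add0r.
split; last first.
  move=> w; rewrite -{1}(Kg w) (surjective_pairing (g w)) LE f f' Psi_mass0 pr1E pr2E.
  congr (mass0 W _); rewrite PsiB PsiZ -surjective_pairing Kg //.
have t1 := usplit_widen s (leqnn 0) (leq_maxl N1 N2).
have t2 := usplit_widen s' (leqnn 0) (leq_maxr N1 N2).
split.
- move=> a x y; rewrite !mulmxDr -!scalemxAr (usj_lin s) (usj_lin s').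
  by rewrite PsiD PsiZ.
- move=> a x y; rewrite gl /= (usv_lin s) (usv_lin s') !mulmxDr -!scalemxAr scalerDr.
  by rewrite addrACA.
- by move=> b x; rewrite !mulmxA ib ib' -!mulmxA (usj_act s) (usj_act s') Psi_act.
- by move=> b w; rewrite gact /= (usv_act s) (usv_act s') !mulmxA ia ia' -!mulmxA mulmxDr.
- move=> x; rewrite gK /= (usK s) (usK s') !mulmxA -mulmxDl.
  by move: x t; move: (fd_in1 X Y *m _ + _) => e x t; rewrite t mul1mx.
- by move=> x k.
- by move=> x; apply: Psi_stage; [exact: (usj_stage t1)|exact: (usj_stage t2)].
- move=> w w0; have -> : w = 0 by apply/universeP => k; exact: w0.
  have -> : g 0 = 0 by apply: (bij_inj Psi_bij); rewrite Kg raddf0.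
  rewrite (usv_stage s) ?(usv_stage s') ?mulmx0 ?addr0 //.
- move=> w; rewrite -{1}(Kg w) => /Psi_tail[h1 h2].
  by rewrite (usv_tail t1 h1) (usv_tail t2 h2) !mulmx0 addr0.
Qed.
End DirectSums.

Lemma dependent_transport (A C : Type) (f : A -> C) (g : C -> A) (P : C -> Type)
    (y : forall a, P (f a)) : cancel f g -> cancel g f ->
  exists z : forall c, P c, forall a, z (f a) = y a.
Proof.
move=> fK gK; exists (fun c => eq_rect (f (g c)) P (y (g c)) c (gK c)) => a.
move: (gK (f a)); rewrite (fK a) => e.
by rewrite (Prop_irrelevance e erefl).
Qed.

(** * An isomorphism of two universes with one *)

Section SummandIso.
Variables (R : realType) (AV : superalgebra R).
Local Notation B := (stensor (Cl R 0 1) AV).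
Variable W : nat -> irrmod B.
Local Notation U := (univ W).
Local Notation dW k := (fd_dim (irr_mod (W k))).
Hypothesis W_universal : forall (S : irrmod B) n, exists k, (n <= k)%N /\ fd_iso S (W k).

Definition same (i k : nat) : bool := `[< fd_iso (W i) (W k) >].

Lemma samexx k : same k k. Proof. exact/asboolP/fd_iso_refl. Qed.
Lemma same_sym i k : same i k -> same k i.
Proof. by move=> /asboolP ik; apply/asboolP/fd_iso_sym. Qed.
Lemma same_trans i k l : same i k -> same k l -> same i l.
Proof. by move=> /asboolP ik /asboolP kl; apply/asboolP; exact: fd_iso_trans ik kl. Qed.
Lemma same_eq k l : same k l -> same^~ k =1 same^~ l.
Proof. by move=> kl i; apply/idP/idP => h; [exact: same_trans kl|exact: same_trans (same_sym kl)]. Qed.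

(** The position of [W k] within its isomorphism class. Class and position determine k, and every
    position occurs because each class occurs infinitely often. *)
Definition srank k := count (same^~ k) (iota 0 k).

Lemma iota_split k l : (k < l)%N -> iota 0 l = iota 0 k ++ k :: iota k.+1 (l - k.+1).
Proof. by move=> kl; rewrite -{1}(subnKC kl) addSnnS iotaD add0n. Qed.

Lemma srank_lt k l : same k l -> (k < l)%N -> (srank k < srank l)%N.
Proof.
move=> kl kl'; rewrite /srank (iota_split kl') count_cat -!(eq_count (same_eq kl)) /= samexx.
by rewrite -[X in (X < _)%N]addn0 ltn_add2l.
Qed.

Lemma srank_inj k l : same k l -> srank k = srank l -> k = l.
Proof.
move=> kl e; apply/eqP; case: ltngtP => // [/(srank_lt kl)|/(srank_lt (same_sym kl))];
  by rewrite e ltnn.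
Qed.

Lemma srank_ex n m : exists k, same k n /\ srank k = m.
Proof.
elim: m => [|m [k [kn km]]].
  have ex0 : exists k, same k n by exists n; exact: samexx.
  case: (ex_minnP ex0) => k kn kmin; exists k; split=> //.
  apply/eqP; rewrite /srank -leqn0 leqNgt -has_count; apply/hasPn => i.
  rewrite mem_iota add0n /= => ik; apply/negP => ik'.
  by have := kmin _ (same_trans ik' kn); rewrite leqNgt ik.
have exl : exists l, (k < l)%N && same l n.
  by have [l [kl /fd_iso_sym nl]] := W_universal (W n) k.+1; exists l; rewrite kl; apply/asboolP.
case: (ex_minnP exl) => l /andP[kl ln] lmin; exists l; split=> //.
have kl' : same k l := same_trans kn (same_sym ln).
rewrite /srank (iota_split kl) count_cat -!(eq_count (same_eq kl')) -/(srank k) km /= samexx.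
rewrite (@eq_in_count _ _ pred0) ?count_pred0 ?addn1 // => i; rewrite mem_iota subnKC // => /andP[ki il].
apply/negP => ik; have := lmin i; rewrite ki (same_trans ik kn) => /(_ isT).
by rewrite leqNgt il.
Qed.

(* The element of rank m of a class of summands is sent from the left copy to rank 2m, from
   the right copy to rank 2m+1. *)
Lemma sigma_ex : exists (sigma : nat + nat -> nat) tau,
  [/\ cancel sigma tau, cancel tau sigma & forall c, fd_iso (W (bicomp c)) (W (sigma c))].
Proof.
have /choice[E0 hE] : forall nm : nat * nat, exists k, same k nm.1 /\ srank k = nm.2.
  by move=> [n m]; exact: srank_ex.
pose E n m := E0 (n, m).
have Es n m : same (E n m) n by have [] := hE (n, m).
have Er n m : srank (E n m) = m by have [] := hE (n, m).
have Eu k n m : same k n -> srank k = m -> E n m = k.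
  move=> kn km; apply: srank_inj; last by rewrite Er.
  exact: same_trans (Es n m) (same_sym kn).
pose sigma c := match c with inl n => E n (srank n).*2 | inr n => E n (srank n).*2.+1 end.
pose tau k : nat + nat := if odd (srank k) then inr (E k (srank k)./2) else inl (E k (srank k)./2).
exists sigma, tau; split.
- case=> n; rewrite /tau /sigma Er /= odd_double /=.
    by congr inl; apply: Eu; rewrite ?doubleK //; exact/same_sym.
  by congr inr; apply: Eu; rewrite ?uphalf_double //; exact/same_sym.
- move=> k; rewrite /tau; case: ifP => o; rewrite /sigma Er; apply: Eu; try exact: same_sym.
    by rewrite -[LHS]odd_double_half o.
  by rewrite -[LHS]odd_double_half o.
- by case=> n /=; apply/fd_iso_sym/asboolP; exact: Es.
Qed.

(** Coordinate [k] of the image is coordinate [tau k] of the argument, carried over by a chosen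
    isomorphism of irreducible modules. *)
Lemma summand_iso_ex : exists Psi : {linear (U * U)%type -> U}, summand_iso Psi.
Proof.
have [sigma [tau [sK tK siso]]] := sigma_ex.
have exT : forall k, exists T : 'M[R]_(dW k, dW (bicomp (tau k))) * 'M[R]_(dW (bicomp (tau k)), dW k),
    [/\ @intertw R B (W (bicomp (tau k))) (W k) T.1, T.1 *m T.2 = 1%:M & T.2 *m T.1 = 1%:M].
  move=> k; have : fd_iso (W (bicomp (tau k))) (W k) by have := siso (tau k); rewrite tK.
  by case/fd_isoP=> P [Q [iP iQ PQ QP]]; exists (P, Q).
pose T0 k := sval (cid (exT k)).
have hT k : [/\ @intertw R B (W (bicomp (tau k))) (W k) (T0 k).1, (T0 k).1 *m (T0 k).2 = 1%:M
    & (T0 k).2 *m (T0 k).1 = 1%:M] by exact: svalP (cid (exT k)).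
clearbody T0.
pose f_comp (w : U * U) k : 'cV[R]_(dW k) := (T0 k).1 *m bisel (tau k) w.
have f_fin w : exists N, forall k, (N <= k)%N -> f_comp w k = 0.
  have [[N1 h1] [N2 h2]] := (ufin w.1, ufin w.2).
  exists (\max_(i < maxn N1 N2) maxn (sigma (inl (i : nat))) (sigma (inr (i : nat)))).+1 => k hk.
  rewrite /f_comp; have -> : bisel (tau k) w = 0; last by rewrite mulmx0.
  have big i : (i < maxn N1 N2)%N -> (k <> sigma (inl i)) /\ (k <> sigma (inr i)).
    move=> iN; have := leq_bigmax (F := fun i : 'I_(maxn N1 N2) => maxn (sigma (inl (i : nat))) (sigma (inr (i : nat)))) (Ordinal iN).
    move=> /= h; split=> e; move: (leq_ltn_trans h hk); rewrite e ltnNge.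
      by rewrite leq_maxl.
    by rewrite leq_maxr.
  case e : (tau k) => [i|i] /=.
    apply: h1; rewrite leqNgt; apply/negP => iN.
    by have [] := big i (leq_trans iN (leq_maxl _ _)); rewrite -e tK.
  apply: h2; rewrite leqNgt; apply/negP => iN.
  by have [_] := big i (leq_trans iN (leq_maxr _ _)); rewrite -e tK.
pose f w : U := Universe (f_fin w).
have fl : linear f.
  move=> r w w'; apply/universeP => k; rewrite ucompD ucompZ /= /f_comp.
  have -> : bisel (tau k) (r *: w + w') = r *: bisel (tau k) w + bisel (tau k) w' by case: (tau k).
  by rewrite mulmxDr scalemxAr.
pose Psi : {linear (U * U)%type -> U} := HB.pack f (GRing.isLinear.Build R (U * U)%type U _ f fl).
have PE w k : Psi w k = (T0 k).1 *m bisel (tau k) w by [].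
clearbody Psi; have sel0 w c : Psi w (sigma c) = 0 -> bisel c w = 0.
  rewrite PE => h; have [_ _ QP] := hT (sigma c).
  have := congr1 (mulmx (T0 (sigma c)).2) h; rewrite mulmxA QP mul1mx mulmx0.
  by rewrite sK.
have Pinj : injective Psi.
  move=> w w' e; apply: bisel_inj => c; apply/eqP; rewrite -subr_eq0 -biselB; apply/eqP/sel0.
  have -> : Psi (w - w') = Psi w - Psi w' by exact: raddfB.
  by rewrite e subrr.
have Psurj v : exists w, Psi w = v.
  have [z hz] := @dependent_transport _ _ tau sigma (fun c => 'cV[R]_(dW (bicomp c)))
    (fun k => (T0 k).2 *m v k) tK sK.
  have [N hN] := ufin v.
  pose K := (\max_(k < N) bicomp (tau k)).+1.
  have zK c : (K <= bicomp c)%N -> z c = 0.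
    move=> Kc; rewrite -(sK c) hz; have [sN|/hN ->] := ltnP (sigma c) N; last by rewrite mulmx0.
    have := leq_bigmax (F := fun k : 'I_N => bicomp (tau k)) (Ordinal sN).
    move=> h; exfalso; move: h; rewrite /= sK => h.
    by move: (leq_ltn_trans h Kc); rewrite ltnn.
  have f1 : exists M, forall n, (M <= n)%N -> z (inl n) = 0 by exists K => n Kn; exact: (zK (inl n)).
  have f2 : exists M, forall n, (M <= n)%N -> z (inr n) = 0 by exists K => n Kn; exact: (zK (inr n)).
  exists (Universe (ucomp := fun n => z (inl n)) f1, Universe (ucomp := fun n => z (inr n)) f2).
  apply/universeP => k; rewrite PE.
  have -> : bisel (tau k) (Universe (ucomp := fun n => z (inl n)) f1 : U, Universe (ucomp := fun n => z (inr n)) f2 : U) = z (tau k).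
    by case: (tau k).
  by rewrite hz mulmxA; have [_ -> _] := hT k; rewrite mul1mx.
have supp c w k : (forall c', c' <> c -> bisel c' w = 0) -> k <> sigma c -> Psi w k = 0.
  move=> h kc; rewrite PE h ?mulmx0 // => e; apply: kc; rewrite -e tK //.
have back c w : @usummand R B W (sigma c) (Psi w) -> forall c', c' <> c -> bisel c' w = 0.
  by move=> h c' cc; apply/sel0/h/eqP => e; apply: cc; exact: (can_inj sK).
exists Psi; split.
- have /choice[g hg] := Psurj; exists g => w; last exact: hg.
  by apply: Pinj; rewrite hg.
- move=> b u v; apply/universeP => k; rewrite ucomp_act !PE.
  have -> : bisel (tau k) (ubact W b u, ubact W b v) = fd_act (W (bicomp (tau k))) b *m bisel (tau k) (u, v).
    by case: (tau k).
  by rewrite mulmxA; have [-> _ _] := hT k; rewrite mulmxA.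
- exists sigma; split; first by exists tau.
  + move=> n; apply/seteqP; split=> [_ [u hu <-] k /eqP kn|v hv].
      apply: (@supp (inl n)) => // -[i|i] /= ci; last by [].
      by apply: hu; apply/eqP => e; apply: ci; rewrite e.
    have [[u u'] e] := Psurj v; have := @back (inl n) (u, u'); rewrite e => /(_ hv) h.
    have u'0 : u' = 0 by apply/universeP => k; exact: (h (inr k)).
    exists u; last by rewrite -e u'0.
    by move=> k /eqP kn; apply: (h (inl k)) => -[].
  + move=> n; apply/seteqP; split=> [_ [u hu <-] k /eqP kn|v hv].
      apply: (@supp (inr n)) => // -[i|i] /= ci; first by [].
      by apply: hu; apply/eqP => e; apply: ci; rewrite e.
    have [[u u'] e] := Psurj v; have := @back (inr n) (u, u'); rewrite e => /(_ hv) h.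
    have u0 : u = 0 by apply/universeP => k; exact: (h (inl k)).
    exists u'; last by rewrite -e u0.
    by move=> k /eqP kn; apply: (h (inr k)) => -[].
Qed.
End SummandIso.

(** * The classification isomorphism *)

Section Classification.
Variables (R : realType) (AV : superalgebra R).
Local Notation B := (stensor (Cl R 0 1) AV).
Local Notation B2 := (stensor (Cl R 0 2) AV).
Variable W : nat -> irrmod B.
Local Notation U := (univ W).
Hypothesis AV_decomp :
  forall a : AV, exists a0 a1, [/\ homog false a0, homog true a1 & a = a0 + a1].
Hypothesis ad1 : forall X : fdmod B, exists Y : fdmod B, fd_iso X Y /\ adapted Y.
Hypothesis ad2 : forall X : fdmod B2, exists Y : fdmod B2, fd_iso X Y /\ adapted Y.
Hypothesis W_universal : forall (S : irrmod B) n, exists k, (n <= k)%N /\ fd_iso S (W k).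

Lemma sign_map_ex : exists Phi : algclass AV -> pi0 W,
  bijective Phi /\ forall X M, signch X M -> Phi (algcls X) = pi0_of M.
Proof.
have /choice[m hm] : forall x : algclass AV, exists M : mass W, exists X, algcls X = x /\ signch X M.
  move=> x; have [X Xx] := algcls_surj AV_decomp ad1 ad2 x.
  have [M hM] := signch_ex AV_decomp ad1 W_universal X.
  by exists M, X.
pose Phi x := pi0_of (m x).
have PhiE X M : signch X M -> Phi (algcls X) = pi0_of M.
  move=> hM; apply/pi0_ofP; have [Y [YX hY]] := hm (algcls X).
  exact: signch_algcls AV_decomp ad1 ad2 W_universal _ _ _ _ YX hY hM.
have Pinj : injective Phi.
  move=> x y; have [X [<- hX]] := hm x; have [Y [<- hY]] := hm y => /pi0_ofP xy.
  exact: (signch_inj AV_decomp ad1 ad2 hX hY xy).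
have Psurj P : exists x, Phi x = P.
  have [M ->] := pi0_ofE P; have [X [L [hL ML]]] := signch_surj AV_decomp ad1 M.
  by exists (algcls X); rewrite (PhiE _ _ hL); apply/pi0_ofP/path_sym.
exists Phi; split=> //; have /choice[g hg] := Psurj; exists g => P; last exact: hg.
by apply: Pinj; rewrite hg.
Qed.

Lemma algcls_zero : algcls (fd_zero B) = 0 :> algclass AV.
Proof.
have := algcls_iso AV_decomp ad1 (fd_add_dim0 (fd_zero B) (X := fd_zero B) erefl).
by rewrite (algclsD AV_decomp ad1) => /eqP; rewrite -subr_eq0 addrK => /eqP.
Qed.

Lemma signch_zero : signch (fd_zero B) (base_mass W).
Proof.
exists 0%N, (fun=> 0), (fun=> 0); split; first exact: usplit_zero.
by move=> w; rewrite scaler0 subr0.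
Qed.

(** The operation is transported from [algclass] along [Phi], so the group laws are inherited; the
    content is that direct sums of masses induce it. *)
Lemma sign_map_group (Phi : algclass AV -> pi0 W) (Psi : {linear (U * U)%type -> U}) :
  bijective Phi -> (forall X M, signch X M -> Phi (algcls X) = pi0_of M) -> summand_iso Psi ->
  exists add : pi0 W -> pi0 W -> pi0 W,
    [/\ (forall M N : mass W, exists L : mass W,
           mass_dsum Psi M N L /\ add (pi0_of M) (pi0_of N) = pi0_of L),
        [/\ associative add, commutative add,
            left_id (pi0_of (base_mass W)) add
          & exists opp : pi0 W -> pi0 W,
              left_inverse (pi0_of (base_mass W)) opp add]
      & {morph Phi : x y / x + y >-> add x y}].
Proof.
move=> [g gK Kg] PhiE [Pbij Pact [sigma [sbij s1 s2]]].
have sP c x : @usummand R B W (sigma c) (Psi (@biinj R AV W c x)).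
  have us k (y : 'cV[R]_(fd_dim (W k))) : @usummand R B W k (usingle y).
    by move=> n /eqP; exact: usingle_ne.
  case: c x => k x /=.
    by rewrite -s1; exists (usingle x).
  by rewrite -s2; exists (usingle x).
have base0 : pi0_of (base_mass W) = Phi 0.
  by rewrite -algcls_zero (PhiE _ _ signch_zero).
exists (fun P Q => Phi (g P + g Q)); split; first 1 last.
- rewrite base0; split.
  + by move=> P Q K; rewrite !gK addrA.
  + by move=> P Q; rewrite addrC.
  + by move=> P; rewrite gK add0r Kg.
  + by exists (fun P => Phi (- g P)) => P; rewrite gK addNr.
- by move=> x y; rewrite !gK.
move=> M N; have [L hL] := dsum_ex Pbij Pact (bij_inj sbij) sP M N.
exists L; split=> //.
(* Both masses are moved within their components to sign changes, whose direct sum is a sign change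
   on the sum of the modules. *)
have [X [M0 [hM0 MM0]]] := signch_surj AV_decomp ad1 M.
have [Y [N0 [hN0 NN0]]] := signch_surj AV_decomp ad1 N.
have [L0 hL0] := dsum_ex Pbij Pact (bij_inj sbij) sP M0 N0.
have -> : pi0_of M = Phi (algcls X) by rewrite (PhiE _ _ hM0); apply/pi0_ofP.
have -> : pi0_of N = Phi (algcls Y) by rewrite (PhiE _ _ hN0); apply/pi0_ofP.
rewrite !gK -(algclsD AV_decomp ad1).
rewrite (PhiE _ _ (dsum_signch Pbij Pact (bij_inj sbij) sP hM0 hN0 hL0)).
by apply/pi0_ofP/path_sym; exact: (dsum_path Pbij Pact (bij_inj sbij) sP MM0 NN0 hL hL0).
Qed.
End Classification.

Local Close Scope quotient_scope.
Local Close Scope classical_set_scope.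

Theorem mainTheorem1 (R : realType) (gT : finGroupType) (D : symmetry_data R gT)
  (q : nat) (rV : mx_representation R [set: gT] q)
  (rV_orthogonal : forall g : gT, (rV g)^T *m rV g = 1%:M)
  (W : nat -> irrmod (stensor (Cl R 0 1) (dirac_alg D rV)))
  (W_universal : forall (S : irrmod (stensor (Cl R 0 1) (dirac_alg D rV))) (n : nat),
     exists k : nat, (n <= k)%N /\ fd_iso S (W k)) :
  let AV := dirac_alg D rV in
  let B := stensor (Cl R 0 1) AV in
  [/\ (forall X : fdmod B,
         exists j : 'cV[R]_(fd_dim X) -> univ W, module_embedding j),
      (forall (X : fdmod B) (j : 'cV[R]_(fd_dim X) -> univ W),
         module_embedding j ->
         exists (C : set (univ W)) (M : mass W), sign_change j C M)
    & exists Phi : algclass AV -> pi0 W,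
      [/\ bijective Phi,
          (forall (X : fdmod B) (j : 'cV[R]_(fd_dim X) -> univ W)
              (C : set (univ W)) (M : mass W),
             module_embedding j -> sign_change j C M ->
             Phi (algcls X) = pi0_of M)
        & (exists Psi : {linear (univ W * univ W)%type -> univ W},
             summand_iso Psi) /\
          (forall Psi : {linear (univ W * univ W)%type -> univ W},
             summand_iso Psi ->
             exists add : pi0 W -> pi0 W -> pi0 W,
               [/\ (forall M N : mass W, exists L : mass W,
                      mass_dsum Psi M N L /\
                      add (pi0_of M) (pi0_of N) = pi0_of L),
                   [/\ associative add, commutative add,
                       left_id (pi0_of (base_mass W)) add
                     & exists opp : pi0 W -> pi0 W,
                         left_inverse (pi0_of (base_mass W)) opp add]
                 & {morph Phi : x y / x + y >-> add x y}])]].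
Proof.
move=> AV B.
have dec := @dirac_decomp R gT D q rV.
have ad1 := @dirac_adapted R gT D q rV 0 1.
have ad2 := @dirac_adapted R gT D q rV 0 2.
split.
- exact: (embedding_ex dec ad1 W_universal).
- exact: (sign_change_ex dec ad1).
have [Phi [Phi_bij PhiE]] := sign_map_ex dec ad1 ad2 W_universal.
exists Phi; split=> //.
  by move=> X j C M hj hM; apply: PhiE; exact: sign_change_signch hj hM.
split; first exact: summand_iso_ex.
by move=> Psi hPsi; exact: sign_map_group Phi_bij PhiE hPsi.
Qed.
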